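(* Let $(\vartheta_0,D_4,D_3)$ be one of the triples $(0.729,1,2)$, $(0.616,3,6)$, $(0.554,4,8)$, $(0.515,7,12)$, and suppose some $\vartheta>\vartheta_0$ satisfies both conditions (A) and (B) below. Then at least one of the following holds: (i) there exists an integer $d$ with $0<|d|\le D_4$ such that $\lambda(p+d)=-1$ for infinitely many primes $p$; (ii) $\liminf_{n\to\infty}(p_{n+1}-p_n)\le D_3$.
   Context: $p_n$ is the $n$-th prime. $\Omega(n)$ is the number of prime factors of $n$ counted with multiplicity and $\lambda(n)=(-1)^{\Omega(n)}$. Condition (A): for every $\varepsilon>0$, $A>0$, $\sum_{q\le N^{\vartheta-\varepsilon}}\max_{a:(a,q)=1}\bigl|\sum_{p\le N,\,p\equiv a\ (\mathrm{mod}\ q)}\log p-\frac{N}{\varphi(q)}\bigr|\ll_{\varepsilon,A}\frac{N}{(\log N)^A}$ ($p$ over primes). Condition (B): for every $\varepsilon>0$, $A>0$, $\sum_{q\le N^{\vartheta-\varepsilon}}\max_{y\le N}\max_a\bigl|\sum_{n\le y,\,n\equiv a\ (\mathrm{mod}\ q)}\lambda(n)\bigr|\ll_{\varepsilon,A}\frac{N}{(\log N)^A}$. *)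

(* Defs.v *)
From Stdlib Require Import Reals ZArith.
From Coquelicot Require Import Coquelicot.
From mathcomp Require Import all_boot.

Set Implicit Arguments.
Unset Strict Implicit.

Open Scope R_scope.

Definition sumR (l : seq R) : R := foldr Rplus 0 l.
(* max of a list of nonnegative reals (0 for the empty list). *)
Definition maxR (l : seq R) : R := foldr Rmax 0 l.

Definition bigOmega (n : nat) : nat := (\sum_(p <- primes n) logn p n)%N.
Definition liouville (n : nat) : R := (-1) ^ bigOmega n.

Definition qs_upto (X : R) : seq nat :=
  [seq q <- iota 1 (Z.to_nat (up X)) | (if Rle_dec (INR q) X then true else false)].

Definition theta_ap (N q a : nat) : R :=
  sumR [seq ln (INR p) | p <- iota 1 N & prime p && (p %% q == a %% q)%N].

Definition liouville_ap (y q a : nat) : R :=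
  sumR [seq liouville n | n <- iota 1 y & (n %% q == a %% q)%N].

Definition condA (theta : R) : Prop :=
  forall eps A : R, 0 < eps -> 0 < A ->
  exists C : R, exists N0 : nat, forall N : nat, (N0 <= N)%N ->
    sumR [seq maxR [seq Rabs (theta_ap N q a - INR N / INR (totient q))
                   | a <- iota 0 q & coprime a q]
         | q <- qs_upto (Rpower (INR N) (theta - eps))]
    <= C * INR N / Rpower (ln (INR N)) A.

Definition condB (theta : R) : Prop :=
  forall eps A : R, 0 < eps -> 0 < A ->
  exists C : R, exists N0 : nat, forall N : nat, (N0 <= N)%N ->
    sumR [seq maxR [seq maxR [seq Rabs (liouville_ap y q a) | a <- iota 0 q]
                   | y <- iota 0 N.+1]
         | q <- qs_upto (Rpower (INR N) (theta - eps))]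
    <= C * INR N / Rpower (ln (INR N)) A.

(* The next prime after m (a prime exists in (m, m + m!]). *)
Definition next_prime (m : nat) : nat :=
  nth 0%N [seq x <- iota m.+1 (m`!) | prime x] 0.

(* nth_prime k = p_{k+1}: nth_prime 0 = 2, nth_prime 1 = 3, ... *)
Fixpoint nth_prime (k : nat) : nat :=
  match k with
  | 0 => 2
  | k'.+1 => next_prime (nth_prime k')
  end.

(* prime gap sequence p_{n+1} - p_n (index shifted by one, which does not
   affect the liminf). *)
Definition prime_gap (n : nat) : R := INR (nth_prime n.+1 - nth_prime n).

(* Main.v *)
Require Import Defs.
From Stdlib Require Import Reals ZArith Lra Lia Classical.
From Coquelicot Require Import Coquelicot.
From mathcomp Require Import all_boot all_order all_algebra.
From mathcomp Require Import Rstruct.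
From mathcomp Require Import ring lra zify.

(** Let [H] be an admissible [k]-tuple ([{0,2}], [{0,2,6}], [{0,2,6,8}],
    [{0,2,6,8,12}]) and [c0] a shift close to all elements of [H].  With Selberg
    weights [w(n)^2] of dimension [k] attached to [prod_(h in H) (n + h)], consider
      [sum_(N < n <= 2N) (sum_h theta(n+h) - log(3N)/2 * (1 + lambda(n+c0))) * w(n)^2].
    By (A) and (B) the sum over primes has its expected main term and the
    [lambda]-part is negligible, so the negative part costs only half of what it
    costs in the Goldston-Pintz-Yildirim argument, and the sum is positive when the
    level of distribution exceeds [theta0].  A positive term yields either two primes
    among the [n + h], or a prime [n + h] with [lambda(n+c0) = -1].

    Squarefree moduli are represented by finite sets [D] of primes in [(D0, B^m]],
    with [n] confined to a reduced residue class modulo [W = D0!].  The Selberg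
    variables are [y_D = f i] when the product of [D] lies in [(B^(i-1), B^i]], so that
    all main terms are finite sums over [i], bounded by Abel summation from
    one-sided bounds of the dimension-one sums; no asymptotic evaluation of
    multiplicative sums is needed.  Taking [N = B^M] makes the ratio [2m/M] of the
    logarithms exact, and the final inequality is a computation with integers. *)

(** The factor [(1 + lambda(n+c0)) / 2] is 0 or 1. Where it is 0, one prime makes the term positive;
    where it is 1, the penalty log(3N) is at least what one prime contributes, since n + h <= 3N.
    Put t = i/m and theta = 2m/M. For large m and small e the inequality to be checked becomes theta
    k int_0^1 (int_t^1 f)^2 t^(k-2)/(k-2)! dt > int_0^1 f(t)^2 t^(k-1)/(k-1)! dt. The best f turns
    this into theta > j^2 / (4k(k-1)), j being the first positive zero of the Bessel function
    J_(k-2): about 0.7229, 0.6117, 0.5495, 0.5088 for k = 2, 3, 4, 5. The distance from there to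
    theta0 pays for a quadratic f, for the discretisation and for e. Sieving only by primes above D0
    keeps the correcting Euler products close to 1, so no singular series has to be computed. The
    parameters are fixed in the order e, D0, then B tending to infinity. *)

Set Implicit Arguments.
Unset Strict Implicit.
Unset Printing Implicit Defensive.

Import Order.TTheory GRing.Theory Num.Theory.
Local Open Scope ring_scope.

(** * Multiplicative functions on finite sets and the Selberg quadratic form *)

Section SetSums.
Variables (F : realFieldType) (T : finType).
Implicit Types (g h a b : T -> F) (D E S : {set T}).

Definition mprod g D : F := \prod_(t in D) g t.

Lemma mprod0 g : mprod g set0 = 1.
Proof. by rewrite /mprod big_set0. Qed.

Lemma mprodU g D E : [disjoint D & E] -> mprod g (D :|: E) = mprod g D * mprod g E.
Proof.
move=> dDE; rewrite /mprod -bigU //; apply: eq_bigl => t.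
by rewrite !inE.
Qed.

Lemma mprodM g h D : mprod (fun t => g t * h t) D = mprod g D * mprod h D.
Proof. exact: big_split. Qed.

Lemma mprodV g D : mprod (fun t => (g t)^-1) D = (mprod g D)^-1.
Proof. by rewrite /mprod prodfV. Qed.

Lemma mprod_ge0 g D : (forall t, 0 <= g t) -> 0 <= mprod g D.
Proof. by move=> g0; apply: prodr_ge0. Qed.

Lemma mprod_gt0 g D : (forall t, 0 < g t) -> 0 < mprod g D.
Proof. by move=> g0; apply: prodr_gt0. Qed.

Lemma le_mprod g h D : (forall t, 0 <= g t <= h t) -> mprod g D <= mprod h D.
Proof. by move=> gh; apply: ler_prod. Qed.

Lemma eq_mprod g h D : (forall t, g t = h t) -> mprod g D = mprod h D.
Proof. by move=> gh; apply: eq_bigr. Qed.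

Lemma mprod_const (c : F) D : mprod (fun=> c) D = c ^+ #|D|.
Proof. by rewrite /mprod prodr_const. Qed.

Lemma sum_set_split D (f : {set T} -> F) :
  \sum_S f S = \sum_(E : {set T} | E \subset D) \sum_(G : {set T} | [disjoint G & D]) f (E :|: G).
Proof.
rewrite pair_big_dep /=.
rewrite (reindex_onto (fun x : {set T} * {set T} => x.1 :|: x.2)
                      (fun S => (S :&: D, S :\: D))) /=; last first.
  by move=> S _; rewrite setID.
apply: eq_bigl => -[E G] /=; rewrite xpair_eqE.
apply/andP/andP => [[/eqP <- /eqP <-]|[sED dGD]].
  by split; [exact: subsetIr | rewrite disjoint_sym disjoints_subset setCD subsetUr].
have GD0 : G :&: D = set0 by apply/eqP; rewrite setI_eq0.
by rewrite setIUl setDUl GD0 setU0 (setIidPl sED) (eqP (_ : E :\: D == set0)) ?setD_eq0 // set0U (setDidPl dGD).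
Qed.

Lemma mprodD a b D :
  mprod (fun t => a t + b t) D
  = \sum_(E : {set T} | E \subset D) mprod a E * mprod b (D :\: E).
Proof.
rewrite /mprod big_mkcond /=.
pose a' t := if t \in D then a t else 0; pose b' t := if t \in D then b t else 1.
rewrite (eq_bigr (fun t => a' t + b' t)); last first.
  by move=> t _; rewrite /a' /b'; case: ifP; rewrite ?add0r.
rewrite bigA_distr (bigID (fun E : {set T} => E \subset D)) /= [X in _ + X]big1 ?addr0.
  apply: eq_bigr => E sED.
  rewrite (bigID (mem E)) /= (big_mkcond (fun t => t \in D :\: E)) /=.
  congr (_ * _); first by apply: eq_bigr => t tE; rewrite tE /a' (subsetP sED).
  rewrite [LHS]big_mkcond; apply: eq_bigr => t _; rewrite in_setD /b'.
  by case: (t \in E).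
move=> E /subsetPn [t tE tD]; rewrite (bigD1 t) //= tE /a' (negbTE tD) mul0r //.
Qed.

Lemma mprod1D b D : mprod (fun t => 1 + b t) D = \sum_(E : {set T} | E \subset D) mprod b E.
Proof.
rewrite (reindex_onto (fun E => D :\: E) (fun E => D :\: E)) /=; last first.
  by move=> E sED; rewrite setDDr setDv set0U (setIidPr sED).
rewrite mprodD; apply: eq_big => [E|E _]; last by rewrite mprod_const expr1n mul1r.
rewrite subsetDl /= setDDr setDv set0U.
by apply/idP/eqP => [/setIidPr|<-]; rewrite ?subsetIl.
Qed.

Lemma sum_mprod b : \sum_E mprod b E = \prod_t (1 + b t).
Proof.
have := mprod1D b setT; rewrite /mprod.
rewrite (eq_bigl xpredT) => [->|t]; last by rewrite in_setT.
by apply: eq_bigl => E; rewrite subsetT.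
Qed.

(* Dropping the condition [disjoint G & D] costs the factor [prod_(t in D) (1 + b t)]:
   split every set into its parts inside and outside [D]. *)
Lemma sum_disjoint_ge b D (y : {set T} -> F) (z : {set T} -> F) :
  (forall t, 0 <= b t) ->
  (forall E (G : {set T}), E \subset D -> [disjoint G & D] -> z (E :|: G) <= y G) ->
  \sum_S mprod b S * z S
   <= mprod (fun t => 1 + b t) D * \sum_(G : {set T} | [disjoint G & D]) mprod b G * y G.
Proof.
move=> b0 zy; rewrite (sum_set_split D) mprod1D mulr_suml.
apply: ler_sum => E sED; rewrite mulr_sumr; apply: ler_sum => G dGD.
rewrite mprodU; last first.
  by rewrite disjoint_sym; apply: disjointWr sED dGD.
rewrite -mulrA ler_wpM2l ?mprod_ge0 // ler_wpM2l ?mprod_ge0 //; exact: zy.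
Qed.

Lemma sum_disjoint_le b D (y : {set T} -> F) (z : {set T} -> F) :
  (forall t, 0 <= b t) ->
  (forall E (G : {set T}), E \subset D -> [disjoint G & D] -> y G <= z (E :|: G)) ->
  mprod (fun t => 1 + b t) D * \sum_(G : {set T} | [disjoint G & D]) mprod b G * y G
   <= \sum_S mprod b S * z S.
Proof.
move=> b0 zy; rewrite (sum_set_split D) mprod1D mulr_suml.
apply: ler_sum => E sED; rewrite mulr_sumr; apply: ler_sum => G dGD.
rewrite mprodU; last first.
  by rewrite disjoint_sym; apply: disjointWr sED dGD.
rewrite -mulrA ler_wpM2l ?mprod_ge0 // ler_wpM2l ?mprod_ge0 //; exact: zy.
Qed.

(** A set of primes stands for a squarefree number, so [D :|: E] is a least common multiple. This is
    the main term of a sum of squared sieve weights when [g] is the density of the sifted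
    classes. *)
Definition quad_form g (lam : {set T} -> F) : F :=
  \sum_D \sum_E lam D * lam E * mprod g (D :|: E).

(** Selberg's diagonalisation: [g] of a union is [g D * g E / g (D :&: E)], and the last inverse is
    a product of factors [1 + 1/h], which expands over the subsets [S] of both [D] and [E]. *)
Lemma quad_form_diag g h (lam : {set T} -> F) :
  (forall t, 0 < g t) -> (forall t, 0 < h t) -> (forall t, (g t)^-1 = 1 + (h t)^-1) ->
  quad_form g lam
  = \sum_S (mprod h S)^-1 * (\sum_(D : {set T} | S \subset D) mprod g D * lam D) ^+ 2.
Proof.
move=> g0 h0 gh.
have gU D E : mprod g (D :|: E)
   = mprod g D * mprod g E * \sum_(S : {set T} | S \subset D :&: E) (mprod h S)^-1.
  under eq_bigr => S _ do rewrite -mprodV.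
  rewrite -mprod1D -(eq_mprod _ gh) mprodV.
  have dDE : [disjoint D :\: E & E].
    by rewrite disjoint_sym disjoints_subset setCD subsetUr.
  have dDE' : [disjoint D :\: E & D :&: E] by apply: disjointWr dDE; rewrite subsetIr.
  have -> : D :|: E = (D :\: E) :|: E 
    by apply/setP => t; rewrite !inE; case: (t \in E); rewrite ?orbT ?orbF.
  rewrite (mprodU _ dDE) -[in mprod g D](setID D E) setUC (mprodU _ dDE').
  have := lt0r_neq0 (mprod_gt0 (D :&: E) g0); set x := mprod g _ => x0.
  by field.
rewrite /quad_form; under eq_bigr => D _ do under eq_bigr => E _ do rewrite gU.
transitivity (\sum_(D : {set T}) \sum_(E : {set T}) \sum_(S : {set T} | (S \subset D) && (S \subset E))
   (mprod h S)^-1 * ((mprod g D * lam D) * (mprod g E * lam E))).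
  apply: eq_bigr => D _; apply: eq_bigr => E _; rewrite !mulr_sumr.
  by apply: eq_big => [S|S _]; [rewrite subsetI | ring].
transitivity (\sum_(S : {set T}) \sum_(D : {set T} | S \subset D) \sum_(E : {set T} | S \subset E)
   (mprod h S)^-1 * ((mprod g D * lam D) * (mprod g E * lam E))).
  rewrite [RHS](exchange_big_dep xpredT) //=; apply: eq_bigr => D _.
  rewrite [RHS](exchange_big_dep xpredT) //=.
apply: eq_bigr => S _; rewrite expr2 mulr_suml mulr_sumr.
by apply: eq_bigr => D _; rewrite !mulr_sumr.
Qed.

(** Möbius inversion of Selberg's change of variables: the sign in the first product is the Möbius
    function, and the [y S] are, up to sign and a factor [h], the diagonal variables for [g]. *)
Definition selberg g h (y : {set T} -> F) D : F :=
  mprod (fun t => - (g t)^-1) D * \sum_(S : {set T} | D \subset S) mprod h S * y S.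

(** The same weights enter two quadratic forms. The factor [u] covers both: [u = 1] recovers the
    diagonal variables for [g], and [u = g'/g] gives those for the density [g'] of the sum over
    primes. After exchanging sums, the sum over [D] between [S] and [X] factors into [-u] on [S] and
    [1 - u] on [X :\: S]. *)
Lemma selberg_inv g h u (y : {set T} -> F) S :
  (forall t, 0 < g t) ->
  \sum_(D : {set T} | S \subset D) mprod (fun t => u t * g t) D * selberg g h y D
  = mprod (fun t => - u t * h t) S
    * \sum_(G : {set T} | [disjoint G & S]) mprod (fun t => h t * (1 - u t)) G * y (S :|: G).
Proof.
move=> g0.
transitivity (\sum_(D : {set T} | S \subset D) \sum_(X : {set T} | D \subset X)
   mprod (fun t => - u t) D * (mprod h X * y X)).
  apply: eq_bigr => D _; rewrite /selberg mulrA -mprodM mulr_sumr.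
  apply: eq_bigr => X _; congr (_ * _); apply: eq_mprod => t.
  by have := lt0r_neq0 (g0 t) => ?; field.
rewrite (exchange_big_dep (fun X : {set T} => S \subset X)) /=; last first.
  by move=> D X; apply: subset_trans.
transitivity (\sum_(X : {set T} | S \subset X)
   mprod (fun t => - u t) S * mprod (fun t => 1 - u t) (X :\: S) * (mprod h X * y X)).
  apply: eq_bigr => X sSX; rewrite -mulr_suml; congr (_ * _).
  rewrite mprod1D mulr_sumr.
  rewrite (reindex_onto (fun E => S :|: E) (fun D => D :\: S)) /=; last first.
    by move=> D /andP[sSD sDX]; rewrite -[RHS](setID D S) (setIidPr sSD).
  apply: eq_big => [E|E /andP[_ /eqP eE]].
    rewrite subsetUl subUset sSX /= subsetD setDUl setDv set0U.
    by case: (E \subset X) => //=; apply/eqP/idP => /setDidPl.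
  by rewrite mprodU // -eE disjoint_sym disjoints_subset setDE subsetIr.
rewrite mulr_sumr.
rewrite (reindex_onto (fun E => S :|: E) (fun D => D :\: S)) /=; last first.
  by move=> D sSD; rewrite -[RHS](setID D S) (setIidPr sSD).
apply: eq_big => [E|E /andP[_ /eqP eE]].
  rewrite subsetUl /= setDUl setDv set0U.
  by apply/eqP/idP => /setDidPl.
rewrite eE mprodU; last first.
  by rewrite -eE disjoint_sym disjoints_subset setDE subsetIr.
by rewrite !mprodM; ring.
Qed.

End SetSums.

(** * Sums of multiplicative functions of given dimension *)

Lemma sum_bin_diag j J : (\sum_(l < J.+1) 'C(l + j, j) = 'C(J + j.+1, j.+1))%N.
Proof.
elim: J => [|J IH]; first by rewrite big_ord_recl big_ord0 !add0n !binn.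
by rewrite big_ord_recr /= IH [in RHS]addSn binS addSnnS.
Qed.

Lemma sum_bin_col j J : (\sum_(l < J) 'C(l, j) = 'C(J, j.+1))%N.
Proof. by elim: J => [|J IH]; rewrite ?big_ord0 // big_ord_recr /= IH binS addnC. Qed.

(** * Partial summation *)

Section Abel.
Variables (F : realFieldType).

Lemma sum_ind (I : finType) (P : pred I) (w : I -> F) :
  \sum_(x | P x) w x = \sum_x w x * (P x)%:R.
Proof. by rewrite big_mkcond; apply: eq_bigr => x _; case: (P x); rewrite ?mulr1 ?mulr0. Qed.

(** As [G] vanishes beyond [J], each value [G n] is the telescoping sum of the drops [G i - G i.+1]
    over n <= i <= J. *)
Lemma abel_sum (I : finType) (w : I -> F) (c : I -> nat) (G : nat -> F) J :
  (forall i, (J < i)%N -> G i = 0) ->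
  \sum_x w x * G (c x) = \sum_(i < J.+1) (G i - G i.+1) * \sum_(x | (c x <= i)%N) w x.
Proof.
move=> GJ.
have layer n : G n = \sum_(i < J.+1) (G i - G i.+1) * (n <= i)%N%:R.
  rewrite -(@sum_ind _ (fun i : 'I_J.+1 => (n <= i)%N)) -(big_mkord (fun i => (n <= i)%N) (fun i => G i - G i.+1)).
  have [nJ|Jn] := leqP n J.+1.
    rewrite (@big_cat_nat _ _ _ n) //= big_nat_cond big1 => [|i]; last by lia.
    rewrite add0r big_nat_cond (eq_bigl (fun i => (n <= i < J.+1)%N)) => [|i]; last by lia.
    rewrite -big_nat (eq_bigr (fun i => - G i.+1 - - G i)) => [|i _]; last by ring.
    by rewrite telescope_sumr // (GJ J.+1) // oppr0 add0r opprK.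
  rewrite big_nat_cond big1 ?GJ // => [|i]; lia.
under eq_bigr => x _ do rewrite layer mulr_sumr.
rewrite exchange_big; apply: eq_bigr => i _ /=.
by rewrite [in RHS]sum_ind mulr_sumr; apply: eq_bigr => x _; ring.
Qed.

(** For a nonincreasing [G] all drops are nonnegative, so an inequality between cumulative masses
    passes to the weighted sums. In each use one side is a model mass on the integers. *)
Lemma abel_comp (I I' : finType) (w : I -> F) (c : I -> nat) (w' : I' -> F) (c' : I' -> nat)
    (G : nat -> F) J :
  (forall i, G i.+1 <= G i) -> (forall i, (J < i)%N -> G i = 0) ->
  (forall i, (i <= J)%N -> \sum_(x | (c x <= i)%N) w x <= \sum_(x | (c' x <= i)%N) w' x) ->
  \sum_x w x * G (c x) <= \sum_x w' x * G (c' x).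
Proof.
move=> Gd GJ ww'; rewrite !(abel_sum _ _ GJ); apply: ler_sum => i _.
by rewrite ler_wpM2l ?subr_ge0 // ww' // -ltnS.
Qed.

Lemma sum_ord_le (v : nat -> F) J i : (i <= J)%N ->
  \sum_(l < J.+1 | (l <= i)%N) v l = \sum_(l < i.+1) v l.
Proof. by move=> iJ; rewrite (big_ord_widen J.+1 v) //. Qed.

Lemma sum_ord_lt (v : nat -> F) J i : (i <= J)%N ->
  \sum_(l < J | (l.+1 <= i)%N) v l = \sum_(l < i) v l.
Proof. by move=> iJ; rewrite (big_ord_widen J v). Qed.

Lemma nonincr_le (G : nat -> F) : (forall i, G i.+1 <= G i) ->
  forall i j, (i <= j)%N -> G j <= G i.
Proof. by move=> Gd i j; apply: (homo_leq (r := fun x y => y <= x)) => // x y z h1 h2; apply: le_trans h2 h1. Qed.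

End Abel.

Section Dim.
Variables (F : realFieldType) (T : finType) (pr : T -> nat) (kk B : nat).
Hypotheses (kk0 : (0 < kk)%N) (prk : forall t, (kk < pr t)%N) (B1 : (1 < B)%N).

Implicit Types (D E S G : {set T}).

Definition qprod D : nat := (\prod_(t in D) pr t)%N.
Definition log_cell n := up_log B n.

Lemma qprod_gt0 D : (0 < qprod D)%N.
Proof. by rewrite prodn_gt0 // => t; apply: leq_ltn_trans (prk t). Qed.

Lemma qprod0 : qprod set0 = 1%N. Proof. by rewrite /qprod big_set0. Qed.

Lemma qprodU D E : [disjoint D & E] -> qprod (D :|: E) = (qprod D * qprod E)%N.
Proof. by move=> dDE; rewrite /qprod -bigU //; apply: eq_bigl => t; rewrite !inE. Qed.

Lemma log_cell_le n i : (log_cell n <= i)%N = (n <= B ^ i)%N.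
Proof.
apply/idP/idP => h; last exact: up_log_min.
by apply: leq_trans (up_logP n B1) _; rewrite leq_exp2l.
Qed.

Lemma log_cellM_le m n : (log_cell (m * n) <= log_cell m + log_cell n)%N.
Proof. by rewrite log_cell_le expnD leq_mul // up_logP. Qed.

Lemma sum_mprodD (a b : T -> F) (X : {set T} -> F) :
  \sum_D mprod (fun t => a t + b t) D * X D
  = \sum_(E : {set T}) \sum_(G : {set T} | [disjoint G & E]) mprod a E * mprod b G * X (E :|: G).
Proof.
under eq_bigr => D _ do rewrite mprodD mulr_suml.
rewrite (exchange_big_dep xpredT) //=; apply: eq_bigr => S _.
rewrite (reindex_onto (fun E => S :|: E) (fun D => D :\: S)) /=; last first.
  by move=> D sSD; rewrite -[RHS](setID D S) (setIidPr sSD).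
apply: eq_big => [E|E /andP[_ /eqP ->] //].
rewrite subsetUl /= setDUl setDv set0U.
by apply/eqP/idP => /setDidPl.
Qed.

(** The binomial is the discrete form of J^j / j!. Writing [j.+1 = j + 1] at each prime splits [D]
    into two disjoint parts; disjointness is dropped because the terms are nonnegative, and the part
    of dimension one is summed by Abel summation. Its size is rounded down with [trunc_log], so the
    room left to the other part is overestimated. *)
Lemma upper_dim (psi : T -> F) (kap : F) :
  (forall t, 0 <= psi t) -> 0 <= kap ->
  (forall i, \sum_(D | (qprod D < B ^ i.+1)%N) mprod psi D <= kap * i.+1%:R) ->
  forall j J, \sum_(D | (qprod D <= B ^ J)%N) mprod (fun t => j%:R * psi t) D
              <= kap ^+ j * 'C(J + j, j)%:R.
Proof.
move=> psi0 kap0 H1; elim=> [|j IH] J.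
  rewrite (bigD1 set0) /= ?qprod0 ?expn_gt0 ?(ltnW B1) //.
  rewrite mprod0 big1 => [|D /andP[_ /set0Pn [t tD]]]; first by rewrite addr0 bin0 mulr1.
  by rewrite /mprod (bigD1 t) //= mul0r mul0r.
pose G i : F := if (i <= J)%N then kap ^+ j * 'C(J - i + j, j)%:R else 0.
have G0 i : 0 <= G i by rewrite /G; case: ifP => // _; rewrite mulr_ge0 ?exprn_ge0.
apply: (@le_trans _ _ (\sum_D mprod psi D * G (trunc_log B (qprod D)))).
  rewrite sum_ind.
  have split1 D : mprod (fun t => j.+1%:R * psi t) D = mprod (fun t => j%:R * psi t + psi t) D.
    by apply: eq_mprod => t; rewrite -natr1 mulrDl mul1r.
  under eq_bigr => D _ do rewrite split1.
  rewrite sum_mprodD.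
  apply: (@le_trans _ _ (\sum_E \sum_G mprod (fun t => j%:R * psi t) E * mprod psi G * (qprod E * qprod G <= B ^ J)%N%:R)).
    apply: ler_sum => E _; rewrite [leRHS](bigID (fun A : {set T} => [disjoint A & E])) /= -[leLHS]addr0.
    apply: lerD.
      by apply: ler_sum => A dA; rewrite qprodU // disjoint_sym.
    by apply: sumr_ge0 => A _; rewrite !mulr_ge0 // mprod_ge0 // => t; rewrite mulr_ge0.
  rewrite exchange_big /=; apply: ler_sum => A _.
  under eq_bigr do rewrite -mulrA mulrCA.
  rewrite -mulr_sumr ler_wpM2l ?mprod_ge0 //.
  have /andP[tl1 _] := trunc_log_bounds B1 (qprod_gt0 A).
  rewrite /G; case: ifP => tJ.
    apply: le_trans (IH _); rewrite -sum_ind big_mkcond [leRHS]big_mkcond.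
    apply: ler_sum => E _.
    have [h|h] := boolP (qprod E * qprod A <= _)%N.
      rewrite ifT // -(leq_pmul2r (qprod_gt0 A)) (leq_trans h) //.
      by rewrite -{1}(subnK tJ) expnD leq_mul2l tl1 orbT.
    by case: ifP => // _; rewrite mprod_ge0 // => t; rewrite mulr_ge0.
  rewrite big1 // => E _; rewrite leqNgt (_ : (B ^ J < _)%N) ?mulr0 //.
  apply: (@leq_trans (B ^ trunc_log B (qprod A))); first by rewrite ltn_exp2l // ltnNge tJ.
  by apply: leq_trans tl1 _; rewrite leq_pmull // qprod_gt0.
apply: (@le_trans _ _ (\sum_(i < J.+1) kap * G i)).
  apply: (abel_comp (c' := fun i : 'I_J.+1 => val i) (J := J)).
  - move=> i; rewrite /G; case: ifP => [h|_]; last exact: G0.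
    rewrite (ltnW h) ler_wpM2l ?exprn_ge0 // ler_nat leq_bin2l //; lia.
  - by move=> i h; rewrite /G leqNgt h.
  - move=> i iJ; rewrite (@sum_ord_le _ (fun=> kap)) // sumr_const card_ord -mulr_natr.
    apply: le_trans (H1 i); rewrite le_eqVlt; apply/orP; left; apply/eqP.
    apply: eq_bigl => D; have /andP[t1 t2] := trunc_log_bounds B1 (qprod_gt0 D).
    apply/idP/idP => h; first by apply: leq_trans t2 _; rewrite leq_exp2l.
    by have := leq_ltn_trans t1 h; rewrite ltn_exp2l.
rewrite -mulr_sumr exprS -mulrA ler_wpM2l // (eq_bigr (fun i : 'I_J.+1 => kap ^+ j * 'C(J - i + j, j)%:R)).
  rewrite -mulr_sumr ler_wpM2l ?exprn_ge0 // -natr_sum ler_nat.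
  rewrite (reindex_inj rev_ord_inj) /= -sum_bin_diag leq_eqVlt; apply/orP; left; apply/eqP.
  by apply: eq_bigr => i _; rewrite subSS subKn // -ltnS.
by move=> i _; rewrite /G -ltnS ltn_ord.
Qed.

(* The weight [j / (p - j)] is what makes the induction on [j] lossless: removing
   coprimality against a factor [1 / (p - 1)] turns [j.+1 / (p - j.+1)] into a weight
   at least [j / (p - j)] ([key] below). *)
Lemma lower_dim (kap : F) m :
  0 <= kap ->
  (forall i, (i <= m)%N ->
     kap * i%:R <= \sum_(D | (qprod D <= B ^ i)%N) mprod (fun t => ((pr t)%:R - 1)^-1) D) ->
  forall j J, (j <= kk)%N -> (J <= m)%N ->
    kap ^+ j * 'C(J, j)%:R
    <= \sum_(D | (qprod D <= B ^ J)%N) mprod (fun t => j%:R / ((pr t)%:R - j%:R)) D.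
Proof.
move=> kap0 H1; elim=> [|j IH] J jk Jm.
  rewrite (bigD1 set0) /= ?qprod0 ?expn_gt0 ?(ltnW B1) //.
  rewrite mprod0 big1 => [|D /andP[_ /set0Pn [t tD]]]; first by rewrite addr0 bin0 mulr1.
  by rewrite /mprod (bigD1 t) //= !mul0r.
pose b t : F := ((pr t)%:R - 1)^-1.
pose w i t : F := i%:R / ((pr t)%:R - i%:R).
have prj t : j.+1%:R + 1 <= (pr t)%:R :> F.
  by rewrite natr1 ler_nat (leq_ltn_trans jk) // prk.
have j0 : 0 <= j%:R :> F by [].
have prj' t : j%:R + 2 <= (pr t)%:R :> F by have := prj t; rewrite -natr1; lra.
have b0 t : 0 <= b t by rewrite invr_ge0; have := prj' t; lra.
have w0 i t : (i <= j.+1)%N -> 0 <= w i t.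
  move=> ij; rewrite divr_ge0 // subr_ge0; apply: le_trans (_ : j.+1%:R <= _).
    by rewrite ler_nat.
  by have := prj t; lra.
have key t : w j t * (1 + b t) + b t <= w j.+1 t.
  rewrite /w /b -natr1; have := prj' t; set p := (pr t)%:R; set x := j%:R : F => hp.
  have -> : x / (p - x) * (1 + (p - 1)^-1) + (p - 1)^-1 = ((x * p + (p - x)) / ((p - x) * (p - 1))).
    by field; apply/andP; split; apply/lt0r_neq0; lra.
  rewrite ler_pdivrMr ?mulr_gt0; try lra.
  rewrite mulrAC ler_pdivlMr; last by lra.
  rewrite -subr_ge0.
  have -> : (x + 1) * ((p - x) * (p - 1)) - (x * p + (p - x)) * (p - (x + 1)) = x * p by ring.
  by rewrite mulr_ge0 //; lra.
have ->: \sum_(D | (qprod D <= B ^ J)%N) mprod (w j.+1) D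
   = \sum_D mprod (fun t => (w j.+1 t - b t) + b t) D * (qprod D <= B ^ J)%N%:R.
  rewrite sum_ind; apply: eq_bigr => D _; congr (_ * _).
  by apply: eq_mprod => t; rewrite subrK.
rewrite sum_mprodD.
apply: (@le_trans _ _ (\sum_E mprod (w j) E * \sum_A mprod b A * (qprod E * qprod A <= B ^ J)%N%:R)); last first.
  apply: ler_sum => E _.
  under [leRHS]eq_bigr => A dA do rewrite qprodU 1?disjoint_sym // -mulrA.
  rewrite -mulr_sumr.
  apply: (@le_trans _ _ (mprod (w j) E * (mprod (fun t => 1 + b t) E * \sum_(A : {set T} | [disjoint A & E]) mprod b A * (qprod E * qprod A <= B ^ J)%N%:R))).
    apply: ler_wpM2l; first by apply: mprod_ge0 => t; apply: w0.
    apply: sum_disjoint_ge => // E' A sE' dA; rewrite ler_nat.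
    case: (leqP (qprod E * qprod (E' :|: A)) _) => // h.
    rewrite (leq_trans _ h) // leq_mul2l (_ : (_ <= _)%N) ?orbT //.
    rewrite qprodU; first by rewrite leq_pmull // qprod_gt0.
    by rewrite disjoint_sym; apply: disjointWr sE' dA.
  rewrite mulrA ler_wpM2r //.
    by apply: sumr_ge0 => A _; rewrite mulr_ge0 // mprod_ge0.
  rewrite -mprodM; apply: le_mprod => t; rewrite mulr_ge0 ?w0 ?addr_ge0 //=.
  by rewrite lerBrDr key.
under [leRHS]eq_bigr do rewrite mulr_sumr; rewrite exchange_big /=.
pose G i : F := if (i <= J)%N then kap ^+ j * 'C(J - i, j)%:R else 0.
have G0 i : 0 <= G i by rewrite /G; case: ifP => // _; rewrite mulr_ge0 ?exprn_ge0.
(* For a lower bound the size of [A] is rounded up: then a product of [E] at most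
   [B ^ (J - log_cell (qprod A))] is always admissible. *)
apply: (@le_trans _ _ (\sum_A mprod b A * G (log_cell (qprod A)))); last first.
  apply: ler_sum => A _.
  under eq_bigr do rewrite mulrCA; rewrite -mulr_sumr ler_wpM2l ?mprod_ge0 //.
  rewrite /G; case: ifP => cJ; last first.
    by apply: sumr_ge0 => E _; rewrite mulr_ge0 // mprod_ge0 // => t; apply: w0.
  apply: le_trans (IH _ (ltnW jk) (leq_trans (leq_subr _ _) Jm)) _.
  rewrite sum_ind; apply: ler_sum => E _; rewrite ler_wpM2l ?mprod_ge0 // => [t|].
    exact: w0.
  rewrite ler_nat; case: (leqP (qprod E) _) => // h.
  by rewrite (leq_trans (leq_mul h (up_logP (qprod A) B1))) // -expnD subnK.
apply: (@le_trans _ _ (\sum_(i < J) kap * G i.+1)); last first.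
  apply: (abel_comp (c := fun i : 'I_J => i.+1) (J := J)).
  - move=> i; rewrite /G; case: ifP => [h|_]; last exact: G0.
    rewrite (ltnW h) ler_wpM2l ?exprn_ge0 // ler_nat leq_bin2l //; lia.
  - by move=> i h; rewrite /G leqNgt h.
  - move=> i iJ; rewrite (@sum_ord_lt _ (fun=> kap)) // sumr_const card_ord -mulr_natr.
    under [leRHS]eq_bigl do rewrite log_cell_le.
    exact: H1 (leq_trans iJ Jm).
rewrite -mulr_sumr exprS -mulrA ler_wpM2l // (eq_bigr (fun i : 'I_J => kap ^+ j * 'C(J - i.+1, j)%:R)).
  rewrite -mulr_sumr ler_wpM2l ?exprn_ge0 // -natr_sum ler_nat.
  rewrite (reindex_inj rev_ord_inj) /= -sum_bin_col leq_eqVlt; apply/orP; left; apply/eqP.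
  by apply: eq_bigr => i _; rewrite subnSK // subKn // ltnW.
by move=> i _; rewrite /G ltn_ord.
Qed.

End Dim.

(** * Main terms of the sieve weights *)

Section MainTerms.
Variables (F : realFieldType) (T : finType) (pr : T -> nat) (kk B m : nat) (f : nat -> F).
Hypotheses (kk1 : (1 < kk)%N) (prk : forall t, (kk < pr t)%N) (B1 : (1 < B)%N).
Hypotheses (fd : forall i, f i.+1 <= f i) (f0 : forall i, 0 <= f i)
  (fm : forall i, (m < i)%N -> f i = 0).

Implicit Types (D E S G : {set T}).
Let kk0 : (0 < kk)%N. Proof. exact: ltnW. Qed.
Local Notation q := (qprod pr).
Local Notation c S := (log_cell B (q S)).

(** [gdens] is the density of the n for which p divides some n + h; [gdens'] is the same density
    among the n with one n + h prime, where [kk - 1] of the [p - 1] reduced classes are left.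
    [hdens] and [hdens'] are the duals in the sense 1/g = 1 + 1/h. *)
Definition gdens (t : T) : F := kk%:R / (pr t)%:R.
Definition hdens (t : T) : F := kk%:R * ((pr t)%:R - kk%:R)^-1.
Definition gdens' (t : T) : F := kk.-1%:R / ((pr t)%:R - 1).
Definition hdens' (t : T) : F := kk.-1%:R / ((pr t)%:R - kk%:R).
Definition gpy D : F := selberg gdens hdens (fun S => f (c S)) D.
(** The discrete integral of [f] over the indices above [a]; [m] terms suffice because [f] vanishes
    beyond [m]. *)
Definition tailsum a : F := \sum_(l < m) f (a + l.+1)%N.

Let kkF : 2 <= kk%:R :> F. Proof. by rewrite ler_nat. Qed.
Let pF t : kk%:R + 1 <= (pr t)%:R :> F. Proof. by rewrite natr1 ler_nat. Qed.
Let kk1E : kk.-1%:R = kk%:R - 1 :> F.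
Proof. by rewrite -[in RHS](prednK kk0) -natr1 addrK. Qed.

Lemma gdens_gt0 t : 0 < gdens t.
Proof. by rewrite divr_gt0 //; have := pF t; have := kkF; lra. Qed.

Lemma hdens_gt0 t : 0 < hdens t.
Proof. by rewrite mulr_gt0 ?invr_gt0 //; have := pF t; have := kkF; lra. Qed.

Lemma hdens'_gt0 t : 0 < hdens' t.
Proof. by rewrite divr_gt0 // ?kk1E; have := pF t; have := kkF; lra. Qed.

Lemma gdens'_gt0 t : 0 < gdens' t.
Proof. by rewrite divr_gt0 // ?kk1E; have := pF t; have := kkF; lra. Qed.

Lemma quad_form_gpy : quad_form gdens gpy = \sum_S mprod hdens S * f (c S) ^+ 2.
Proof.
rewrite (quad_form_diag _ gdens_gt0 hdens_gt0) => [|t]; last first.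
  rewrite /gdens /hdens; have := pF t; have := kkF => h1 h2.
  by field; rewrite !andbA; apply/andP; split; [apply/andP; split|]; apply/lt0r_neq0; lra.
apply: eq_bigr => S _.
have := @selberg_inv _ _ gdens hdens (fun=> 1) (fun S => f (c S)) S gdens_gt0.
have E1 D : mprod (fun t => 1 * gdens t) D = mprod gdens D.
  by apply: eq_mprod => t; rewrite mul1r.
under eq_bigr do rewrite E1.
rewrite /gpy => ->.
rewrite (bigD1 set0) /=; last by rewrite -setI_eq0 set0I.
rewrite big1 ?addr0 => [|G /andP[_ /set0Pn [t tG]]]; last first.
  by rewrite /mprod (bigD1 t) //= subrr mulr0 !mul0r.
rewrite mprod0 mul1r setU0 exprMn.
have -> : mprod (fun t => -1 * hdens t) S ^+ 2 = mprod hdens S ^+ 2.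
  by rewrite !expr2 -!mprodM; apply: eq_mprod => t; ring.
by field; apply/lt0r_neq0/mprod_gt0/hdens_gt0.
Qed.

(** [hdens] is [kk] times a weight of dimension one, so its cumulative mass is bounded by
    [upper_dim]; the binomials ['C(i + kk.-1, kk.-1)] are the increments of that bound. *)
Lemma quad_form_gpy_le (kap : F) :
  0 <= kap ->
  (forall i, \sum_(D : {set T} | (q D < B ^ i.+1)%N) mprod (fun t => ((pr t)%:R - kk%:R)^-1) D
     <= kap * i.+1%:R) ->
  quad_form gdens gpy <= kap ^+ kk * \sum_(i < m.+1) f i ^+ 2 * 'C(i + kk.-1, kk.-1)%:R.
Proof.
move=> kap0 H1; rewrite quad_form_gpy mulr_sumr.
under [leRHS]eq_bigr do rewrite mulrA mulrAC.
pose v i : F := kap ^+ kk * 'C(i + kk.-1, kk.-1)%:R.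
apply: (@abel_comp _ _ _ _ (fun S => c S) (fun i : 'I_m.+1 => v i) (fun i => val i) (fun i => f i ^+ 2) m).
- by move=> i; rewrite ler_sqr ?nnegrE.
- by move=> i h; rewrite fm ?expr0n.
- move=> i im; rewrite sum_ord_le // -mulr_sumr -natr_sum sum_bin_diag prednK //.
  under eq_bigl do rewrite log_cell_le //.
  apply: (upper_dim kk0) => // t; rewrite invr_ge0; have := pF t; lra.
Qed.

Lemma tailsum_ge0 a : 0 <= tailsum a.
Proof. exact: sumr_ge0. Qed.

Lemma tailsum_decr a : tailsum a.+1 <= tailsum a.
Proof. by apply: ler_sum => i _; rewrite addSn. Qed.

Lemma tailsum_eq0 a : (m <= a)%N -> tailsum a = 0.
Proof. by move=> ma; rewrite /tailsum big1 // => i _; rewrite fm //; lia. Qed.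

(** The diagonal variable at [S] for [gdens'] is a sum of dimension one over the [G] disjoint from
    [S], hence at least about [kap * tailsum]. Its square gives two powers of [kap], and the outer
    sum with weight [hdens'], of dimension [kk - 1], gives the other [kk - 1]. *)
Lemma quad_form_gpy_ge (kap : F) :
  0 <= kap ->
  (forall i, (i <= m)%N ->
     kap * i%:R <= \sum_(D : {set T} | (q D <= B ^ i)%N) mprod (fun t => ((pr t)%:R - 1)^-1) D) ->
  kap ^+ kk.+1 * \sum_(a < m) tailsum a.+1 ^+ 2 * 'C(a, kk.-2)%:R
   <= quad_form gdens' gpy.
Proof.
move=> kap0 H1.
pose b t : F := ((pr t)%:R - 1)^-1.
have b0 t : 0 <= b t by rewrite invr_ge0; have := pF t; have := kkF; lra.
pose u t := gdens' t / gdens t.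
have uE t : u t * gdens t = gdens' t by rewrite divfK // lt0r_neq0 ?gdens_gt0.
rewrite (quad_form_diag _ gdens'_gt0 hdens'_gt0) => [|t]; last first.
  rewrite /gdens' /hdens' kk1E; have := pF t; have := kkF => h1 h2.
  by field; rewrite ?andbA; repeat (apply/andP; split); apply/lt0r_neq0; lra.
have innerge S : kap * tailsum (c S)
   <= mprod (fun t => 1 + b t) S * \sum_(G : {set T} | [disjoint G & S]) mprod b G * f (c (S :|: G)).
  apply: (@le_trans _ _ (\sum_G mprod b G * f (log_cell B (q S * q G)%N))); last first.
    apply: sum_disjoint_ge => // E G sE dG; apply: (nonincr_le fd).
    rewrite log_cell_le // qprodU 1?disjoint_sym //.
    apply: leq_trans (up_logP _ B1); rewrite leq_mul2l (_ : (_ <= _)%N) ?orbT //.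
    rewrite qprodU; first by rewrite leq_pmull // (qprod_gt0 prk).
    by rewrite disjoint_sym; apply: disjointWr sE dG.
  apply: (@le_trans _ _ (\sum_G mprod b G * f (c S + c G)%N)); last first.
    apply: ler_sum => G _; rewrite ler_wpM2l ?mprod_ge0 //; apply: (nonincr_le fd).
    exact: log_cellM_le.
  rewrite mulr_sumr.
  apply: (@abel_comp _ _ _ (fun=> kap) (fun i : 'I_m => i.+1) (mprod b) (fun G => c G) (fun i => f (c S + i)%N) m).
  - by move=> i; rewrite addnS.
  - by move=> i h; rewrite fm //; lia.
  - move=> i im; rewrite (@sum_ord_lt _ (fun=> kap)) // sumr_const card_ord -mulr_natr.
    under [leRHS]eq_bigl do rewrite log_cell_le //.
    exact: H1.
apply: (@le_trans _ _ (\sum_S mprod hdens' S * (kap * tailsum (c S)) ^+ 2)); last first.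
  apply: ler_sum => S _.
  have := @selberg_inv _ _ gdens hdens u (fun S => f (c S)) S gdens_gt0.
  have E1 D : mprod (fun t => u t * gdens t) D = mprod gdens' D by apply: eq_mprod => t; rewrite uE.
  under eq_bigr do rewrite E1.
  rewrite /gpy => ->.
  have E2 D : mprod (fun t => hdens t * (1 - u t)) D = mprod b D.
    apply: eq_mprod => t; rewrite /u /hdens /gdens /gdens' /b kk1E.
    have := pF t; have := kkF => h1 h2.
    by field; rewrite ?andbA; repeat (apply/andP; split); apply/lt0r_neq0; lra.
  under eq_bigr do rewrite E2.
  set X := (X in _ * X) in innerge *.
  (* Here u h = h' p/(p - 1), and p/(p - 1) = 1 + b is exactly the price paid in [innerge] for
     dropping disjointness from [S]. Nothing is lost. *)
  have -> : mprod (fun t => - u t * hdens t) S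
      = mprod (fun => -1) S * (mprod hdens' S * mprod (fun t => 1 + b t) S).
    rewrite -!mprodM; apply: eq_mprod => t; rewrite /u /hdens /gdens /gdens' /hdens' /b kk1E.
    have := pF t; have := kkF => h1 h2.
    by field; rewrite ?andbA; repeat (apply/andP; split); apply/lt0r_neq0; lra.
  have h0 : 0 < mprod hdens' S by apply/mprod_gt0/hdens'_gt0.
  rewrite mprod_const.
  have -> (e p x : F) : (mprod hdens' S)^-1 * (e * (mprod hdens' S * p) * x) ^+ 2
      = e ^+ 2 * (mprod hdens' S * (p * x) ^+ 2).
    by field; apply: lt0r_neq0.
  rewrite -exprM mulnC exprM sqrrN expr1n expr1n mul1r.
  apply: ler_wpM2l; first exact: ltW.
  rewrite ler_sqr ?nnegrE //.
    by rewrite mulr_ge0 // tailsum_ge0.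
  by apply: le_trans (innerge S); rewrite mulr_ge0 // tailsum_ge0.
under [leRHS]eq_bigr do rewrite exprMn mulrCA.
have -> : kk.+1 = (2 + kk.-1)%N by rewrite -[in LHS](prednK kk0).
rewrite -mulr_sumr exprD -mulrA ler_wpM2l ?exprn_ge0 //.
rewrite mulr_sumr; under eq_bigr do rewrite mulrA mulrAC.
pose v i : F := kap ^+ kk.-1 * 'C(i, kk.-2)%:R.
apply: (@abel_comp _ _ _ (fun i : 'I_m => v i) (fun i : 'I_m => i.+1) (mprod hdens') (fun G => c G) (fun i => tailsum i ^+ 2) m).
- by move=> i; rewrite ler_sqr ?nnegrE ?tailsum_ge0 ?tailsum_decr.
- by move=> i h; rewrite tailsum_eq0 ?expr0n // ltnW.
move=> i im; rewrite sum_ord_lt // -mulr_sumr -natr_sum sum_bin_col.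
under [leRHS]eq_bigl do rewrite log_cell_le //.
have -> : kk.-2.+1 = kk.-1 by case: (kk) kk1 => [|[]].
(* The weight of [lower_dim] for j = kk - 1 has denominator p - (kk - 1), so [hdens'], with
   denominator p - kk, is at least as large. *)
apply: le_trans (lower_dim kk0 prk B1 kap0 H1 (leq_pred kk) im) _.
apply: ler_sum => S _; apply: le_mprod => t.
have := pF t; have := kkF => h1 h2; rewrite /hdens' kk1E.
apply/andP; split; first by rewrite divr_ge0; lra.
by rewrite ler_wpM2l ?lef_pV2 ?posrE; lra.
Qed.

Lemma gpy_out D : (B ^ m < q D)%N -> gpy D = 0.
Proof.
move=> h; rewrite /gpy /selberg big1 ?mulr0 // => S sDS; rewrite fm ?mulr0 //.
rewrite ltnNge log_cell_le // -ltnNge (leq_trans h) //.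
rewrite -(setID S D) (setIidPr sDS) qprodU; first by rewrite leq_pmulr // (qprod_gt0 prk).
by rewrite disjoint_sym disjoints_subset setDE subsetIr.
Qed.

(** Since h/g = 1 + h, the factor in front of the sum over sets disjoint from [D] is what it takes
    to restore the subsets of [D]: the whole is at most a sum over all [S]. *)
Lemma gpy_bound D :
  `|gpy D| <= f 0%N * \sum_(S : {set T} | (q S <= B ^ m)%N) mprod hdens S.
Proof.
have h0 t : 0 <= hdens t by apply/ltW/hdens_gt0.
have -> : gpy D = mprod (fun t => - (gdens t)^-1 * hdens t) D *
    \sum_(G : {set T} | [disjoint G & D]) mprod hdens G * f (c (D :|: G)).
  rewrite /gpy /selberg mprodM -mulrA; congr (_ * _); rewrite mulr_sumr.
  rewrite (reindex_onto (fun E => D :|: E) (fun S => S :\: D)) /=; last first.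
    by move=> S sDS; rewrite -[RHS](setID S D) (setIidPr sDS).
  apply: eq_big => [E|E /andP[_ /eqP eE]].
    rewrite subsetUl /= setDUl setDv set0U.
    by apply/eqP/idP => /setDidPl.
  by rewrite mprodU ?mulrA // -eE disjoint_sym disjoints_subset setDE subsetIr.
rewrite normrM [X in _ * X]ger0_norm; last first.
  by apply: sumr_ge0 => G _; rewrite mulr_ge0 ?mprod_ge0.
have -> : `|mprod (fun t => - (gdens t)^-1 * hdens t) D| = mprod (fun t => 1 + hdens t) D.
  rewrite /mprod normr_prod; apply: eq_bigr => t _.
  rewrite mulNr normrN ger0_norm; last by rewrite mulr_ge0 // invr_ge0 ltW // gdens_gt0.
  rewrite /gdens /hdens; have := pF t; have := kkF => h1 h2.
  by field; rewrite ?andbA; repeat (apply/andP; split); apply/lt0r_neq0; lra.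
rewrite [in leRHS]sum_ind [leRHS]mulr_sumr; under [leRHS]eq_bigr do rewrite mulrCA.
apply: sum_disjoint_le => // E G sE dG.
case: leqP => h; rewrite ?mulr1 ?mulr0; first exact: (nonincr_le fd).
rewrite fm // ltnNge log_cell_le // -ltnNge (leq_trans h) //.
have dEG : [disjoint E & G] by rewrite disjoint_sym; apply: disjointWr sE dG.
rewrite (qprodU _ dEG) qprodU 1?disjoint_sym //.
rewrite leq_mul2r -(setID D E) qprodU ?(setIidPr sE) ?leq_pmulr ?orbT ?(qprod_gt0 prk) //.
by rewrite disjoint_sym disjoints_subset setDE subsetIr.
Qed.

End MainTerms.

(** * The one-dimensional sums *)

Lemma sum_inj_le (F : numDomainType) (I J : finType) (P : pred I) (Q : pred J) (h : I -> J) (u : J -> F) :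
  {in P &, injective h} -> (forall i, P i -> Q (h i)) -> (forall j, 0 <= u j) ->
  \sum_(i | P i) u (h i) <= \sum_(j | Q j) u j.
Proof.
move=> injh PQ u0; rewrite -(big_imset u injh) /=.
rewrite big_mkcond [leRHS]big_mkcond; apply: ler_sum => j _.
case: imsetP => [[i Pi ->]|_]; first by rewrite PQ.
by case: ifP.
Qed.

Lemma sum_nat_inj_le (F : numDomainType) (I : finType) (P : pred I) (Q : pred nat) (h : I -> nat)
    (u : nat -> F) a b :
  {in P &, injective h} -> (forall i, P i -> (a <= h i < b)%N && Q (h i)) ->
  (forall n, 0 <= u n) ->
  \sum_(i | P i) u (h i) <= \sum_(a <= n < b | Q n) u n.
Proof.
move=> injh PQ u0; case: b PQ => [|b] PQ.
  by rewrite big1 ?sumr_ge0 // => i /PQ; rewrite ltn0 andbF.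
have hK i : P i -> (inord (h i) : 'I_b.+1) = h i :> nat.
  by move=> /PQ /andP[/andP[_ hb] _]; rewrite inordK.
have -> : \sum_(a <= n < b.+1 | Q n) u n = \sum_(n < b.+1 | (a <= n)%N && Q n) u n.
  rewrite big_nat_cond -(big_mkord (fun n => (a <= n)%N && Q n) u).
  rewrite [RHS]big_nat_cond; have [ab|ba] := leqP a b.+1.
    rewrite [RHS](@big_cat_nat _ _ _ a) //= [X in _ = X + _]big_nat_cond.
    rewrite [X in _ = X + _]big1 ?add0r => [|i]; last by lia.
    by rewrite big_nat_cond [RHS]big_nat_cond; apply: eq_bigl => i; lia.
  by rewrite big_geq ?(ltnW ba) // big1 // => i; lia.
rewrite (eq_bigr (fun i => u (inord (h i) : 'I_b.+1))) => [|i /hK -> //].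
apply: (@sum_inj_le _ _ _ _ _ (fun i => inord (h i)) (fun n : 'I_b.+1 => u n)) => //.
- move=> i j Pi Pj /(congr1 val) /=; rewrite !hK //; exact: injh.
- by move=> i Pi; rewrite hK //; case/andP: (PQ i Pi) => /andP[-> _] ->.
Qed.

Lemma sum_eq_le (F : numDomainType) (r : seq nat) (P : pred nat) (m : nat) (v : F) :
  uniq r -> 0 <= v -> \sum_(n <- r | P n && (m == n)) v <= v *+ (m \in r).
Proof.
move=> ur v0; rewrite big_const_seq iter_addr_0 -(count_uniq_mem m ur).
by rewrite ler_wpMn2l // sub_count // => n /= /andP[_ /eqP ->].
Qed.

(** An upper bound 1/(1 - sum) for the product that needs no exponential; it is applied when the sum
    is at most e < 1. *)
Lemma prodD1_le (F : realFieldType) (I : Type) (r : seq I) (c : I -> F) :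
  (forall i, 0 <= c i) -> (\prod_(i <- r) (1 + c i)) * (1 - \sum_(i <- r) c i) <= 1.
Proof.
move=> c0; elim: r => [|i r IH]; first by rewrite !big_nil subr0 mulr1.
rewrite !big_cons.
have P0 : 0 <= \prod_(j <- r) (1 + c j) by apply: prodr_ge0 => j _; rewrite addr_ge0.
have s0 : 0 <= \sum_(j <- r) c j by apply: sumr_ge0.
move: IH P0 s0 (c0 i); set P := \prod_(_ <- _) _; set s := \sum_(_ <- _) _; set x := c i.
move=> IH P0 s0 x0; apply: le_trans IH.
rewrite [(1 + x) * P]mulrC -mulrA ler_wpM2l //; nra.
Qed.

Lemma prime_dvd_fact_le p n : prime p -> (p %| n`!)%N -> (p <= n)%N.
Proof.
move=> pp; elim: n => [|n IH]; first by rewrite fact0 dvdn1 => /eqP p1; rewrite p1 in pp.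
by rewrite factS Euclid_dvdM // => /orP[/dvdn_leq-> //|/IH /leqW].
Qed.

Lemma sum_inv_sq_le (F : realFieldType) k D Y : (k < D)%N ->
  \sum_(D <= n < Y) (((n - k)%N)%:R * (n.+1 - k)%N%:R)^-1 <= ((D - k)%N%:R)^-1 :> F.
Proof.
move=> kD; have [YD|DY] := leqP Y D.
  by rewrite big_geq // invr_ge0.
rewrite (eq_big_nat _ _ (F2 := fun n => - (n.+1 - k)%N%:R^-1 - - (n - k)%N%:R^-1)).
  rewrite telescope_sumr; last exact: ltnW.
  by rewrite opprK gerDr oppr_le0 invr_ge0.
move=> n /andP[Dn _]; rewrite subSn; last by lia.
have : 0 < (n - k)%N%:R :> F by rewrite ltr0n; lia.
set x := (n - k)%N%:R => x0; rewrite -natr1 -/x.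
by field; apply/andP; split; apply: lt0r_neq0; lra.
Qed.

Definition harm_coprime (F : realFieldType) (W x : nat) : F :=
  \sum_(1 <= n < x.+1 | coprime n W) (n%:R)^-1.

Section OneDim.
Variables (F : realFieldType) (T : finType) (pr : T -> nat) (k D0 X : nat).
Hypotheses (k0 : (0 < k)%N) (kD0 : (k < D0)%N).
Hypotheses (pr_prime : forall t, prime (pr t)) (pr_inj : injective pr).
Hypotheses (prD0 : forall t, (D0 < pr t)%N) (prX : forall t, (pr t <= X)%N).
Hypothesis pr_onto : forall p, prime p -> (D0 < p <= X)%N -> exists t, pr t = p.

Implicit Types (D E G : {set T}).
Local Notation q := (qprod pr).
Local Notation W := (D0`!).

Let prk t : (k < pr t)%N. Proof. exact: ltn_trans kD0 (prD0 t). Qed.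

Lemma coprime_prW t : coprime (pr t) W.
Proof.
rewrite prime_coprime //; apply/negP => /(prime_dvd_fact_le (pr_prime t)).
by rewrite leqNgt prD0.
Qed.

Lemma coprime_qW D : coprime (q D) W.
Proof.
rewrite /qprod; apply: (big_ind (fun n => coprime n W)) => [|x y|t _]; first exact: coprime1n.
  by rewrite coprimeMl => -> ->.
exact: coprime_prW.
Qed.

Lemma dvd_qprod t D : (pr t %| q D)%N = (t \in D).
Proof.
apply/idP/idP => [|tD]; last by rewrite /qprod (bigD1 t) //= dvdn_mulr.
apply: contraLR => tD; rewrite -prime_coprime // /qprod.
apply: (big_ind (fun n => coprime (pr t) n)) => [|x y|s sD]; first exact: coprimen1.
  by rewrite coprimeMr => -> ->.
rewrite prime_coprime // dvdn_prime2 //; apply: contra tD => /eqP /pr_inj -> //.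
Qed.

Lemma qprod_inj : injective q.
Proof. by move=> D E qDE; apply/setP => t; rewrite -!dvd_qprod qDE. Qed.

Lemma inv_qprod D : mprod (fun t => ((pr t)%:R)^-1 : F) D = ((q D)%:R)^-1.
Proof. by rewrite mprodV /mprod /qprod natr_prod. Qed.

Lemma sum_inv_qprod_le x :
  \sum_(D : {set T} | (q D <= x)%N) mprod (fun t => ((pr t)%:R)^-1 : F) D <= harm_coprime F W x.
Proof.
under eq_bigr do rewrite inv_qprod.
apply: (@sum_nat_inj_le _ _ _ _ q (fun n => (n%:R)^-1)).
- by move=> D E _ _; apply: qprod_inj.
- by move=> D hD; rewrite coprime_qW (qprod_gt0 prk) ltnS hD.
- by move=> n; rewrite invr_ge0.
Qed.

Lemma sum_corr_le :
  \sum_t k%:R / ((pr t)%:R * ((pr t)%:R - k%:R)) <= k%:R * ((D0 - k)%N%:R)^-1 :> F.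
Proof.
rewrite -mulr_sumr ler_wpM2l //.
apply: le_trans (sum_inv_sq_le F X kD0).
(* At n = p - 1 the denominator is (p - 1 - k)(p - k), at most p(p - k), and the sum over n
   telescopes. *)
pose u (n : nat) : F := ((n - k)%N%:R * (n.+1 - k)%N%:R)^-1.
apply: (@le_trans _ _ (\sum_t u (pr t).-1)).
  apply: ler_sum => t _; rewrite /u prednK ?prime_gt0 //.
  have h := prD0 t.
  rewrite -natrB ?(ltnW (prk t)) // -natrM lef_pV2 ?posrE -?natrM ?ltr0n ?ler_nat ?muln_gt0 //; try lia.
  by apply: leq_mul; lia.
apply: (@sum_nat_inj_le _ _ _ xpredT (fun t => (pr t).-1) u).
- move=> s t _ _ /(congr1 S); rewrite !prednK ?prime_gt0 //; exact: pr_inj.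
- by move=> t _; have := prD0 t; have := prX t; rewrite andbT; lia.
- by move=> n; rewrite invr_ge0 mulr_ge0.
Qed.

(** Split 1/(p - k) = 1/p + k/(p(p - k)). The corrections have total mass at most e because p > D0,
    so they cost only the factor 1/(1 - e); what remains is a sum of 1/d over squarefree d coprime
    to [W]. *)
Lemma one_dim_le x (e : F) : k%:R * ((D0 - k)%N%:R)^-1 <= e -> e < 1 ->
  \sum_(D : {set T} | (q D <= x)%N) mprod (fun t => ((pr t)%:R - k%:R)^-1 : F) D
  <= (1 - e)^-1 * harm_coprime F W x.
Proof.
move=> he e1.
pose a t : F := ((pr t)%:R)^-1.
pose c t : F := k%:R / ((pr t)%:R * ((pr t)%:R - k%:R)).
have pF t : k%:R + 1 <= (pr t)%:R :> F by rewrite natr1 ler_nat.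
have kF : 0 <= k%:R :> F by [].
have a0 t : 0 <= a t by rewrite invr_ge0.
have c0 t : 0 <= c t by rewrite divr_ge0 // mulr_ge0 //; have := pF t; lra.
rewrite sum_ind.
have E1 D : mprod (fun t => ((pr t)%:R - k%:R)^-1 : F) D = mprod (fun t => a t + c t) D.
  apply: eq_mprod => t; rewrite /a /c; have := pF t => h.
  by field; apply/andP; split; apply: lt0r_neq0; lra.
under eq_bigr do rewrite E1.
rewrite sum_mprodD.
apply: (@le_trans _ _ (\sum_E \sum_G mprod a E * (q E <= x)%N%:R * mprod c G)).
  apply: ler_sum => E _; rewrite [leRHS](bigID (fun A : {set T} => [disjoint A & E])) /= -[leLHS]addr0.
  apply: lerD.
    apply: ler_sum => A dA; rewrite mulrAC ler_wpM2r ?mprod_ge0 // ler_wpM2l ?mprod_ge0 //.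
    rewrite ler_nat qprodU 1?disjoint_sym //; case: (leqP (q E * q A) x) => // h.
    by rewrite (leq_trans _ h) // leq_pmulr // (qprod_gt0 prk).
  by apply: sumr_ge0 => A _; rewrite !mulr_ge0 // mprod_ge0.
under eq_bigr do rewrite -mulr_sumr.
rewrite -mulr_suml mulrC -sum_ind sum_mprod.
apply: ler_pM.
- by apply: prodr_ge0 => t _; rewrite addr_ge0.
- by apply: sumr_ge0 => E _; rewrite mprod_ge0.
- rewrite -[leRHS]mul1r ler_pdivlMr ?subr_gt0 //.
  apply: le_trans (prodD1_le (index_enum T) c0).
  rewrite ler_wpM2l ?lerB //; first by apply: prodr_ge0 => t _; rewrite addr_ge0.
  exact: le_trans sum_corr_le he.
- exact: sum_inv_qprod_le.
Qed.

Lemma sq_decomposition n : (0 < n <= X)%N -> coprime n W ->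
  exists D b, n = (q D * b ^ 2)%N /\ ((b == 1) || (D0 < b))%N.
Proof.
elim/ltn_ind: n => n IH /andP[n0 nX] cn.
have [n1|n1] := leqP n 1.
  by exists set0, 1%N; rewrite qprod0; split => //; lia.
have pp := pdiv_prime n1; have pn := pdiv_dvd n.
have pD0 : (D0 < pdiv n)%N.
  rewrite ltnNge; apply/negP => pD.
  have : (pdiv n %| gcdn n W)%N by rewrite dvdn_gcd pn dvdn_fact // prime_gt0.
  by rewrite (eqP cn) dvdn1 => /eqP h; rewrite h in pp.
have [t tp] := pr_onto pp (introT andP (conj pD0 (leq_trans (dvdn_leq n0 pn) nX))).
have nE := divnK pn.
have n'0 : (0 < n %/ pdiv n)%N by rewrite divn_gt0 ?prime_gt0 // dvdn_leq.
have n'n : (n %/ pdiv n < n)%N by rewrite ltn_Pdiv // prime_gt1.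
have [|D [b [Eb hb]]] := IH _ n'n _ (coprime_dvdl (dvdn_div pn) cn).
  by rewrite n'0 (leq_trans (ltnW n'n)).
have [tD|tD] := boolP (t \in D).
  exists (D :\ t), (pdiv n * b)%N; split.
    rewrite -[LHS]nE Eb -{1}(setD1K tD) qprodU ?disjoints1 ?in_setD1 ?eqxx //.
    rewrite {1}/qprod big_set1 tp expnMn; ring.
  apply/orP; right; case/orP: hb => [/eqP ->|hb]; first by rewrite muln1.
  by rewrite (leq_trans hb) // leq_pmull // prime_gt0.
exists (t |: D), b; split => //.
rewrite -[LHS]nE Eb qprodU ?disjoints1 // {2}/qprod big_set1 tp; ring.
Qed.

(** Every n coprime to [W] is a squarefree d times a square b^2, where b is 1 or exceeds D0. The sum
    of 1/b^2 over such b is at most 1 + 1/D0, and 1/p <= 1/(p - 1). *)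
Lemma one_dim_ge x : (x <= X)%N ->
  harm_coprime F W x <= (1 + (D0%:R)^-1) *
   \sum_(D : {set T} | (q D <= x)%N) mprod (fun t => ((pr t)%:R - 1)^-1 : F) D.
Proof.
move=> xX.
pose good (b : 'I_x.+1) := ((b == 1 :> nat) || (D0 < b))%N.
pose v (z : {set T} * 'I_x.+1) : F := ((q z.1)%:R)^-1 * ((z.2 ^ 2)%N%:R)^-1.
have v0 z : 0 <= v z by rewrite mulr_ge0 ?invr_ge0.
apply: (@le_trans _ _ (\sum_(1 <= n < x.+1 | coprime n W)
   \sum_(z : {set T} * 'I_x.+1 | good z.2 && (q z.1 * z.2 ^ 2 == n)%N) v z)).
  rewrite /harm_coprime big_nat_cond [leRHS]big_nat_cond; apply: ler_sum => n /andP[/andP[n0 nx] cn].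
  have [|D [b [nE hb]]] := @sq_decomposition n _ cn; first by rewrite n0; lia.
  have bx : (b < x.+1)%N.
    apply: leq_trans nx; rewrite ltnS nE -[leqLHS]mul1n leq_mul ?(qprod_gt0 prk) //.
    by case: (b) => // c; rewrite expnS expn1 leq_pmulr.
  rewrite (bigD1 (D, Ordinal bx)) /=; last by rewrite /good /= hb nE eqxx.
  rewrite {1}nE natrM invfM /v /= lerDl; apply: sumr_ge0 => z _; exact: v0.
rewrite (exchange_big_dep (fun z : {set T} * 'I_x.+1 => good z.2)) /=; last first.
  by move=> n z _ /andP[].
apply: (@le_trans _ _ (\sum_(z : {set T} * 'I_x.+1 | good z.2 && (q z.1 <= x)%N) v z)).
  rewrite [leRHS]big_mkcond [leLHS]big_mkcond; apply: ler_sum => -[D b] _ /=.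
  case: ifP => //= gb.
  rewrite (eq_bigl (fun n => coprime n W && (q D * b ^ 2 == n)%N)) => [|n]; last by rewrite gb.
  apply: le_trans (sum_eq_le _ _ (iota_uniq _ _) (v0 _)) _.
  rewrite mem_iota add1n subn1 /= ltnS.
  have [/andP[h1 h2]|_] := boolP (_ && _); last by rewrite mulr0n; case: ifP.
  rewrite ifT ?mulr1n // (leq_trans _ h2) // leq_pmulr //.
  by move: h1; rewrite muln_gt0 => /andP[].
rewrite (eq_bigl (fun z => (q z.1 <= x)%N && good z.2)) => [|z]; last by rewrite andbC.
rewrite -(pair_big_dep (fun D : {set T} => (q D <= x)%N) (fun _ b => good b) (fun D b => v (D, b))) /=.
under eq_bigr do rewrite /v /= -mulr_sumr.
rewrite -mulr_suml mulrC; apply: ler_pM.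
- by apply: sumr_ge0 => b _; rewrite invr_ge0.
- by apply: sumr_ge0 => D _; rewrite invr_ge0.
- have D00 : (0 < D0)%N by apply: leq_ltn_trans kD0.
  pose w (b : nat) : F := ((b ^ 2)%N%:R)^-1.
  have w0 b : 0 <= w b by rewrite invr_ge0.
  apply: (@le_trans _ _ (\sum_(b < x.+1 | b == 1 :> nat) w b + \sum_(b < x.+1 | (D0 < b)%N) w b)).
    rewrite [leLHS]big_mkcond [X in _ <= X + _]big_mkcond [X in _ <= _ + X]big_mkcond -big_split /=; apply: ler_sum => b _.
    by rewrite /good; case: (_ == _); case: (_ < _)%N; rewrite /= ?addr0 ?add0r // lerDl.
  apply: lerD.
    have -> : 1 = \sum_(1 <= n < 2 | xpredT n) w n by rewrite big_nat1 /w exp1n invr1.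
    apply: (@sum_nat_inj_le _ _ _ _ val w) => //.
    - by move=> b c _ _; apply: val_inj.
    - by move=> b /eqP /= ->.
  have := sum_inv_sq_le F x D00; rewrite subn0 => h; apply: le_trans h.
  pose u (n : nat) : F := ((n - 0)%N%:R * (n.+1 - 0)%N%:R)^-1.
  apply: (@le_trans _ _ (\sum_(b < x.+1 | (D0 < b)%N) u b.-1)).
    apply: ler_sum => b hb; have b1 : (1 < b)%N by apply: leq_ltn_trans hb.
    rewrite /w /u !subn0 prednK; last exact: ltnW.
    have h1 : (b.-1 * b <= b ^ 2)%N by rewrite expnS expn1 leq_mul2r leq_pred orbT.
    have h2 : (0 < b.-1 * b)%N by rewrite muln_gt0; lia.
    rewrite -natrM lef_pV2 ?posrE ?ltr0n ?ler_nat //.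
    exact: leq_trans h2 h1.
  apply: (@sum_nat_inj_le _ _ _ xpredT (fun b : 'I_x.+1 => b.-1) u).
  + by move=> b c hb hc h; apply: val_inj => /=; move: hb hc h; rewrite !unfold_in; lia.
  + by move=> b hb; have := ltn_ord b; rewrite andbT; lia.
  + by move=> n; rewrite invr_ge0 mulr_ge0.
- apply: ler_sum => D _; rewrite -inv_qprod; apply: le_mprod => t.
  have h : 1 < (pr t)%:R :> F by rewrite ltr1n prime_gt1.
  by rewrite invr_ge0 ler0n /= lef_pV2 ?posrE; lra.
Qed.

End OneDim.

(** * Comparison with the logarithm *)

Lemma sum_block_coprime W y : (\sum_(W * y + 1 <= n < W * y.+1 + 1) coprime n W = totient W)%N.
Proof.
rewrite totient_count_coprime.
have -> : (W * y.+1 + 1 = W + (W * y + 1))%N by rewrite mulnS addnA.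
rewrite -[X in index_iota X _]add0n big_addn addnK.
have cop i : coprime (i + (W * y + 1)) W = coprime W i.+1.
  by rewrite addnCA addn1 mulnC coprime_sym /coprime gcdnMDl.
under eq_bigr do rewrite cop.
case: W {cop} => [|W]; first by rewrite !big_geq.
rewrite [RHS]big_nat_recl // big_nat_recr //= [RHS]addnC; congr (_ + _)%N.
by rewrite /coprime gcdn0 gcdnn.
Qed.

Section Harmonic.
Variables (F : realFieldType) (W : nat).
Hypothesis W0 : (0 < W)%N.

Lemma harm_coprime_rec y :
  harm_coprime F W (W * y.+1)
  = harm_coprime F W (W * y) + \sum_(W * y + 1 <= n < W * y.+1 + 1 | coprime n W) (n%:R)^-1.
Proof.
rewrite !addn1 /harm_coprime (@big_cat_nat _ _ _ (W * y).+1) //.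
by rewrite ltnS leq_mul2l leqnSn orbT.
Qed.

Lemma sum_block_const y (c : F) :
  \sum_(W * y + 1 <= n < W * y.+1 + 1 | coprime n W) c = c * (totient W)%:R.
Proof.
rewrite -(sum_block_coprime W y) natr_sum mulr_sumr big_mkcond; apply: eq_bigr => n _.
by case: coprime; rewrite ?mulr1 ?mulr0.
Qed.

(** Each block of [W] consecutive integers has [totient W] members coprime to [W], and each is at
    most the right end of its block. *)
Lemma harm_coprime_ge y :
  (totient W)%:R / W%:R * \sum_(1 <= j < y.+1) (j%:R)^-1 <= harm_coprime F W (W * y).
Proof.
elim: y => [|y IH]; first by rewrite muln0 big_geq // mulr0 /harm_coprime big_geq.
rewrite harm_coprime_rec big_nat_recr //= mulrDr lerD //.
have -> : (totient W)%:R / W%:R * (y.+1%:R)^-1 = (W * y.+1)%:R^-1 * (totient W)%:R :> F.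
  by rewrite natrM invfM; ring.
rewrite -(sum_block_const y) [leLHS]big_nat_cond [leRHS]big_nat_cond.
apply: ler_sum => n /andP[/andP[h1 h2] _].
by rewrite lef_pV2 ?posrE ?ltr0n ?ler_nat; try lia; rewrite muln_gt0 W0.
Qed.

Lemma harm_coprime_le y :
  harm_coprime F W (W * y)
  <= (totient W)%:R + (totient W)%:R / W%:R * \sum_(1 <= j < y.+1) (j%:R)^-1.
Proof.
have r0 : 0 <= (totient W)%:R / W%:R :> F by rewrite divr_ge0.
have s0 n : 0 <= \sum_(1 <= j < n) (j%:R)^-1 :> F by apply: sumr_ge0 => j _; rewrite invr_ge0.
case: y => [|y]; first by rewrite muln0 /harm_coprime big_geq // addr_ge0 // mulr_ge0.
apply: (@le_trans _ _ ((totient W)%:R + (totient W)%:R / W%:R * \sum_(1 <= j < y.+1) (j%:R)^-1)); last first.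
  by rewrite lerD2l ler_wpM2l // [leRHS]big_nat_recr //= lerDl invr_ge0.
(* In the first block the left end gives no bound; its [totient W] terms are bounded by 1 each,
   which is the additive constant. *)
elim: y => [|y IH]; rewrite harm_coprime_rec.
  rewrite muln0 {1}/harm_coprime big_geq // add0r [X in _ <= _ + _ * X]big_geq // mulr0 addr0.
  rewrite -[leRHS]mul1r -(sum_block_const 0) muln0 [leLHS]big_nat_cond [leRHS]big_nat_cond.
  apply: ler_sum => n /andP[/andP[h1 h2] _]; rewrite invf_le1 ?ler1n ?ltr0n; lia.
rewrite [X in _ <= _ + _ * X]big_nat_recr //= mulrDr addrA lerD //.
have -> : (totient W)%:R / W%:R * (y.+1%:R)^-1 = (W * y.+1)%:R^-1 * (totient W)%:R :> F.
  by rewrite natrM invfM; ring.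
rewrite -(sum_block_const y.+1) [leLHS]big_nat_cond [leRHS]big_nat_cond.
apply: ler_sum => n /andP[/andP[h1 h2] _].
have h3 : (0 < W * y.+1)%N by rewrite muln_gt0 W0.
by rewrite lef_pV2 ?posrE ?ltr0n ?ler_nat; lia.
Qed.

End Harmonic.

(** Monotonicity and the comparison with the harmonic sum follow from these two properties, so the
    sieve runs over an arbitrary ordered field and meets the real logarithm only at the levels of
    distribution. *)
Definition is_log (F : realFieldType) (ln : F -> F) : Prop :=
  (forall x, 0 < x -> ln x <= x - 1) /\
  (forall x y, 0 < x -> 0 < y -> ln (x * y) = ln x + ln y).

Section Log.
Variables (R : realFieldType) (ln : R -> R).
Hypothesis lnP : is_log ln.

Lemma ln_le_sub1 x : 0 < x -> ln x <= x - 1. Proof. exact: lnP.1. Qed.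

Lemma lnM x y : 0 < x -> 0 < y -> ln (x * y) = ln x + ln y. Proof. exact: lnP.2. Qed.

Lemma ln1 : ln 1 = 0.
Proof. by have := lnM ltr01 ltr01; rewrite mulr1 => h; apply: (addrI (ln 1)); rewrite addr0. Qed.

Lemma lnX x n : 0 < x -> ln (x ^+ n) = n%:R * ln x.
Proof.
move=> x0; elim: n => [|n IH]; first by rewrite expr0 mul0r ln1.
by rewrite exprS lnM ?exprn_gt0 // IH -natr1; ring.
Qed.

Lemma ler_ln x y : 0 < x -> x <= y -> ln x <= ln y.
Proof.
move=> x0 xy; have y0 : 0 < y by apply: lt_le_trans xy.
have xy0 : 0 < x / y by rewrite divr_gt0.
have := ln_le_sub1 xy0; have := lnM y0 xy0; rewrite mulrC divfK ?lt0r_neq0 //.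
have : x / y <= 1 by rewrite ler_pdivrMr // mul1r.
by lra.
Qed.

Lemma ln_ge0 x : 1 <= x -> 0 <= ln x.
Proof. by move=> x1; rewrite -ln1 ler_ln. Qed.

Lemma ln_nat_step j : (0 < j)%N ->
  (j.+1%:R)^-1 <= ln (j.+1%:R) - ln (j%:R) <= (j%:R : R)^-1.
Proof.
move=> j0; have x0 : 0 < j%:R :> R by rewrite ltr0n.
rewrite -natr1; move: x0; set x := j%:R => x0.
have h1 : 0 < (x + 1) / x by rewrite divr_gt0; lra.
have h2 : 0 < x / (x + 1) by rewrite divr_gt0; lra.
have xn : x != 0 by rewrite lt0r_neq0.
have xn1 : x + 1 != 0 by rewrite lt0r_neq0; lra.
have E1 : ln (x + 1) = ln x + ln ((x + 1) / x) by rewrite -lnM // mulrC divfK.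
have E2 : ln x = ln (x + 1) + ln (x / (x + 1)) by rewrite -lnM // 1?mulrC ?divfK //; lra.
have := ln_le_sub1 h1; have := ln_le_sub1 h2.
have -> : x / (x + 1) - 1 = - (x + 1)^-1 by field.
have -> : (x + 1) / x - 1 = x^-1 by field.
by move=> l1 l2; apply/andP; split; lra.
Qed.

Lemma harm_ge y : ln (y.+1%:R) <= \sum_(1 <= j < y.+1) (j%:R)^-1 :> R.
Proof.
elim: y => [|y IH]; first by rewrite big_geq // (ln1 : ln 1%:R = 0).
rewrite big_nat_recr //=; have /andP[_] := ln_nat_step (ltn0Sn y); rewrite lerBlDl => h.
by apply: le_trans h _; rewrite lerD2r.
Qed.

Lemma harm_le y : (0 < y)%N -> \sum_(1 <= j < y.+1) (j%:R)^-1 <= 1 + ln y%:R :> R.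
Proof.
elim: y => // -[_ _|y IH _]; first by rewrite big_nat1 (ln1 : ln 1%:R = 0) invr1 addr0.
rewrite big_nat_recr //=; have /andP[+ _] := ln_nat_step (ltn0Sn y).
by rewrite lerBrDl => h; apply: le_trans (lerD (IH isT) (lexx _)) _; rewrite -addrA lerD2l.
Qed.

Section Kappa.
Variables (T : finType) (pr : T -> nat) (k D0 X : nat).
Hypotheses (k0 : (0 < k)%N) (kD0 : (k < D0)%N).
Hypotheses (pr_prime : forall t, prime (pr t)) (pr_inj : injective pr).
Hypotheses (prD0 : forall t, (D0 < pr t)%N) (prX : forall t, (pr t <= X)%N).
Hypothesis pr_onto : forall p, prime p -> (D0 < p <= X)%N -> exists t, pr t = p.
Variables (s m : nat).
Local Notation W := (D0`!).
(** As a multiple of [W], [B ^ i.+1] ends a whole number of blocks of length [W]. *)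
Let B := (W * s)%N.
Hypotheses (s1 : (1 < s)%N) (BX : (B ^ m <= X)%N).

Let rho : R := (totient W)%:R / W%:R.
Let W0 : (0 < W)%N. Proof. exact: fact_gt0. Qed.
Let B0 : (0 < B)%N. Proof. by rewrite muln_gt0 W0 ltnW. Qed.
Let rho0 : 0 < rho. Proof. by rewrite divr_gt0 ?ltr0n ?totient_gt0. Qed.
Let Bi i : (B ^ i.+1 = W * (s * B ^ i))%N.
Proof. by rewrite expnS mulnA. Qed.

(** The excess of the harmonic bounds over the logarithm is [W + 1], namely the first block and the
    constant of [harm_le]; it is absorbed by [e * ln B]. *)
Lemma kappa_le i (e : R) : 0 < e -> e < 1 -> k%:R / (D0 - k)%N%:R <= e -> W%:R + 1 <= e * ln B%:R ->
  \sum_(D : {set T} | (qprod pr D < B ^ i.+1)%N) mprod (fun t => ((pr t)%:R - k%:R)^-1 : R) D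
  <= (1 + e) / (1 - e) * (rho * ln B%:R) * i.+1%:R.
Proof.
move=> e0 e1 De Be.
apply: (@le_trans _ _ (\sum_(D : {set T} | (qprod pr D <= B ^ i.+1)%N) mprod (fun t => ((pr t)%:R - k%:R)^-1 : R) D)).
  rewrite big_mkcond [leRHS]big_mkcond; apply: ler_sum => D _.
  case: ifP => [/ltnW -> //|_]; case: ifP => // _.
  by apply: mprod_ge0 => t; rewrite invr_ge0 subr_ge0 ler_nat ltnW // (ltn_trans kD0).
apply: le_trans (one_dim_le k0 kD0 pr_prime pr_inj prD0 prX _ De e1) _.
have e1' : 0 < (1 - e)^-1 by rewrite invr_gt0; lra.
have -> : (1 + e) / (1 - e) * (rho * ln B%:R) * i.+1%:R
   = (1 - e)^-1 * (rho * ((1 + e) * (i.+1%:R * ln B%:R))) by ring.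
rewrite ler_pM2l // Bi; apply: le_trans (harm_coprime_le _ W0 _) _.
have y0 : (0 < s * B ^ i)%N by rewrite muln_gt0 expn_gt0 B0 (ltnW s1).
rewrite -/rho; have -> : (totient W)%:R = rho * W%:R :> R.
  by rewrite /rho divfK // pnatr_eq0 -lt0n.
rewrite -mulrDr ler_pM2l //.
apply: (@le_trans _ _ (W%:R + (1 + ln (s * B ^ i)%N%:R))); first by rewrite lerD2l harm_le.
have h1 : ln (s * B ^ i)%N%:R <= ln ((B ^ i.+1)%N%:R) :> R.
  by rewrite ler_ln ?ltr0n // ler_nat Bi leq_pmull.
have h2 : ln ((B ^ i.+1)%N%:R) = i.+1%:R * ln B%:R :> R by rewrite natrX lnX ?ltr0n.
have i1 : 1 <= i.+1%:R :> R by rewrite ler1n.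
have b0 : 0 <= e * ln B%:R by apply: le_trans Be; rewrite addr_ge0.
have h3 : e * ln B%:R <= i.+1%:R * (e * ln B%:R) by rewrite ler_peMl.
rewrite h2 in h1; rewrite mulrDl mul1r [e * _]mulrCA; move: Be; lra.
Qed.

Lemma kappa_ge i (e : R) : (i <= m)%N -> 0 < e -> e < 1 -> k%:R / (D0 - k)%N%:R <= e -> W%:R + 1 <= e * ln B%:R ->
  (1 - e) / (1 + e) * (rho * ln B%:R) * i%:R
  <= \sum_(D : {set T} | (qprod pr D <= B ^ i)%N) mprod (fun t => ((pr t)%:R - 1)^-1 : R) D.
Proof.
case: i => [|i] im e0 e1 De Be.
  by rewrite mulr0; apply: sumr_ge0 => D _; apply: mprod_ge0 => t; rewrite invr_ge0 subr_ge0 ler1n prime_gt0.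
have iX : (B ^ i.+1 <= X)%N by apply: leq_trans BX; rewrite leq_pexp2l.
have := one_dim_ge R k0 kD0 pr_prime prD0 pr_onto iX.
set S := \sum_(_ | _) _ => h.
have S0 : 0 <= S.
  by apply: sumr_ge0 => D _; apply: mprod_ge0 => t; rewrite invr_ge0 subr_ge0 ler1n prime_gt0.
have D00 : (0 < D0)%N by apply: leq_ltn_trans kD0.
have h1 : (D0%:R)^-1 <= e.
  apply: le_trans De; rewrite -[leLHS]mul1r ler_pM ?invr_ge0 ?ler1n //.
  by rewrite lef_pV2 ?posrE ?ltr0n ?ler_nat ?subn_gt0 // leq_subr.
have h2 : harm_coprime R W (B ^ i.+1) <= (1 + e) * S.
  by apply: le_trans h _; rewrite ler_wpM2r // lerD2l.
have e1' : 0 < 1 + e by lra.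
have -> : (1 - e) / (1 + e) * (rho * ln B%:R) * i.+1%:R
   = (rho * ((1 - e) * (i.+1%:R * ln B%:R))) / (1 + e) by ring.
rewrite ler_pdivrMr // [S * _]mulrC; apply: le_trans h2.
rewrite Bi; apply: le_trans (harm_coprime_ge R W0 _); rewrite ler_pM2l //.
apply: le_trans (harm_ge _).
have y0 : (0 < s * B ^ i)%N by rewrite muln_gt0 expn_gt0 B0 (ltnW s1).
have h3 : ln ((B ^ i.+1)%N%:R) = i.+1%:R * ln B%:R :> R by rewrite natrX lnX ?ltr0n.
have h4 : ln ((B ^ i.+1)%N%:R) = ln W%:R + ln (s * B ^ i)%N%:R :> R.
  by rewrite Bi natrM lnM ?ltr0n.
have h5 : ln (s * B ^ i)%N%:R <= ln (s * B ^ i).+1%:R :> R.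
  by rewrite ler_ln ?ltr0n // ler_nat.
have h6 : ln W%:R <= W%:R - 1 :> R by rewrite ln_le_sub1 // ltr0n.
have i1 : 1 <= i.+1%:R :> R by rewrite ler1n.
have b0 : 0 <= e * ln B%:R by apply: le_trans Be; rewrite addr_ge0.
have h7 : e * ln B%:R <= i.+1%:R * (e * ln B%:R) by rewrite ler_peMl.
rewrite mulrBl mul1r [e * _]mulrCA; move: Be h3 h4 h5 h6 h7; lra.
Qed.

End Kappa.
End Log.

(** * Sums over arithmetic progressions *)

(** [p.-1 * h] is -h modulo p, written with natural numbers. *)
Lemma dvdn_add_mod p n h : (0 < p)%N -> (p %| n + h)%N = (n == p.-1 * h %[mod p])%N.
Proof.
move=> p0; by rewrite -(eqn_modDr h) -mulSnr prednK // modnMr.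
Qed.

Lemma coprime_mod_eq a b Q : a = b %[mod Q] -> coprime a Q = coprime b Q.
Proof. by move=> h; rewrite -coprime_modl h coprime_modl. Qed.

Section APSum.
Variables (F : realFieldType) (H Ha Hb : seq nat).
Hypotheses (HE : perm_eq H (Hb ++ Ha)) (Huniq : uniq H).

Definition hits (n p : nat) := has (fun h => p %| n + h)%N H.

(** As p exceeds all elements of [H], it divides n + h for at most one h; those h in [Hb] are
    excluded because [x] vanishes there. *)
Lemma hits_split (x : F) n p : prime p -> (forall h, h \in H -> (h < p)%N) ->
  (forall h, h \in Hb -> (p %| n + h)%N -> x = 0) ->
  x *+ hits n p = \sum_(h <- Ha) x *+ (p %| n + h)%N.
Proof.
move=> pp Hp bad.
have uHa : uniq Ha by move: Huniq; rewrite (perm_uniq HE) cat_uniq => /and3P[].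
have [x0|x0] := eqVneq x 0; first by rewrite x0 mul0rn big1 // => h _; rewrite mul0rn.
have hE : hits n p = has (fun h => p %| n + h)%N Ha.
  rewrite /hits (perm_has _ HE) has_cat; case: hasP => // -[h hb /(bad h hb) /eqP].
  by rewrite (negbTE x0).
rewrite hE.
have inj h h' : h \in Ha -> h' \in Ha -> (p %| n + h)%N -> (p %| n + h')%N -> h = h'.
  move=> hHa h'Ha d d'.
  have hp : (h < p)%N by apply: Hp; rewrite (perm_mem HE) mem_cat hHa orbT.
  have hp' : (h' < p)%N by apply: Hp; rewrite (perm_mem HE) mem_cat h'Ha orbT.
  have : (n + h == n + h' %[mod p])%N by rewrite (eqP d) (eqP d').
  by rewrite eqn_modDl !modn_small // => /eqP.
case: hasP => [[h hHa d]|nh].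
  rewrite (bigD1_seq h) //= d big_seq_cond big1 ?addr0 // => h' /andP[h'Ha hh'].
  by case: (boolP (p %| n + h')%N) => // d'; rewrite (inj _ _ h'Ha hHa d' d) eqxx in hh'.
rewrite big_seq big1 // => h hHa; case: (boolP (p %| n + h)%N) => // d.
by case: nh; exists h.
Qed.

(** Each prime splits the condition into [size Ha] residue classes, glued to the modulus by the
    Chinese remainder theorem. [Hb] records the shifts that must stay coprime to the modulus: it is
    [[:: h]] when [x] is supported on n + h prime, and empty otherwise. *)
Lemma ap_sum (r : seq nat) (x : nat -> F) (M E : F) ps Q a :
  (0 < Q)%N -> all prime ps -> uniq ps ->
  (forall p h, p \in ps -> h \in H -> (h < p)%N) ->
  (forall p, p \in ps -> coprime Q p) ->
  (forall n p h, n \in r -> p \in ps -> h \in Hb -> (p %| n + h)%N -> x n = 0) ->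
  (forall h, h \in Hb -> coprime (a + h) Q) ->
  (forall c, (forall h, h \in Hb -> coprime (c + h) (Q * \prod_(p <- ps) p)) ->
     `|\sum_(n <- r) x n *+ (n == c %[mod Q * \prod_(p <- ps) p])%N - M| <= E) ->
  `|\sum_(n <- r) x n *+ ((n == a %[mod Q])%N && all (hits n) ps) - M *+ (size Ha ^ size ps)|
  <= E *+ (size Ha ^ size ps).
Proof.
elim: ps Q a => [|p ps IH] Q a Q0.
  move=> _ _ _ _ _ ga hyp; rewrite big_nil muln1 in hyp; rewrite expn0 !mulr1n.
  by under eq_bigr do rewrite andbT; apply: hyp.
rewrite /= => /andP[pp pps] /andP[pnps ups] Hp cQ bad ga hyp.
have p0 := prime_gt0 pp.
have cQp : coprime Q p by apply: cQ; rewrite inE eqxx.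
have Hpp h : h \in H -> (h < p)%N by apply: Hp; rewrite inE eqxx.
pose ah h := chinese Q p a (p.-1 * h).
have split1 n : n \in r ->
   x n *+ ((n == a %[mod Q])%N && (hits n p && all (hits n) ps))
   = \sum_(h <- Ha) x n *+ ((n == ah h %[mod Q * p])%N && all (hits n) ps).
  move=> nr; rewrite andbCA andbC -mulnb mulrnA.
  rewrite hits_split //; last first.
    move=> h hb d; rewrite (bad n p h nr _ hb d) ?mul0rn // inE eqxx //.
  apply: eq_bigr => h _; rewrite -mulrnA mulnb; congr (_ *+ nat_of_bool _).
  rewrite andbAC; congr andb.
  rewrite (chinese_remainder cQp) dvdn_add_mod //.
  by rewrite (chinese_modl cQp) (chinese_modr cQp).
rewrite big_seq (eq_bigr _ split1) -big_seq exchange_big /=.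
have sumc (c : F) : c *+ size Ha = \sum_(h <- Ha) c.
  by rewrite big_const_seq count_predT iter_addr_0.
rewrite expnSr !mulrnA !sumc -sumrB.
apply: le_trans (ler_norm_sum _ _ _) _.
rewrite big_seq [leRHS]big_seq; apply: ler_sum => h hHa.
have hH : h \in H by rewrite (perm_mem HE) mem_cat hHa orbT.
have QpE : (Q * p * \prod_(q <- ps) q = Q * \prod_(q <- p :: ps) q)%N.
  by rewrite big_cons mulnA.
apply: IH => //.
- by rewrite muln_gt0 Q0.
- by move=> q h' qps; apply: Hp; rewrite inE qps orbT.
- move=> q qps; rewrite coprimeMl cQ ?inE ?qps ?orbT //=.
  rewrite prime_coprime // dvdn_prime2 //; last exact: (allP pps).
  by apply: contraNneq pnps => ->.
- by move=> n q h' nr qps; apply: bad; rewrite // inE qps orbT.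
(* The new class is -h modulo p with h in [Ha], and h' in [Hb] differs from h, so p does not divide
   the shifted class. *)
- move=> h' hb; rewrite coprimeMr; apply/andP; split.
    rewrite (@coprime_mod_eq _ (a + h')) ?ga //.
    by apply/eqP; rewrite eqn_modDr (chinese_modl cQp).
  have hh' : h' != h.
    apply: contraTneq hHa => <-; move: Huniq; rewrite (perm_uniq HE) cat_uniq.
    by case/and3P => _ /hasPn nb _; apply: contraL hb => /nb.
  have h'H : h' \in H by rewrite (perm_mem HE) mem_cat hb.
  rewrite coprime_sym prime_coprime //; apply: contra hh' => d'.
  have d : (p %| ah h + h)%N by rewrite dvdn_add_mod // (chinese_modr cQp).
  have : (ah h + h' == ah h + h %[mod p])%N by rewrite (eqP d) (eqP d').
  by rewrite eqn_modDl !modn_small // Hpp.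
- by move=> c; rewrite QpE; apply: hyp.
Qed.

End APSum.

(** * Weighted sums and their error terms *)

Section Weighted.
Variables (F : realFieldType) (T : finType) (pr : T -> nat) (k B : nat) (H : seq nat).
Hypotheses (pr_prime : forall t, prime (pr t)) (pr_inj : injective pr).
Hypotheses (k0 : (0 < k)%N) (prk : forall t, (k < pr t)%N) (B1 : (1 < B)%N).
Hypotheses (Hpr : forall t h, h \in H -> (h < pr t)%N) (Huniq : uniq H).

Implicit Types (D E G : {set T}) (lam : {set T} -> F).
Local Notation q := (qprod pr).

Definition hit_set n G := [forall t in G, hits H n (pr t)].

Definition wgt lam n : F := \sum_D lam D *+ hit_set n D.

Lemma hit_setU n D E : hit_set n (D :|: E) = hit_set n D && hit_set n E.
Proof.
apply/forall_inP/andP => [h|[/forall_inP hD /forall_inP hE] t].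
  by split; apply/forall_inP => t tD; apply: h; rewrite inE tD ?orbT.
by rewrite inE => /orP[/hD|/hE].
Qed.

Lemma wgt_sq lam (x : F) n :
  x * wgt lam n ^+ 2 = \sum_D \sum_E lam D * lam E * (x *+ hit_set n (D :|: E)).
Proof.
rewrite expr2 /wgt mulr_suml mulr_sumr; apply: eq_bigr => D _.
rewrite !mulr_sumr; apply: eq_bigr => E _; rewrite hit_setU.
by case: (hit_set n D); case: (hit_set n E); rewrite /= ?mulr1n ?mulr0n; ring.
Qed.

Lemma hit_set_sum Ha Hb (r : seq nat) (x : nat -> F) (M E : F) Q a G :
  perm_eq H (Hb ++ Ha) -> (0 < Q)%N -> (forall t, coprime Q (pr t)) ->
  (forall n t h, n \in r -> t \in G -> h \in Hb -> (pr t %| n + h)%N -> x n = 0) ->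
  (forall h, h \in Hb -> coprime (a + h) Q) ->
  (forall c, (forall h, h \in Hb -> coprime (c + h) (Q * q G)) ->
     `|\sum_(n <- r) x n *+ (n == c %[mod Q * q G])%N - M| <= E) ->
  `|\sum_(n <- r) x n *+ ((n == a %[mod Q])%N && hit_set n G) - M *+ (size Ha ^ #|G|)|
  <= E *+ (size Ha ^ #|G|).
Proof.
move=> HE Q0 cQ bad ga hyp.
pose ps := [seq pr t | t <- enum G].
have psP p : p \in ps -> exists2 t, t \in G & p = pr t.
  by case/mapP => t; rewrite mem_enum => tG ->; exists t.
have qE : q G = (\prod_(p <- ps) p)%N by rewrite big_map big_enum.
have hE n : hit_set n G = all (hits H n) ps.
  apply/forall_inP/allP => [h p /psP [t tG ->]|h t tG]; first exact: h.
  by apply: h; apply/mapP; exists t; rewrite ?mem_enum.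
have sE : #|G| = size ps by rewrite size_map cardE.
under eq_bigr do rewrite hE; rewrite sE; rewrite qE in hyp.
apply: (ap_sum HE Huniq) => //.
- by apply/allP => p /psP [t _ ->].
- by rewrite map_inj_uniq ?enum_uniq.
- by move=> p h /psP [t _ ->] /Hpr.
- by move=> p /psP [t _ ->].
- by move=> n p h nr /psP [t tG ->]; apply: bad.
Qed.

(** In a pair with union [G], each prime of [G] lies in [D] only, in [E] only, or in both. *)
Lemma sum_setU_pairs (Y : {set T} -> F) :
  \sum_D \sum_E Y (D :|: E) = \sum_(G : {set T}) 3%:R ^+ #|G| * Y G.
Proof.
transitivity (\sum_(G : {set T}) mprod (fun=> (1 + 1) + 1 : F) G * Y G); last first.
  have -> : (1 + 1) + 1 = 3%:R :> F by ring.
  by apply: eq_bigr => G _; rewrite mprod_const.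
rewrite sum_mprodD; apply: eq_bigr => D _.
rewrite (sum_set_split D) mprod1D.
under [RHS]eq_bigr do rewrite [mprod (fun=> 1) _]mprod_const expr1n mulr1.
rewrite -mulr_sumr mulr_suml; apply: eq_bigr => E sED.
rewrite mprod_const expr1n mul1r; apply: eq_bigr => G _.
by rewrite setUA (setUidPl sED).
Qed.

Lemma qprodU_le D E : (q (D :|: E) <= q D * q E)%N.
Proof.
have -> : D :|: E = D :|: (E :\: D) by apply/setP => t; rewrite !inE; case: (t \in D).
rewrite qprodU; last by rewrite disjoints_subset setCD subsetUr.
rewrite leq_mul2l -{2}(setID E D) qprodU ?leq_pmull ?orbT ?(qprod_gt0 prk) //.
by rewrite disjoint_sym disjoints_subset setDE (subset_trans (subsetIr _ _)) // setCS subsetIr.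
Qed.

(** Expanding the square leads to moduli with [q G] at most [B ^ (m + m)]. The factor [3 * k] per
    prime collects 3 for the pairs with union [G] and at most [k] for the residue classes. *)
Lemma weighted_sum lam (Lam : F) m Ha Hb (r : seq nat) (x : nat -> F) (Mf Ef : {set T} -> F) Q a :
  perm_eq H (Hb ++ Ha) -> (size Ha <= k)%N -> (0 < Q)%N -> (forall t, coprime Q (pr t)) ->
  (forall n t h, n \in r -> h \in Hb -> (pr t %| n + h)%N -> x n = 0) ->
  (forall h, h \in Hb -> coprime (a + h) Q) ->
  (forall D, `|lam D| <= Lam) -> (forall D, (B ^ m < q D)%N -> lam D = 0) ->
  (forall G, 0 <= Ef G) ->
  (forall G c, (q G <= B ^ (m + m))%N ->
     (forall h, h \in Hb -> coprime (c + h) (Q * q G)) ->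
     `|\sum_(n <- r) x n *+ (n == c %[mod Q * q G])%N - Mf G| <= Ef G) ->
  `|\sum_(n <- r) x n *+ (n == a %[mod Q])%N * wgt lam n ^+ 2
    - \sum_(D : {set T}) \sum_(E : {set T})
        lam D * lam E * ((size Ha)%:R ^+ #|D :|: E| * Mf (D :|: E))|
  <= Lam ^+ 2 * \sum_(G : {set T} | (q G <= B ^ (m + m))%N) (3 * k)%:R ^+ #|G| * Ef G.
Proof.
move=> HE sHa Q0 cQ bad ga lamL lam0 E0 hyp.
have L0 : 0 <= Lam by apply: le_trans (lamL set0).
have -> : \sum_(n <- r) x n *+ (n == a %[mod Q])%N * wgt lam n ^+ 2
   = \sum_D \sum_E lam D * lam E * \sum_(n <- r) x n *+ ((n == a %[mod Q])%N && hit_set n (D :|: E)).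
  under eq_bigr do rewrite wgt_sq.
  rewrite exchange_big /=; apply: eq_bigr => D _.
  rewrite exchange_big /=; apply: eq_bigr => E _.
  by rewrite mulr_sumr; apply: eq_bigr => n _; rewrite -mulrnA mulnb.
rewrite -sumrB.
under eq_bigr => D _.
  rewrite -sumrB; under eq_bigr => E _ do rewrite -mulrBr; over.
pose Y G : F := Lam ^+ 2 * ((k%:R ^+ #|G| * Ef G) *+ (q G <= B ^ (m + m))%N).
have Y0 G : 0 <= Y G.
  by rewrite mulr_ge0 ?exprn_ge0 // mulrn_wge0 // mulr_ge0 // exprn_ge0.
apply: (@le_trans _ _ (\sum_D \sum_E Y (D :|: E))); last first.
  rewrite sum_setU_pairs mulr_sumr [leRHS]big_mkcond; apply: ler_sum => G _.
  rewrite /Y natrM exprMn; case: ifP => _; last by rewrite mulr0n !mulr0.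
  by rewrite mulr1n le_eqVlt; apply/orP; left; apply/eqP; ring.
apply: le_trans (ler_norm_sum _ _ _) _; apply: ler_sum => D _.
apply: le_trans (ler_norm_sum _ _ _) _; apply: ler_sum => E _.
have [hD|hD] := ltnP (B ^ m) (q D).
  by rewrite (lam0 D) // !mul0r normr0.
have [hE|hE] := ltnP (B ^ m) (q E).
  by rewrite (lam0 E) // mulr0 !mul0r normr0.
have hDE : (q (D :|: E) <= B ^ (m + m))%N.
  by apply: leq_trans (qprodU_le _ _) _; rewrite expnD leq_mul.
rewrite normrM /Y hDE mulr1n.
apply: ler_pM => //; first by rewrite normrM expr2 ler_pM.
have := hit_set_sum (E := Ef (D :|: E)) (M := Mf (D :|: E)) (r := r) (x := x) HE Q0 cQ.
move=> /(_ a (D :|: E)) h.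
have -> : (size Ha)%:R ^+ #|D :|: E| * Mf (D :|: E) = Mf (D :|: E) *+ (size Ha ^ #|D :|: E|).
  by rewrite -natrX mulr_natl.
apply: le_trans (h _ _ _) _ => //.
- by move=> n t h' nr _; apply: bad.
- by move=> c; apply: hyp.
rewrite -[leLHS]mulr_natl natrX ler_wpM2r // lerXn2r ?nnegrE // ler_nat //.
Qed.

Lemma error_split (Ef : {set T} -> F) (C tau : F) (K J : nat) :
  0 < tau -> 0 <= C -> (forall G, 0 <= Ef G) ->
  (forall G, (q G <= B ^ J)%N -> Ef G <= C * mprod (fun t => ((pr t)%:R - k%:R)^-1) G) ->
  \sum_(G : {set T} | (q G <= B ^ J)%N) K%:R ^+ #|G| * Ef G
  <= tau * \sum_(G : {set T} | (q G <= B ^ J)%N) Ef G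
     + tau^-1 * (C * \sum_(G : {set T} | (q G <= B ^ J)%N)
                   mprod (fun t => (K ^ 2)%:R * ((pr t)%:R - k%:R)^-1) G).
Proof.
move=> t0 C0 E0 hC; rewrite !mulr_sumr -big_split /=; apply: ler_sum => G hG.
rewrite mprodM mprod_const natrX -exprM mulnC exprM.
have z0 : 0 <= K%:R ^+ #|G| :> F by rewrite exprn_ge0.
move: z0; set z := K%:R ^+ #|G| => z0.
(* Replaces Cauchy-Schwarz: moduli with few prime factors are handled by the level of
   distribution, the others by the trivial bound. *)
have hz : z <= tau + tau^-1 * z ^+ 2.
  rewrite -(ler_pM2l t0) mulrDr mulrA divff ?mul1r ?lt0r_neq0 //.
  have := sqr_ge0 (tau - z); have := sqr_ge0 tau; nra.
apply: (@le_trans _ _ ((tau + tau^-1 * z ^+ 2) * Ef G)); first by rewrite ler_wpM2r.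
rewrite mulrDl lerD2l -mulrA ler_pM2l ?invr_gt0 // mulrCA ler_wpM2l ?sqr_ge0 //.
exact: hC.
Qed.

End Weighted.

(** * The sieve inequality *)

Lemma totient_le n : (totient n <= n)%N.
Proof.
rewrite totient_count_coprime -[leqRHS]subn0 -[leqRHS]muln1 -sum_nat_const_nat.
by apply: leq_sum => d _; exact: leq_b1.
Qed.

(* [lnB ^+ err_tau k] is the threshold [tau] in [error_split]; the two exponents are
   chosen so that all errors are [O(N / lnB ^+ 2)]. *)
Definition err_tau (k : nat) := ((3 * k) ^ 2 + k + k + 3)%N.
Definition err_exp (k : nat) := (err_tau k + k + k + 2)%N.

(** [lnB ^+ k * lam_const] bounds the sieve weights; the 2 comes from bounding the density of the
    dimension-one sums by 2 ln B. It does not depend on [B]. *)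
Definition lam_const (R : realFieldType) (k m : nat) (f : nat -> R) : R :=
  f 0%N * (2 ^+ k * 'C(m + k, k)%:R).

(** [C1] belongs to the average over moduli and [C2] to the trivial bound. The exponent
    [(3 * k) ^ 2] is the dimension created by squaring the factor [3 * k] in [error_split]. *)
Definition err_const (R : realFieldType) (k m : nat) (f : nat -> R) (C1 C2 : R) : R :=
  lam_const k m f ^+ 2 * (C1 + C2 * (2 ^+ ((3 * k) ^ 2)%N * 'C(m + m + (3 * k) ^ 2, (3 * k) ^ 2)%:R)).

Section Assembly.
Variables (R : realFieldType) (ln : R -> R).
Hypothesis lnP : is_log ln.
Variables (T : finType) (pr : T -> nat) (k D0 s m : nat) (H : seq nat) (f : nat -> R) (v0 : nat).
Local Notation W := (D0`!).
Let B := (W * s)%N.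
Hypotheses (k1 : (1 < k)%N) (kD0 : (k < D0)%N) (s1 : (1 < s)%N).
Hypotheses (pr_prime : forall t, prime (pr t)) (pr_inj : injective pr).
Hypotheses (prD0 : forall t, (D0 < pr t)%N) (prX : forall t, (pr t <= B ^ m)%N).
Hypothesis pr_onto : forall p, prime p -> (D0 < p <= B ^ m)%N -> exists t, pr t = p.
Hypotheses (Hsize : size H = k) (Huniq : uniq H) (HD0 : forall h, h \in H -> (h < D0)%N).
Hypothesis Hv0 : forall h, h \in H -> coprime (v0 + h) W.
Hypotheses (fd : forall i, f i.+1 <= f i) (f0 : forall i, 0 <= f i)
  (fm : forall i, (m < i)%N -> f i = 0).

Local Notation q := (qprod pr).
Local Notation lam := (gpy pr k B f).
Local Notation w := (wgt pr H lam).
Local Notation lnB := (ln B%:R).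

Let k0 : (0 < k)%N. Proof. exact: ltnW. Qed.
Let prk t : (k < pr t)%N. Proof. exact: ltn_trans kD0 (prD0 t). Qed.
Let W0 : (0 < W)%N. Proof. exact: fact_gt0. Qed.
Let B1 : (1 < B)%N. Proof. by rewrite (leq_trans s1) // leq_pmull. Qed.
Let rho : R := (totient W)%:R / W%:R.

Lemma rho_gt0 : 0 < rho. Proof. by rewrite divr_gt0 ?ltr0n ?totient_gt0. Qed.
Lemma rho_le1 : rho <= 1.
Proof. by rewrite ler_pdivrMr ?ltr0n // mul1r ler_nat totient_le. Qed.

Lemma inv_prk_ge0 t : 0 <= ((pr t)%:R - k%:R)^-1 :> R.
Proof. by rewrite invr_ge0 subr_ge0 ler_nat ltnW. Qed.

Lemma dim_sum_le j J (e : R) :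
  0 < e -> e <= 1 / 4 -> k%:R / (D0 - k)%N%:R <= e -> W%:R + 1 <= e * lnB ->
  \sum_(D : {set T} | (q D <= B ^ J)%N) mprod (fun t => j%:R * ((pr t)%:R - k%:R)^-1) D
   <= lnB ^+ j * (2 ^+ j * 'C(J + j, j)%:R).
Proof.
move=> e0 e1 De Be.
have l0 : 0 <= lnB by rewrite (ln_ge0 lnP) // ler1n ltnW.
have kap0 : 0 <= 2 * lnB by rewrite mulr_ge0.
rewrite mulrA -exprMn [lnB * 2]mulrC.
apply: (upper_dim k0 prk B1 (psi := fun t => ((pr t)%:R - k%:R)^-1) inv_prk_ge0 kap0) => i.
have e1' : e < 1 by lra.
apply: le_trans (kappa_le lnP k0 kD0 pr_prime pr_inj prD0 prX s1 i e0 e1' De Be) _.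
rewrite ler_wpM2r // -/rho.
have h1 : (1 + e) / (1 - e) <= 2 by rewrite ler_pdivrMr; lra.
have h2 : 0 <= (1 + e) / (1 - e) by rewrite divr_ge0; lra.
apply: ler_pM => //; first by rewrite mulr_ge0 // ltW // rho_gt0.
by rewrite ler_piMl // rho_le1.
Qed.

Lemma gpy_norm_le (e : R) D :
  0 < e -> e <= 1 / 4 -> k%:R / (D0 - k)%N%:R <= e -> W%:R + 1 <= e * lnB ->
  `|lam D| <= lnB ^+ k * lam_const k m f.
Proof.
move=> e0 e1 De Be; apply: le_trans (gpy_bound k1 prk B1 fd f0 fm D) _.
rewrite /lam_const mulrCA ler_wpM2l //.
exact: (dim_sum_le k m e0 e1 De Be).
Qed.

Lemma q_coprime_W t : coprime W (pr t).
Proof. by rewrite coprime_sym (coprime_prW pr_prime prD0). Qed.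

Lemma gpy_weighted Ha Hb (r : seq nat) (x : nat -> R) (Mf : {set T} -> R) (ee : nat -> R)
    (e C1 C2 N : R) :
  perm_eq H (Hb ++ Ha) ->
  (forall n t h, n \in r -> h \in Hb -> (pr t %| n + h)%N -> x n = 0) ->
  0 < e -> e <= 1 / 4 -> k%:R / (D0 - k)%N%:R <= e -> W%:R + 1 <= e * lnB ->
  0 <= N -> 0 <= C2 -> (forall d, 0 <= ee d) ->
  (forall G c, (q G <= B ^ (m + m))%N ->
     (forall h, h \in Hb -> coprime (c + h) (W * q G)) ->
     `|\sum_(n <- r) x n *+ (n == c %[mod W * q G])%N - Mf G| <= ee (W * q G)%N) ->
  (forall G, (q G <= B ^ (m + m))%N ->
     ee (W * q G)%N <= C2 * (N * lnB) * mprod (fun t => ((pr t)%:R - k%:R)^-1) G) ->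
  \sum_(1 <= d < (B ^ (m + m).+1).+1) ee d <= C1 * (N / lnB ^+ err_exp k) ->
  `|\sum_(n <- r) x n *+ (n == v0 %[mod W])%N * w n ^+ 2
    - \sum_(D : {set T}) \sum_(E : {set T})
        lam D * lam E * ((size Ha)%:R ^+ #|D :|: E| * Mf (D :|: E))|
  <= err_const k m f C1 C2 * (N / lnB ^+ 2).
Proof.
move=> HE bad e0 e1 De Be N0 C20 ee0 hyp triv avg.
have b1 : 1 <= lnB.
  have : 1 <= W%:R :> R by rewrite ler1n.
  by have : e * lnB <= 1 / 4 * lnB; [apply: ler_wpM2r; rewrite ?(ln_ge0 lnP) ?ler1n 1?ltnW|lra].
have b0 : 0 < lnB by lra.
have bne : lnB != 0 by rewrite lt0r_neq0.
have sHa : (size Ha <= k)%N by rewrite -Hsize (perm_size HE) size_cat leq_addl.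
have Hpr t h : h \in H -> (h < pr t)%N by move=> /HD0 hD; apply: ltn_trans hD (prD0 t).
have ga h : h \in Hb -> coprime (v0 + h) W.
  by move=> hb; apply: Hv0; rewrite (perm_mem HE) mem_cat hb.
apply: le_trans (@weighted_sum _ _ _ k B H pr_prime pr_inj prk Hpr Huniq lam
  (lnB ^+ k * lam_const k m f) m Ha Hb r x Mf (fun G => ee (W * q G)%N) W v0 HE sHa W0
  q_coprime_W bad ga _ _ _ hyp) _ => //.
- by move=> D; apply: (gpy_norm_le D e0).
- by move=> D; apply: gpy_out.
have tau0 : 0 < lnB ^+ err_tau k by rewrite exprn_gt0.
have CN0 : 0 <= C2 * (N * lnB) by rewrite !mulr_ge0 // ltW.
set SG := \sum_(_ | _) _.
have hSG : SG <= lnB ^+ err_tau k * (C1 * (N / lnB ^+ err_exp k))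
    + (lnB ^+ err_tau k)^-1 * (C2 * (N * lnB) *
       (lnB ^+ ((3 * k) ^ 2)%N * (2 ^+ ((3 * k) ^ 2)%N * 'C(m + m + (3 * k) ^ 2, (3 * k) ^ 2)%:R))).
  apply: le_trans (error_split (C := C2 * (N * lnB)) (3 * k) tau0 CN0 _ triv) _ => //.
  apply: lerD.
    rewrite ler_pM2l //; apply: le_trans avg.
    apply: (@sum_nat_inj_le _ _ _ xpredT (fun G => (W * q G)%N) ee) => //.
      move=> D E _ _ /eqP; rewrite eqn_pmul2l // => /eqP.
      exact: (qprod_inj pr_prime pr_inj).
    (* The factor [W <= B] of the modulus is why the averages run up to [B ^ (m + m).+1]. *)
    move=> G hG; rewrite muln_gt0 W0 (qprod_gt0 prk) ltnS expnS leq_mul // leq_pmulr // ltnW //.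
  rewrite ler_pM2l ?invr_gt0 // ler_wpM2l //.
  exact: (dim_sum_le _ _ e0 e1 De Be).
apply: (@le_trans _ _ ((lnB ^+ k * lam_const k m f) ^+ 2 * (lnB ^+ err_tau k * (C1 * (N / lnB ^+ err_exp k))
    + (lnB ^+ err_tau k)^-1 * (C2 * (N * lnB) *
       (lnB ^+ ((3 * k) ^ 2)%N * (2 ^+ ((3 * k) ^ 2)%N * 'C(m + m + (3 * k) ^ 2, (3 * k) ^ 2)%:R)))))).
  by rewrite ler_wpM2l // sqr_ge0.
rewrite /err_const le_eqVlt; apply/orP; left; apply/eqP.
move: (2 ^+ ((3 * k) ^ 2)%N * _) (lam_const k m f) => X Y.
rewrite /err_exp /err_tau !exprD !exprMn.
move: bne (expf_neq0 ((3 * k) ^ 2)%N bne) (expf_neq0 k bne).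
move: lnB (lnB ^+ ((3 * k) ^ 2)%N) (lnB ^+ k) => u y z u0 y0 z0.
by field; rewrite u0 y0 z0.
Qed.

End Assembly.

(** * Counting integers in a residue class, then the three weighted sums of the sieve *)

Lemma count_ap_period d c a : (0 < d)%N -> (\sum_(n <- iota a d) (n == c %[mod d]) = 1)%N.
Proof.
move=> d0; elim: a => [|a IH].
  transitivity (\sum_(n <- iota 0 d) (n == c %% d))%N.
    rewrite big_seq [RHS]big_seq; apply: eq_bigr => n; rewrite mem_iota add0n => /= nd.
    by rewrite modn_small.
  have -> : (\sum_(n <- iota 0 d) (n == c %% d) = count (pred1 (c %% d)) (iota 0 d))%N.
    by rewrite -sum1_count [RHS]big_mkcond.
  by rewrite count_uniq_mem ?iota_uniq // mem_iota add0n ltn_pmod.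
have : (\sum_(n <- iota a d.+1) (n == c %[mod d]) = (a == c %[mod d]) + \sum_(n <- iota a.+1 d) (n == c %[mod d]))%N.
  by rewrite big_cons.
rewrite -addn1 iotaD big_cat /= big_seq1 IH modnDr; lia.
Qed.

Lemma count_ap_bounds d c a u v : (0 < d)%N -> (v < d)%N ->
  (u <= \sum_(n <- iota a (u * d + v)) (n == c %[mod d]) <= u.+1)%N.
Proof.
move=> d0 vd; elim: u a => [|u IH] a.
  rewrite mul0n add0n /= -(count_ap_period c a d0) -(subnK (ltnW vd)) addnC iotaD big_cat.
  exact: leq_addr.
by rewrite mulSn -addnA iotaD big_cat /= count_ap_period // add1n !ltnS IH.
Qed.

Lemma count_ap_dist (F : realFieldType) d c a L : (0 < d)%N ->
  `|\sum_(n <- iota a L) 1 *+ (n == c %[mod d])%N - L%:R / d%:R| <= 1 :> F.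
Proof.
move=> d0.
have -> : \sum_(n <- iota a L) 1 *+ (n == c %[mod d])%N
   = (\sum_(n <- iota a L) (n == c %[mod d]))%N%:R :> F by rewrite natr_sum.
have vd : (L %% d < d)%N by rewrite ltn_pmod.
have := count_ap_bounds c a (L %/ d) d0 vd; rewrite -divn_eq.
set cnt := (\sum_(_ <- _) _)%N => /andP[h1 h2].
have dF : 0 < d%:R :> F by rewrite ltr0n.
have l1 : (L %/ d)%:R <= L%:R / d%:R :> F.
  by rewrite ler_pdivlMr // -natrM ler_nat leq_divM.
have l2 : L%:R / d%:R <= (L %/ d).+1%:R :> F.
  by rewrite ler_pdivrMr // -natrM ler_nat ltnW // ltn_ceil.
have c1 : (L %/ d)%:R <= cnt%:R :> F by rewrite ler_nat.
have c2 : cnt%:R <= (L %/ d).+1%:R :> F by rewrite ler_nat.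
rewrite -natr1 in l2 c2; rewrite ler_norml; apply/andP; split; lra.
Qed.

Section Positivity.
Variables (R : realFieldType) (ln : R -> R).
Hypothesis lnP : is_log ln.
Variables (T : finType) (pr : T -> nat) (k D0 s m M : nat) (H : seq nat) (f : nat -> R) (v0 : nat).
Local Notation W := (D0`!).
Let B := (W * s)%N.
Hypotheses (k1 : (1 < k)%N) (kD0 : (k < D0)%N) (s1 : (1 < s)%N).
Hypotheses (pr_prime : forall t, prime (pr t)) (pr_inj : injective pr).
Hypotheses (prD0 : forall t, (D0 < pr t)%N) (prX : forall t, (pr t <= B ^ m)%N).
Hypothesis pr_onto : forall p, prime p -> (D0 < p <= B ^ m)%N -> exists t, pr t = p.
Hypotheses (Hsize : size H = k) (Huniq : uniq H) (HD0 : forall h, h \in H -> (h < D0)%N).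
Hypothesis Hv0 : forall h, h \in H -> coprime (v0 + h) W.
Hypotheses (fd : forall i, f i.+1 <= f i) (f0 : forall i, 0 <= f i)
  (fm : forall i, (m < i)%N -> f i = 0).
Hypothesis mM : ((m + m).+1 + err_exp k <= M)%N.

Local Notation q := (qprod pr).
Local Notation lam := (gpy pr k B f).
Local Notation w := (wgt pr H lam).
Local Notation lnB := (ln B%:R).
Local Notation N := (B ^ M)%N.
Local Notation r := (iota N.+1 N).

Let k0 : (0 < k)%N. Proof. exact: ltnW. Qed.
Let prk t : (k < pr t)%N. Proof. exact: ltn_trans kD0 (prD0 t). Qed.
Let W0 : (0 < W)%N. Proof. exact: fact_gt0. Qed.
Let B1 : (1 < B)%N. Proof. by rewrite (leq_trans s1) // leq_pmull. Qed.
Let B0 : (0 < B)%N. Proof. exact: ltnW. Qed.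
Let mmM : (m + m <= M)%N.
Proof. by apply: leq_trans mM; apply: (leq_trans (leqnSn _)); apply: leq_addr. Qed.

Definition theta n : R := if prime n then ln n%:R else 0.

Lemma lnB_ge1 (e : R) : 0 < e -> e <= 1 / 4 -> W%:R + 1 <= e * lnB -> 1 <= lnB.
Proof.
move=> e0 e1 Be.
have : 1 <= W%:R :> R by rewrite ler1n.
by have : e * lnB <= 1 / 4 * lnB; [apply: ler_wpM2r; rewrite ?(ln_ge0 lnP) ?ler1n 1?ltnW|lra].
Qed.

(** Each class has error at most 1, so the average is the number of moduli; [mM] and ln B <= B make
    it at most [N / lnB ^+ err_exp k]. *)
Lemma sieve_count (e : R) :
  0 < e -> e <= 1 / 4 -> k%:R / (D0 - k)%N%:R <= e -> W%:R + 1 <= e * lnB ->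
  `|\sum_(n <- r) 1 *+ (n == v0 %[mod W])%N * w n ^+ 2
     - N%:R / W%:R * quad_form (gdens R pr k) lam| <= err_const k m f 1 1 * (N%:R / lnB ^+ 2).
Proof.
move=> e0 e1 De Be; have b1 := lnB_ge1 e0 e1 Be.
have HE : perm_eq H ([::] ++ H) by [].
have NF : 0 <= N%:R :> R by [].
have := @gpy_weighted R ln lnP T pr k D0 s m H f v0 k1 kD0 s1 pr_prime pr_inj prD0 prX Hsize
  Huniq HD0 Hv0 fd f0 fm H [::] r (fun=> 1) (fun G => N%:R / (W * q G)%N%:R) (fun=> 1)
  e 1 1 N%:R HE _ e0 e1 De Be NF ler01 (fun=> ler01).
rewrite -/B => h.
have -> : N%:R / W%:R * quad_form (gdens R pr k) lam
  = \sum_(D : {set T}) \sum_(E : {set T})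
     lam D * lam E * ((size H)%:R ^+ #|D :|: E| * (N%:R / (W * q (D :|: E))%N%:R)).
  rewrite /quad_form mulr_sumr; apply: eq_bigr => D _; rewrite mulr_sumr; apply: eq_bigr => E _.
  rewrite mulrCA; congr (_ * _); rewrite Hsize natrM invfM -(inv_qprod R pr) -mprod_const.
  have -> X : mprod (gdens R pr k) X = mprod (fun=> k%:R) X * mprod (fun t => (pr t)%:R^-1) X.
    by rewrite -mprodM.
  ring.
apply: h => //.
- by move=> G c hG _; apply: count_ap_dist; rewrite muln_gt0 W0 (qprod_gt0 prk).
- move=> G hG; rewrite mul1r.
  have h1 : ((q G)%:R)^-1 <= mprod (fun t => ((pr t)%:R - k%:R)^-1) G :> R.
    rewrite -inv_qprod; apply: le_mprod => t; rewrite invr_ge0 ler0n /=.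
    by rewrite lef_pV2 ?posrE ?subr_gt0 ?ltr_nat ?ltr0n ?prime_gt0 // gerBl.
  apply: le_trans (_ : N%:R * ((q G)%:R)^-1 <= _); last first.
    by rewrite -mulrA ler_pM // ?invr_ge0 // (le_trans h1) // ler_peMl // mprod_ge0 // => t;
      rewrite invr_ge0 subr_ge0 ler_nat ltnW.
  rewrite ler_pdivlMr ?ltr0n ?(qprod_gt0 prk) // mul1r ler_nat (leq_trans hG) //.
  by rewrite leq_exp2l.
rewrite mul1r big_const_nat iter_addr_0 subn1 /=.
rewrite ler_pdivlMr ?exprn_gt0 //; last by lra.
apply: (@le_trans _ _ ((B ^ (m + m).+1)%:R * (B ^ err_exp k)%:R)).
  rewrite ler_wpM2l // natrX lerXn2r ?nnegrE //; first by lra.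
  by apply: le_trans (ln_le_sub1 lnP _) _; rewrite ?ltr0n // gerBl.
by rewrite -natrM -expnD ler_nat leq_exp2l.
Qed.

Lemma totient_qprod G : (totient (q G))%:R = mprod (fun t => (pr t)%:R - 1) G :> R.
Proof.
have [n] := ubnP #|G|; elim: n G => // n IH G; rewrite ltnS => Gn.
have [->|[t tG]] := set_0Vmem G; first by rewrite qprod0 mprod0.
have {}IH := IH (G :\ t); rewrite (cardsD1 t) tG in Gn; have {}IH := IH Gn.
rewrite -(setD1K tG).
have dtG : [disjoint [set t] & G :\ t] by rewrite disjoints1 !inE eqxx.
rewrite qprodU // mprodU // totient_coprime; last first.
  by rewrite {1}/qprod big_set1 prime_coprime // (dvd_qprod pr_prime pr_inj) !inE eqxx.
rewrite natrM IH {1}/qprod {2}/mprod !big_set1 totient_prime //; congr (_ * _).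
by rewrite -[in RHS](prednK (prime_gt0 (pr_prime t))) -natr1 addrK.
Qed.

Lemma totient_Wq G : ((totient (W * q G))%:R)^-1
  = (totient W)%:R^-1 * mprod (fun t => ((pr t)%:R - 1)^-1) G :> R.
Proof.
rewrite totient_coprime; last by rewrite coprime_sym (coprime_qW pr_prime prD0).
by rewrite natrM invfM mprodV totient_qprod.
Qed.

Lemma inv_totient_Wq_le G :
  ((totient (W * q G))%:R)^-1 <= mprod (fun t => ((pr t)%:R - k%:R)^-1) G :> R.
Proof.
rewrite totient_Wq; apply: (@le_trans _ _ (mprod (fun t => ((pr t)%:R - 1)^-1) G)).
  rewrite ler_piMl ?invf_le1 ?ltr0n ?ler1n ?totient_gt0 // mprod_ge0 // => t.
  by rewrite invr_ge0 subr_ge0 ler1n prime_gt0.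
apply: le_mprod => t; rewrite invr_ge0 subr_ge0 ler1n prime_gt0 //=.
rewrite lef_pV2 ?posrE ?subr_gt0 ?ltr_nat ?ltr1n ?prime_gt1 //.
by rewrite lerD2l lerN2 ler1n.
Qed.

(** A prime n + h exceeds N, hence every sieving prime, so none of these divides it. Only the other
    [k - 1] shifts can be hit, which leads to [gdens']. *)
Lemma sieve_primes (e C1 C2 : R) (EA : nat -> R) h :
  0 < e -> e <= 1 / 4 -> k%:R / (D0 - k)%N%:R <= e -> W%:R + 1 <= e * lnB ->
  h \in H -> 0 <= C2 -> (forall d, 0 <= EA d) ->
  (forall d c, (0 < d <= B ^ (m + m).+1)%N -> coprime (c + h) d ->
    `|\sum_(n <- r) theta (n + h) *+ (n == c %[mod d])%N - N%:R / (totient d)%:R| <= EA d) ->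
  (forall d, (0 < d <= B ^ (m + m).+1)%N -> EA d <= C2 * (N%:R * lnB) / (totient d)%:R) ->
  \sum_(1 <= d < (B ^ (m + m).+1).+1) EA d <= C1 * (N%:R / lnB ^+ err_exp k) ->
  `|\sum_(n <- r) theta (n + h) *+ (n == v0 %[mod W])%N * w n ^+ 2
     - N%:R / (totient W)%:R * quad_form (gdens' R pr k) lam|
  <= err_const k m f C1 C2 * (N%:R / lnB ^+ 2).
Proof.
move=> e0 e1 De Be hH C20 EA0 cls triv avg; have b1 := lnB_ge1 e0 e1 Be.
have HE : perm_eq H ([:: h] ++ rem h H) by rewrite /= perm_to_rem.
have NF : 0 <= N%:R :> R by [].
have dW G : (q G <= B ^ (m + m))%N -> (0 < W * q G <= B ^ (m + m).+1)%N.
  by move=> hG; rewrite muln_gt0 W0 (qprod_gt0 prk) expnS leq_mul // leq_pmulr // ltnW.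
have := @gpy_weighted R ln lnP T pr k D0 s m H f v0 k1 kD0 s1 pr_prime pr_inj prD0 prX Hsize
  Huniq HD0 Hv0 fd f0 fm (rem h H) [:: h] r (fun n => theta (n + h))
  (fun G => N%:R / (totient (W * q G))%:R) EA
  e C1 C2 N%:R HE _ e0 e1 De Be NF C20 EA0.
rewrite -/B => hyp.
have -> : N%:R / (totient W)%:R * quad_form (gdens' R pr k) lam
  = \sum_(D : {set T}) \sum_(E : {set T})
     lam D * lam E * ((size (rem h H))%:R ^+ #|D :|: E| * (N%:R / (totient (W * q (D :|: E)))%:R)).
  rewrite /quad_form mulr_sumr; apply: eq_bigr => D _; rewrite mulr_sumr; apply: eq_bigr => E _.
  rewrite mulrCA; congr (_ * _); rewrite size_rem // Hsize totient_Wq -mprod_const.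
  have -> X : mprod (gdens' R pr k) X = mprod (fun=> k.-1%:R) X * mprod (fun t => ((pr t)%:R - 1)^-1) X.
    by rewrite -mprodM.
  ring.
apply: hyp => //.
- move=> n t h'; rewrite mem_iota inE => /andP[Nn _] /eqP -> d; rewrite /theta.
  case: ifP => // pnh; move: d; rewrite dvdn_prime2 // => /eqP prE.
  have : (pr t <= N)%N.
    by apply: leq_trans (prX t) _; rewrite leq_exp2l // (leq_trans (leq_addr m m)).
  by rewrite prE leqNgt (leq_trans Nn) // leq_addr.
- by move=> G c hG ch; apply: cls; rewrite ?dW // ch // inE.
- move=> G hG; apply: le_trans (triv _ (dW G hG)) _.
  rewrite ler_wpM2l //; first by rewrite !mulr_ge0 //; lra.
  exact: inv_totient_Wq_le.
Qed.

(** The expected main term is 0. Condition (B) covers all residue classes, so no coprimality with n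
    + c0 is required and [Hb] is empty. *)
Lemma sieve_liouville (e C1 C2 : R) (EB : nat -> R) (la : nat -> R) :
  0 < e -> e <= 1 / 4 -> k%:R / (D0 - k)%N%:R <= e -> W%:R + 1 <= e * lnB ->
  0 <= C2 -> (forall d, 0 <= EB d) ->
  (forall d c, (0 < d <= B ^ (m + m).+1)%N ->
    `|\sum_(n <- r) la n *+ (n == c %[mod d])%N| <= EB d) ->
  (forall d, (0 < d <= B ^ (m + m).+1)%N -> EB d <= C2 * (N%:R * lnB) / (totient d)%:R) ->
  \sum_(1 <= d < (B ^ (m + m).+1).+1) EB d <= C1 * (N%:R / lnB ^+ err_exp k) ->
  `|\sum_(n <- r) la n *+ (n == v0 %[mod W])%N * w n ^+ 2|
  <= err_const k m f C1 C2 * (N%:R / lnB ^+ 2).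
Proof.
move=> e0 e1 De Be C20 EB0 cls triv avg; have b1 := lnB_ge1 e0 e1 Be.
have HE : perm_eq H ([::] ++ H) by [].
have NF : 0 <= N%:R :> R by [].
have dW G : (q G <= B ^ (m + m))%N -> (0 < W * q G <= B ^ (m + m).+1)%N.
  by move=> hG; rewrite muln_gt0 W0 (qprod_gt0 prk) expnS leq_mul // leq_pmulr // ltnW.
have := @gpy_weighted R ln lnP T pr k D0 s m H f v0 k1 kD0 s1 pr_prime pr_inj prD0 prX Hsize
  Huniq HD0 Hv0 fd f0 fm H [::] r la (fun G => 0) EB
  e C1 C2 N%:R HE _ e0 e1 De Be NF C20 EB0.
rewrite -/B => hyp.
have E0 : \sum_(D : {set T}) \sum_(E : {set T})
     lam D * lam E * ((size H)%:R ^+ #|D :|: E| * 0) = 0 :> R.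
  by rewrite big1 // => D _; rewrite big1 // => E _; rewrite !mulr0.
rewrite E0 subr0 in hyp.
apply: hyp => //.
- by move=> G c hG ch; rewrite subr0; apply: cls; rewrite ?dW.
- move=> G hG; apply: le_trans (triv _ (dW G hG)) _.
  rewrite ler_wpM2l //; first by rewrite !mulr_ge0 //; lra.
  exact: inv_totient_Wq_le.
Qed.

End Positivity.

(** * Comparison of the main terms *)

Definition main_sum (R : realFieldType) (k m : nat) (f : nat -> R) : R :=
  \sum_(i < m.+1) f i ^+ 2 * 'C(i + k.-1, k.-1)%:R.

Definition main_sum' (R : realFieldType) (k m : nat) (f : nat -> R) : R :=
  \sum_(a < m) tailsum m f a.+1 ^+ 2 * 'C(a, k.-2)%:R.

(** Twice the difference of the main terms, prime part minus penalty, up to a positive factor. [M]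
    is ln N / ln B, [M * (1 + e)] bounds ln(3N) / ln B, and the ratios of 1 - e and 1 + e come from
    the one-sided densities. *)
Definition margin (R : realFieldType) (k m M : nat) (f : nat -> R) (e : R) : R :=
  (2 * k)%:R * ((1 - e) / (1 + e)) ^+ k.+1 * main_sum' k m f
  - M%:R * (1 + e) * ((1 + e) / (1 - e)) ^+ k * main_sum k m f.

(** With b = ln B the main terms are of order N b^(k+1), while all errors together are O(N / b). The
    crude condition in the last hypothesis, linear in b, is therefore enough. *)
Lemma margin_algebra (R : realFieldType) (k : nat) (K M N W phi b d d' e1 Q Qs T Ts cA c1 L : R) :
  0 < K -> 0 <= M -> 0 < N -> 0 < W -> 0 < phi -> 1 <= b -> 0 < e1 -> 0 <= cA -> 0 <= c1 ->
  0 <= Q -> Q <= (d * (phi / W * b)) ^+ k * T -> (d' * (phi / W * b)) ^+ k.+1 * Ts <= Qs ->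
  L <= M * b * e1 ->
  2 * W * (K * cA + M * e1 * (c1 + cA))
    < (phi / W) ^+ k * (2 * K * d' ^+ k.+1 * Ts - M * e1 * d ^+ k * T) * b ->
  L / 2 * (N / W * Q + c1 * (N / b ^+ 2) + cA * (N / b ^+ 2))
   < K * (N / phi * Qs - cA * (N / b ^+ 2)).
Proof.
move=> K0 M0 N0 W0 phi0 b1 e10 cA0 c10 Q0 hQ hQs hL big.
have b0 : 0 < b by lra.
have U0 : 0 <= N / W * Q + c1 * (N / b ^+ 2) + cA * (N / b ^+ 2).
  by rewrite !addr_ge0 // mulr_ge0 // ?divr_ge0 ?exprn_ge0 // ltW.
have h1 : L / 2 * (N / W * Q + c1 * (N / b ^+ 2) + cA * (N / b ^+ 2))
   <= (M * b * e1) / 2 * (N / W * Q + c1 * (N / b ^+ 2) + cA * (N / b ^+ 2)).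
  by rewrite ler_wpM2r // ler_wpM2r // invr_ge0.
apply: le_lt_trans h1 _.
rewrite -subr_gt0.
have rho0 : 0 < phi / W by rewrite divr_gt0.
have -> : K * (N / phi * Qs - cA * (N / b ^+ 2))
   - M * b * e1 / 2 * (N / W * Q + c1 * (N / b ^+ 2) + cA * (N / b ^+ 2))
  = N * ((K / phi * Qs - M * e1 / 2 * b / W * Q) - (K * cA / b ^+ 2 + M * e1 / 2 * (c1 + cA) / b)).
  by field; rewrite ?(lt0r_neq0 b0) ?(lt0r_neq0 W0) ?(lt0r_neq0 phi0).
rewrite mulr_gt0 // subr_gt0.
set E := K * cA + M * e1 * (c1 + cA) in big *.
have E0 : 0 <= E by rewrite addr_ge0 // mulr_ge0 ?addr_ge0 // ?mulr_ge0 // ltW.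
set eta := 2 * K * _ * Ts - _ in big *.
have big0 : 0 < (phi / W) ^+ k * eta * b by apply: le_lt_trans big; rewrite !mulr_ge0 // ltW.
have re0 : 0 < (phi / W) ^+ k * eta by rewrite -(pmulr_lgt0 _ b0).
apply: (@le_lt_trans _ _ E).
  have h2 : K * cA / b ^+ 2 <= K * cA.
    by rewrite ler_pdivrMr ?exprn_gt0 // ler_peMr ?exprn_ege1 // mulr_ge0 // ltW.
  have h3 : M * e1 / 2 * (c1 + cA) / b <= M * e1 * (c1 + cA).
    have z0 : 0 <= M * e1 * (c1 + cA) by rewrite mulr_ge0 ?addr_ge0 // mulr_ge0 // ltW.
    rewrite ler_pdivrMr //.
    apply: (@le_trans _ _ (M * e1 * (c1 + cA) * 1)); last by rewrite ler_wpM2l.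
    have -> : M * e1 / 2 * (c1 + cA) = M * e1 * (c1 + cA) / 2 by ring.
    by lra.
  exact: lerD.
apply: (@lt_le_trans _ _ ((phi / W) ^+ k * eta * b / (2 * W))).
  by rewrite ltr_pdivlMr ?mulr_gt0 // mulrC.
apply: (@le_trans _ _ ((phi / W) ^+ k * eta * b ^+ k.+1 / (2 * W))).
  rewrite ler_pM2r ?invr_gt0 ?mulr_gt0 // ler_pM2l // exprS ler_peMr ?exprn_ege1 //.
  exact: ltW.
have l1 : K / phi * ((d' * (phi / W * b)) ^+ k.+1 * Ts) <= K / phi * Qs.
  by rewrite ler_wpM2l // divr_ge0 // ltW.
have l2 : M * e1 / 2 * b / W * Q <= M * e1 / 2 * b / W * ((d * (phi / W * b)) ^+ k * T).
  by rewrite ler_wpM2l // !mulr_ge0 // ?invr_ge0 // ltW.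
apply: le_trans (lerB l1 l2).
rewrite le_eqVlt; apply/orP; left; apply/eqP; rewrite /eta !exprMn !exprS.
move: (d' ^+ k) (d ^+ k) (b ^+ k) (phi ^+ k) (W^-1 ^+ k) => x1 x2 x3 x4 x5.
by field; rewrite ?(lt0r_neq0 b0) ?(lt0r_neq0 W0) ?(lt0r_neq0 phi0).
Qed.

Section Positive.
Variables (R : realFieldType) (ln : R -> R).
Hypothesis lnP : is_log ln.
Variables (k D0 s m M : nat) (H : seq nat) (f : nat -> R) (v0 : nat).
Local Notation W := (D0`!).
Let B := (W * s)%N.
Hypotheses (k1 : (1 < k)%N) (kD0 : (k < D0)%N) (s1 : (1 < s)%N).
Hypotheses (Hsize : size H = k) (Huniq : uniq H) (HD0 : forall h, h \in H -> (h < D0)%N).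
Hypothesis Hv0 : forall h, h \in H -> coprime (v0 + h) W.
Hypotheses (fd : forall i, f i.+1 <= f i) (f0 : forall i, 0 <= f i)
  (fm : forall i, (m < i)%N -> f i = 0).
Hypothesis mM : ((m + m).+1 + err_exp k <= M)%N.
Local Notation lnB := (ln B%:R).
Local Notation N := (B ^ M)%N.
Local Notation r := (iota N.+1 N).

Definition sieve_prime := {x : 'I_(B ^ m).+1 | prime x && (D0 < x)%N}.
Definition sieve_prime_val (t : sieve_prime) : nat := val (val t).

Lemma sieve_prime_prime t : prime (sieve_prime_val t). Proof. by case/andP: (valP t). Qed.
Lemma sieve_prime_gt t : (D0 < sieve_prime_val t)%N. Proof. by case/andP: (valP t). Qed.
Lemma sieve_prime_le t : (sieve_prime_val t <= B ^ m)%N. Proof. by rewrite -ltnS ltn_ord. Qed.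
Lemma sieve_prime_inj : injective sieve_prime_val. Proof. by move=> s' t h; do 2 apply: val_inj. Qed.
Lemma sieve_prime_onto p : prime p -> (D0 < p <= B ^ m)%N -> exists t, sieve_prime_val t = p.
Proof.
move=> pp /andP[Dp pB]; rewrite -ltnS in pB.
have h : prime (Ordinal pB) && (D0 < Ordinal pB)%N by rewrite /= pp.
by exists (exist _ (Ordinal pB) h).
Qed.

Lemma err_const_ge0 (C1 C2 : R) : 0 <= C1 -> 0 <= C2 -> 0 <= err_const k m f C1 C2.
Proof. by move=> h1 h2; rewrite mulr_ge0 ?sqr_ge0 // addr_ge0 // !mulr_ge0 // exprn_ge0. Qed.

(** If no n had the stated inequality, averaging its negation against the nonnegative weights [u]
    would contradict [margin_algebra]. *)
Lemma sieve_positive (e C1 C2 : R) (EA : nat -> nat -> R) (EB : nat -> R) (la : nat -> R) :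
  0 < e -> e <= 1 / 4 -> k%:R / (D0 - k)%N%:R <= e -> W%:R + 1 <= e * lnB ->
  2 <= e * (M%:R * lnB) -> 0 <= C1 -> 0 <= C2 ->
  2 * W%:R * (k%:R * err_const k m f C1 C2
              + M%:R * (1 + e) * (err_const k m f 1 1 + err_const k m f C1 C2))
    < ((totient W)%:R / W%:R) ^+ k * margin k m M f e * lnB ->
  (forall h d, h \in H -> 0 <= EA h d) ->
  (forall h d c, h \in H -> (0 < d <= B ^ (m + m).+1)%N -> coprime (c + h) d ->
    `|\sum_(n <- r) theta ln (n + h) *+ (n == c %[mod d])%N - N%:R / (totient d)%:R| <= EA h d) ->
  (forall h d, h \in H -> (0 < d <= B ^ (m + m).+1)%N ->
     EA h d <= C2 * (N%:R * lnB) / (totient d)%:R) ->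
  (forall h, h \in H ->
     \sum_(1 <= d < (B ^ (m + m).+1).+1) EA h d <= C1 * (N%:R / lnB ^+ err_exp k)) ->
  (forall d, 0 <= EB d) ->
  (forall d c, (0 < d <= B ^ (m + m).+1)%N ->
    `|\sum_(n <- r) la n *+ (n == c %[mod d])%N| <= EB d) ->
  (forall d, (0 < d <= B ^ (m + m).+1)%N -> EB d <= C2 * (N%:R * lnB) / (totient d)%:R) ->
  \sum_(1 <= d < (B ^ (m + m).+1).+1) EB d <= C1 * (N%:R / lnB ^+ err_exp k) ->
  exists2 n, n \in r & ln (3 * N)%:R / 2 * (1 + la n) < \sum_(h <- H) theta ln (n + h).
Proof.
move=> e0 e1 De Be Me C10 C20 big EA0 clsA trivA avgA EB0 clsB trivB avgB.
have k0 : (0 < k)%N by exact: ltnW.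
have W0 : (0 < W)%N by exact: fact_gt0.
have B1 : (1 < B)%N by rewrite (leq_trans s1) // leq_pmull.
have b1 := lnB_ge1 lnP s1 e0 e1 Be; rewrite -/B in b1.
have b0 : 0 < lnB by apply: lt_le_trans b1.
have prk t : (k < sieve_prime_val t)%N by exact: ltn_trans kD0 (sieve_prime_gt t).
case: (boolP (has (fun n => ln (3 * N)%:R / 2 * (1 + la n) < \sum_(h <- H) theta ln (n + h)) r)).
  by case/hasP => n nr hn; exists n.
move=> /hasPn none; exfalso.
set lam := gpy sieve_prime_val k B f.
pose w n := wgt sieve_prime_val H lam n.
pose u n : R := 1 *+ (n == v0 %[mod W])%N * w n ^+ 2.
have u0 n : 0 <= u n by rewrite mulr_ge0 ?sqr_ge0 // mulrn_wge0.
have S1 := sieve_count lnP k1 kD0 s1 sieve_prime_prime sieve_prime_inj sieve_prime_gt sieve_prime_le Hsize Huniq HD0 Hv0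
   fd f0 fm mM e0 e1 De Be.
have S2 h : h \in H -> _ := fun hH => sieve_primes lnP k1 kD0 s1 sieve_prime_prime sieve_prime_inj sieve_prime_gt sieve_prime_le
   Hsize Huniq HD0 Hv0 fd f0 fm mM e0 e1 De Be hH C20 (fun d => EA0 h d hH)
   (fun d c => clsA h d c hH) (fun d => trivA h d hH) (avgA h hH).
have S3 := sieve_liouville lnP k1 kD0 s1 sieve_prime_prime sieve_prime_inj sieve_prime_gt sieve_prime_le Hsize Huniq HD0 Hv0
   fd f0 fm e0 e1 De Be C20 EB0 clsB trivB avgB.
rewrite -/B -/lam in S1 S2 S3.
have kapE (x : R) : 0 <= x -> 0 <= x * ((totient W)%:R / W%:R * lnB).
  by move=> x0; rewrite !mulr_ge0 ?invr_ge0 // ltW.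
have e1' : e < 1 by lra.
have dp : 0 <= (1 + e) / (1 - e) by rewrite divr_ge0; lra.
have dm : 0 <= (1 - e) / (1 + e) by rewrite divr_ge0; lra.
have Q1 := @quad_form_gpy_le R _ sieve_prime_val k B m f k1 prk B1 fd f0 fm _ (kapE _ dp)
  (fun i => kappa_le lnP k0 kD0 sieve_prime_prime sieve_prime_inj sieve_prime_gt sieve_prime_le s1 i e0 e1' De Be).
have Q2 := @quad_form_gpy_ge R _ sieve_prime_val k B m f k1 prk B1 fd f0 fm _ (kapE _ dm)
  (fun i im => kappa_ge lnP k0 kD0 sieve_prime_prime sieve_prime_gt sieve_prime_onto s1 (leqnn _) im e0 e1' De Be).
rewrite -/lam in Q1 Q2.
have Q0 : 0 <= quad_form (gdens R sieve_prime_val k) lam.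
  rewrite quad_form_gpy //; apply: sumr_ge0 => S _; rewrite mulr_ge0 ?sqr_ge0 //.
  by apply: mprod_ge0 => t; apply/ltW/hdens_gt0.
(* Here ln 3 <= 2 <= e ln N. *)
have L3 : ln (3 * N)%:R <= M%:R * lnB * (1 + e).
  rewrite natrM (lnM lnP) ?ltr0n ?expn_gt0 ?(ltnW B1) // natrX (lnX lnP) ?ltr0n ?(ltnW B1) //.
  have := ln_le_sub1 lnP (ltr0Sn R 2); move: Me; rewrite mulrDr mulr1 [e * _]mulrC.
  by move: (M%:R * lnB) (M%:R * lnB * e) (ln 3) => x y z; lra.
have NF : 0 < N%:R :> R by rewrite ltr0n expn_gt0 ltnW.
have kF : 0 < k%:R :> R by rewrite ltr0n.
have WF : 0 < W%:R :> R by rewrite ltr0n.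
have phiF : 0 < (totient W)%:R :> R by rewrite ltr0n totient_gt0.
have h1e : 0 < 1 + e by lra.
have cA0 := err_const_ge0 C10 C20.
have c10 := err_const_ge0 ler01 ler01.
rewrite /margin natrM in big.
have := margin_algebra kF (ler0n _ M) NF WF phiF b1 h1e cA0 c10 Q0 Q1 Q2 L3 big.
rewrite ltNge => /negP; apply.
have sum2 : \sum_(h <- H) \sum_(n <- r) theta ln (n + h) *+ (n == v0 %[mod W])%N * w n ^+ 2
   <= ln (3 * N)%:R / 2 * (\sum_(n <- r) u n + \sum_(n <- r) la n *+ (n == v0 %[mod W])%N * w n ^+ 2).
  rewrite exchange_big /= -big_split mulr_sumr /= big_seq [leRHS]big_seq; apply: ler_sum => n nr.
  have := none n nr; rewrite -leNgt => h; rewrite -mulr_suml.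
  rewrite /u; case: (n == v0 %[mod W])%N; last first.
    rewrite !mulr0n !mul0r addr0 mulr0 big1 ?mul0r //.
  rewrite !mulr1n -mulrDl mulrA ler_wpM2r ?sqr_ge0 //.
have sum2ge : k%:R * (N%:R / (totient W)%:R * quad_form (gdens' R sieve_prime_val k) lam
     - err_const k m f C1 C2 * (N%:R / lnB ^+ 2))
  <= \sum_(h <- H) \sum_(n <- r) theta ln (n + h) *+ (n == v0 %[mod W])%N * w n ^+ 2.
  have -> (z : R) : k%:R * z = \sum_(h <- H) z.
    by rewrite big_const_seq count_predT iter_addr_0 Hsize mulr_natl.
  rewrite big_seq [leRHS]big_seq; apply: ler_sum => h hH; have := S2 h hH.
  by rewrite ler_distl => /andP[].
apply: le_trans sum2ge _; apply: le_trans sum2 _.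
have L0 : 0 <= ln (3 * N)%:R / 2.
  by rewrite divr_ge0 // (ln_ge0 lnP) // ler1n muln_gt0 expn_gt0 (ltnW B1).
rewrite ler_wpM2l //; apply: lerD; last first.
  by apply: le_trans S3; rewrite ler_norm.
by move: S1; rewrite ler_distl => /andP[].
Qed.

End Positive.

(** * Levels of distribution *)

Local Notation R := Rdefinitions.R.
Local Arguments ln x : clear scopes.
Local Arguments exp x : clear scopes.
Local Arguments Rpower x y : clear scopes.

Lemma ln_is_log : is_log ln.
Proof.
split=> [x /RltP x0|x y /RltP x0 /RltP y0]; last exact: ln_mult.
have := exp_ineq1_le (ln x); rewrite exp_ln // => h.
by apply/RleP; change (Rle (ln x) (Rminus x (IZR 1))); Lra.lra.
Qed.

Lemma sumRE l : sumR l = \sum_(x <- l) x.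
Proof. by elim: l => [|x l IH]; rewrite ?big_nil // big_cons /= -IH. Qed.

Lemma maxR_ge x l : x \in l -> x <= maxR l.
Proof.
elim: l => // y l IH; rewrite inE => /orP[/eqP ->|/IH h]; first by apply/RleP/Rmax_l.
by apply: le_trans h _; apply/RleP/Rmax_r.
Qed.

Lemma maxR_ge0 l : 0 <= maxR l.
Proof. by elim: l => [|y l IH] //=; apply: le_trans IH _; apply/RleP/Rmax_r. Qed.

Lemma maxR_le (C : R) l : 0 <= C -> (forall x, x \in l -> x <= C) -> maxR l <= C.
Proof.
move=> C0; elim: l => [|y l IH] h //=; apply/RleP/Rmax_lub; apply/RleP.
  by apply: h; rewrite inE eqxx.
by apply: IH => x xl; apply: h; rewrite inE xl orbT.
Qed.

Definition ap_sum_upto (g : nat -> R) (N d a : nat) : R :=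
  \sum_(n <- iota 1 N) g n *+ (n == a %[mod d])%N.

Lemma theta_apE N d a : theta_ap N d a = ap_sum_upto (theta ln) N d a.
Proof.
rewrite /theta_ap sumRE big_map big_filter big_mkcond; apply: eq_bigr => n _.
by rewrite /theta INRE; case: prime => /=; case: (_ == _); rewrite ?mulr1n ?mulr0n.
Qed.

Lemma liouville_apE N d a : liouville_ap N d a = ap_sum_upto liouville N d a.
Proof.
rewrite /liouville_ap sumRE big_map big_filter big_mkcond; apply: eq_bigr => n _.
by case: (_ == _).
Qed.

Lemma ap_sum_shift g N h d c :
  \sum_(n <- iota N.+1 N) g (n + h)%N *+ (n == c %[mod d])%N
  = ap_sum_upto g (N + h + N) d (c + h) - ap_sum_upto g (N + h) d (c + h).
Proof.
rewrite /ap_sum_upto iotaD big_cat /= [RHS]addrC addKr.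
have -> : (1 + (N + h) = h + N.+1)%N by lia.
rewrite iotaDl big_map; apply: eq_bigr => n _.
by rewrite [(h + n)%N]addnC eqn_modDr.
Qed.

Lemma ap_sum_mod g N d a : ap_sum_upto g N d (a %% d) = ap_sum_upto g N d a.
Proof. by rewrite /ap_sum_upto; apply: eq_bigr => n _; rewrite modn_mod. Qed.

Lemma ap_sum_norm_le g N d a (L : R) : (0 < d)%N -> (forall n, (n <= N)%N -> `|g n| <= L) ->
  `|ap_sum_upto g N d a| <= L * (N%:R / d%:R + 1).
Proof.
move=> d0 gL; have L0 : 0 <= L by apply: le_trans (gL 0%N _).
apply: (@le_trans _ _ (L * \sum_(n <- iota 1 N) 1 *+ (n == a %[mod d])%N)); last first.
  rewrite ler_wpM2l //; have := @count_ap_dist R d a 1 N d0.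
  by rewrite ler_distl => /andP[].
apply: le_trans (ler_norm_sum _ _ _) _; rewrite mulr_sumr big_seq [leRHS]big_seq.
apply: ler_sum => n; rewrite mem_iota add1n ltnS => /andP[_ nN].
by case: (_ == _); rewrite ?mulr1n ?mulr0n ?normr0 ?mulr0 // mulr1 gL.
Qed.

Lemma theta_norm_le n N : (n <= N)%N -> (0 < N)%N -> `|theta ln n| <= ln N%:R :> R.
Proof.
move=> nN N0; have lN := ln_ge0 ln_is_log (_ : 1 <= N%:R :> R).
rewrite /theta; case: ifP => pn; last by rewrite normr0 lN // ler1n.
rewrite ger0_norm; first by rewrite (ler_ln ln_is_log) ?ltr0n ?prime_gt0 // ler_nat.
by rewrite (ln_ge0 ln_is_log) // ler1n prime_gt0.
Qed.

Lemma liouville_norm n : `|liouville n| = 1.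
Proof.
rewrite /liouville; elim: (bigOmega n) => [|j IH] /=; first by rewrite normr1.
by rewrite RmultE normrM IH mulr1 (_ : IZR (-1) = -1) ?normrN1.
Qed.

Definition max_errA N d : R :=
  maxR [seq Rabs (Rminus (theta_ap N d a) (Rdiv (INR N) (INR (totient d)))) | a <- iota 0 d & coprime a d].
Definition max_errB N d : R :=
  maxR [seq maxR [seq Rabs (liouville_ap y d a) | a <- iota 0 d] | y <- iota 0 N.+1].

Lemma max_errA_ge N d c : (0 < d)%N -> coprime c d ->
  `|ap_sum_upto (theta ln) N d c - N%:R / (totient d)%:R| <= max_errA N d.
Proof.
move=> d0 cd; apply: maxR_ge; apply/mapP; exists (c %% d)%N.
  by rewrite mem_filter coprime_modl cd mem_iota ltn_pmod.
by rewrite theta_apE ap_sum_mod !INRE.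
Qed.

Lemma max_errB_ge N y d c : (0 < d)%N -> (y <= N)%N ->
  `|ap_sum_upto liouville y d c| <= max_errB N d.
Proof.
move=> d0 yN; apply: (@le_trans _ _ (maxR [seq Rabs (liouville_ap y d a) | a <- iota 0 d])).
  apply: maxR_ge; apply/mapP; exists (c %% d)%N; first by rewrite mem_iota ltn_pmod.
  by rewrite liouville_apE ap_sum_mod.
by apply: maxR_ge; apply/mapP; exists y; rewrite // mem_iota.
Qed.

Lemma max_errA_le N d : (0 < d)%N -> (0 < N)%N ->
  max_errA N d <= ln N%:R * (N%:R / d%:R + 1) + N%:R / (totient d)%:R.
Proof.
move=> d0 N0; have lN : 0 <= ln N%:R by rewrite (ln_ge0 ln_is_log) // ler1n.
apply: maxR_le; first by rewrite addr_ge0 ?mulr_ge0 ?addr_ge0 ?divr_ge0 ?invr_ge0 ?ler0n ?ler01 //.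
move=> x /mapP[a _ ->]; rewrite theta_apE !INRE.
change (`|ap_sum_upto (theta ln) N d a - N%:R / (totient d)%:R|
  <= ln N%:R * (N%:R / d%:R + 1) + N%:R / (totient d)%:R).
apply: le_trans (ler_normB _ _) _; apply: lerD.
  by apply: ap_sum_norm_le => // n nN; apply: theta_norm_le.
by rewrite ger0_norm // divr_ge0 ?ler0n.
Qed.

Lemma max_errB_le N d : (0 < d)%N -> max_errB N d <= N%:R / d%:R + 1.
Proof.
move=> d0; have C0 (n : nat) : 0 <= n%:R / d%:R + 1 :> R by rewrite addr_ge0 ?divr_ge0 ?ler0n ?ler01.
apply: maxR_le => // x /mapP[y]; rewrite mem_iota add0n ltnS => yN ->.
apply: maxR_le => // z /mapP[a _ ->]; rewrite liouville_apE.
have h : `|ap_sum_upto liouville y d a| <= 1 * (y%:R / d%:R + 1).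
  by apply: ap_sum_norm_le => // n _; rewrite liouville_norm.
by apply: le_trans h _; rewrite mul1r lerD2r ler_wpM2r ?invr_ge0 ?ler0n ?ler_nat.
Qed.

Lemma mem_qs_upto d (Y : nat) (X : R) : Y%:R <= X -> (0 < d <= Y)%N -> d \in qs_upto X.
Proof.
move=> YX /andP[d0 dY]; have dX : d%:R <= X by apply: le_trans YX; rewrite ler_nat.
rewrite mem_filter; apply/andP; split.
  by case: Rle_dec => // nh; case: nh; rewrite INRE; apply/RleP.
rewrite mem_iota d0 add1n ltnS /=.
apply/ssrnat.leP; apply: INR_le; rewrite INRE.
have [h _] := archimed X; have dX' : Rle d%:R X by apply/RleP.
have X0 : Rle 0 X by apply: Rle_trans dX'; rewrite -INRE; apply: pos_INR.
have up0 : Z.le Z0 (up X) by apply: le_IZR; Lra.lra.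
by rewrite INR_IZR_INZ Z2Nat.id //; Lra.lra.
Qed.

Lemma uniq_qs_upto X : uniq (qs_upto X).
Proof. by rewrite filter_uniq // iota_uniq. Qed.

Lemma sum_qs_upto_ge (u : nat -> R) (Y : nat) (X : R) : (forall d, 0 <= u d) -> Y%:R <= X ->
  \sum_(1 <= d < Y.+1) u d <= sumR [seq u d | d <- qs_upto X].
Proof.
move=> u0 YX; rewrite sumRE big_map.
apply: (@le_trans _ _ (\sum_(d <- qs_upto X | (d <= Y)%N) u d)); last first.
  by rewrite big_mkcond; apply: ler_sum => d _; case: ifP.
rewrite -[leRHS]big_filter le_eqVlt; apply/orP; left; apply/eqP; apply: perm_big.
apply: uniq_perm; [exact: iota_uniq | exact/filter_uniq/uniq_qs_upto | move=> d].
rewrite mem_index_iota mem_filter ltnS; apply/idP/andP => [h|[dY dq]].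
  by split; [case/andP: h | apply: (mem_qs_upto YX)].
by rewrite dY andbT; move: dq; rewrite mem_filter mem_iota => /and3P[].
Qed.

Definition admissible (H : seq nat) :=
  forall p, prime p -> exists a, forall h, h \in H -> ~~ (p %| a + h)%N.

(** For p larger than the size of [H], the classes -h cannot fill all residues modulo p, so only the
    small primes need a computation. *)
Lemma admissible_small H :
  all (fun p => has (fun a => all (fun h => ~~ (p %| a + h)%N) H) (iota 0 p))
      [seq p <- iota 0 (size H).+1 | prime p] -> admissible H.
Proof.
move=> /allP small p pp; have [pH|Hp] := leqP p (size H).
  have /small/hasP[a _ /allP ha] : p \in [seq p <- iota 0 (size H).+1 | prime p].
    by rewrite mem_filter pp mem_iota.
  by exists a.
have p0 := prime_gt0 pp.
have [|a ap al] := @allPn _ (fun a => a \in [seq (p.-1 * h %% p)%N | h <- H]) (iota 0 p) _.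
  apply/negP => /allP sub; have := uniq_leq_size (iota_uniq 0 p) sub.
  by rewrite size_iota size_map leqNgt Hp.
exists a => h hH; apply: contra al; rewrite dvdn_add_mod // => /eqP E.
apply/mapP; exists h => //; move: ap; rewrite mem_iota add0n => /= ap.
by rewrite -E modn_small.
Qed.

(** Good residues modulo the primes up to [D] are glued one prime at a time. *)
Lemma admissible_residue H D : admissible H ->
  exists v, forall h, h \in H -> coprime (v + h) D`!.
Proof.
move=> adm.
have [v hv] : exists v, forall p h, prime p -> (p <= D)%N -> h \in H -> ~~ (p %| v + h)%N.
  elim: D => [|D [v hv]].
    by exists 0%N => p h pp; rewrite leqn0 => /eqP p0; rewrite p0 in pp.
  have [pD|npD] := boolP (prime D.+1); last first.
    exists v => p h pp; rewrite leq_eqVlt => /orP[/eqP pE|]; last exact: hv.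
    by rewrite -pE pp in npD.
  have [a ha] := adm _ pD.
  have cop : coprime D`! D.+1.
    rewrite coprime_sym prime_coprime //; apply/negP => /(prime_dvd_fact_le pD).
    by rewrite ltnn.
  have modP p x y h : x = y %[mod p] -> (p %| x + h)%N = (p %| y + h)%N.
    by move=> xy; rewrite /dvdn -modnDml xy modnDml.
  exists (chinese D`! D.+1 v a) => p h pp; rewrite leq_eqVlt => /orP[/eqP ->|pD'] hH.
    by rewrite (modP _ _ a) ?ha // (chinese_modr cop).
  have dv : (p %| D`!)%N by rewrite dvdn_fact // prime_gt0.
  rewrite (modP _ _ v) ?hv //.
  by rewrite -(modn_dvdm _ dv) (chinese_modl cop) modn_dvdm.
exists v => h hH; rewrite /coprime; apply: contraT => g1.
have g0 : (0 < gcdn (v + h) D`!)%N by rewrite gcdn_gt0 fact_gt0 orbT.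
have pp : prime (pdiv (gcdn (v + h) D`!)) by rewrite pdiv_prime // ltn_neqAle eq_sym g1.
have := pdiv_dvd (gcdn (v + h) D`!); rewrite dvdn_gcd => /andP[d1 d2].
by have := hv _ _ pp (prime_dvd_fact_le pp d2) hH; rewrite d1.
Qed.

(** * From the levels of distribution to averages over the sieve moduli *)

Lemma ler_expR (x y : R) : x <= y -> exp x <= exp y.
Proof.
rewrite le_eqVlt => /orP[/eqP -> //|/RltP xy].
by apply/ltW/RltP/exp_increasing.
Qed.

(** Since [2m + 1 <= theta0 * M], the moduli up to [B ^ (m + m).+1] lie below [N' ^ theta0] for all
    N' >= B^M. Letting N' run up to 3 B^M covers the shifted end points N + h and 2N + h. *)
Lemma avg_transfer (mx : nat -> nat -> R) (theta0 C0 : R) (N0 A m M : nat) :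
  (forall N d, 0 <= mx N d) -> (0 < A)%N -> (0 < M)%N ->
  (m + m).+1%:R <= theta0 * M%:R ->
  (forall N : nat, (N0 <= N)%N ->
    sumR [seq mx N d | d <- qs_upto (Rpower (INR N) theta0)]
    <= C0 * INR N / Rpower (ln (INR N)) (INR A)) ->
  forall B N', (N0 <= B)%N -> (2 < B)%N -> (B ^ M <= N' <= 3 * B ^ M)%N ->
    \sum_(1 <= d < (B ^ (m + m).+1).+1) mx N' d
    <= 3 * `|C0| * ((B ^ M)%:R / ln B%:R ^+ A).
Proof.
move=> mx0 A0 M0 mM hyp B N' NB B3 /andP[N1 N2].
have B0 : 0 < B%:R :> R by rewrite ltr0n (leq_trans _ B3).
have lB : 0 < ln B%:R.
  have /RltP h : 1 < B%:R :> R by rewrite ltr1n (leq_trans _ B3).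
  by rewrite -(ln1 ln_is_log); apply/RltP/ln_increasing => //; apply: Rlt_0_1.
have BN' : (B <= N')%N.
  by apply: leq_trans N1; rewrite -{1}(expn1 B) leq_exp2l // (leq_trans _ B3).
have lBN : ln B%:R <= ln N'%:R by rewrite (ler_ln ln_is_log) // ler_nat.
have lN : 0 < ln N'%:R by apply: lt_le_trans lBN.
have M00 : 0 < M%:R :> R by rewrite ltr0n.
have t0 : 0 <= theta0.
  by rewrite -(pmulr_lge0 _ M00); apply: le_trans mM; rewrite ler0n.
have Y : (B ^ (m + m).+1)%:R <= Rpower (INR N') theta0.
  rewrite INRE /Rpower natrX.
  have -> : B%:R ^+ (m + m).+1 = exp ((m + m).+1%:R * ln B%:R).
    by rewrite -(lnX ln_is_log) // exp_ln //; apply/RltP; rewrite exprn_gt0.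
  apply: ler_expR; apply: (@le_trans _ _ (theta0 * M%:R * ln B%:R)).
    by rewrite ler_wpM2r // ltW.
  rewrite -mulrA; apply: ler_wpM2l => //.
  rewrite -(lnX ln_is_log) // -natrX (ler_ln ln_is_log) ?ler_nat //.
  by rewrite natrX exprn_gt0.
apply: le_trans (sum_qs_upto_ge (mx0 N') Y) _.
apply: le_trans (hyp N' (leq_trans NB BN')) _.
rewrite Rpower_pow; last by rewrite INRE; apply/RltP.
rewrite !INRE RpowE.
have lA : 0 < ln B%:R ^+ A by rewrite exprn_gt0.
apply: (@le_trans _ _ (`|C0| * N'%:R / ln B%:R ^+ A)).
  apply: (@le_trans _ _ (`|C0| * N'%:R / ln N'%:R ^+ A)).
    by rewrite !ler_wpM2r ?invr_ge0 ?ler0n ?exprn_ge0 ?ler_norm // ltW.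
  rewrite ler_wpM2l ?mulr_ge0 ?normr_ge0 ?ler0n // lef_pV2 ?posrE ?exprn_gt0 //.
  by rewrite lerXn2r ?nnegrE // ltW.
have -> : 3 * `|C0| * ((B ^ M)%:R / ln B%:R ^+ A) = `|C0| * (3 * B ^ M)%:R / ln B%:R ^+ A.
  by rewrite natrM; ring.
by rewrite ler_wpM2r ?invr_ge0 ?(ltW lA) // ler_wpM2l ?normr_ge0 ?ler_nat.
Qed.

(* [condA] and [condB] are convertible to this with [max_errA] and [max_errB]. *)
Definition level_of_distribution (mx : nat -> nat -> R) (vt : R) : Prop :=
  forall eps A : R, Rlt (IZR 0) eps -> Rlt (IZR 0) A ->
  exists C : R, exists N0 : nat, forall N : nat, (N0 <= N)%N ->
    Rle (sumR [seq mx N d | d <- qs_upto (Rpower (INR N) (Rminus vt eps))])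
        (Rdiv (Rmult C (INR N)) (Rpower (ln (INR N)) A)).

Lemma level_avg (mx : nat -> nat -> R) (theta0 vt : R) (A m M : nat) :
  (forall N d, 0 <= mx N d) -> theta0 < vt -> level_of_distribution mx vt ->
  (0 < A)%N -> (0 < M)%N -> (m + m).+1%:R <= theta0 * M%:R ->
  exists C : R, exists N0 : nat, 0 <= C /\
  forall B N', (N0 <= B)%N -> (B ^ M <= N' <= 3 * B ^ M)%N ->
    \sum_(1 <= d < (B ^ (m + m).+1).+1) mx N' d <= C * ((B ^ M)%:R / ln B%:R ^+ A).
Proof.
move=> mx0 tt lev A0 M0 mM.
have /RltP e0 : 0 < vt - theta0 by rewrite subr_gt0.
have /RltP A0' : 0 < INR A by rewrite INRE ltr0n.
have [C0 [N0 h]] := lev _ _ e0 A0'.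
exists (3 * `|C0|), (maxn N0 3); split; first by rewrite mulr_ge0 ?ler0n ?normr_ge0.
move=> B N'; rewrite geq_max => /andP[NB B3] hN'.
apply: (@avg_transfer mx theta0 C0 N0) => // N NN; apply/RleP; have := h N NN.
by rewrite (_ : Rminus vt (vt - theta0) = theta0) // RminusE subKr.
Qed.

Lemma nat_above (x : R) : exists n : nat, x <= n%:R.
Proof.
by have [n h] := INR_unbounded x; exists n; rewrite -INRE; apply/ltW/RltP.
Qed.

Lemma ln_unbounded (L : R) : exists n : nat, forall s, (n <= s)%N -> L <= ln s%:R.
Proof.
have [n hn] := nat_above (exp L); exists n => s ns.
have e0 : 0 < exp L by apply/RltP/exp_pos.
rewrite -[leLHS]ln_exp; apply: (ler_ln ln_is_log) => //.
by apply: le_trans hn _; rewrite ler_nat.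
Qed.

Lemma trivial_errA (M N N' d : nat) (b : R) : (0 < d <= N)%N -> (0 < N' <= 3 * N)%N ->
  1 <= b -> ln (3 * N)%:R <= (M%:R + 2) * b ->
  max_errA N' d <= (4 * M + 11)%:R * (N%:R * b) / (totient d)%:R.
Proof.
move=> /andP[d0 dN] /andP[N'0 N'3] b1 lb.
apply: le_trans (max_errA_le d0 N'0) _.
have phi0 : 0 < (totient d)%:R :> R by rewrite ltr0n totient_gt0.
have d0' : 0 < d%:R :> R by rewrite ltr0n.
have lN' : ln N'%:R <= (M%:R + 2) * b.
  by apply: le_trans lb; rewrite (ler_ln ln_is_log) ?ltr0n // ler_nat.
have phid : (totient d)%:R <= d%:R :> R by rewrite ler_nat totient_le.
have N'F : N'%:R <= 3 * N%:R :> R by rewrite -natrM ler_nat.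
have NF : 0 <= N%:R :> R by rewrite ler0n.
have M0 : 0 <= M%:R :> R by rewrite ler0n.
have h1 : N'%:R / d%:R + 1 <= 4 * N%:R / (totient d)%:R :> R.
  have a1 : N'%:R / d%:R <= 3 * N%:R / (totient d)%:R :> R.
    by apply: ler_pM => //; rewrite ?ler0n ?invr_ge0 ?ler0n // lef_pV2 ?posrE.
  have a2 : 1 <= N%:R / (totient d)%:R :> R.
    rewrite ler_pdivlMr // mul1r ler_nat; exact: leq_trans (totient_le d) dN.
  have -> : 4 * N%:R / (totient d)%:R = 3 * N%:R / (totient d)%:R + N%:R / (totient d)%:R :> R by ring.
  exact: lerD.
have h2 : N'%:R / (totient d)%:R <= b * (3 * N%:R / (totient d)%:R).
  apply: (@le_trans _ _ (3 * N%:R / (totient d)%:R)); first by rewrite ler_wpM2r ?invr_ge0 ?(ltW phi0).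
  by rewrite ler_peMl // divr_ge0 ?ler0n // mulr_ge0 ?ler0n.
have h3 : ln N'%:R * (N'%:R / d%:R + 1) <= (M%:R + 2) * b * (4 * N%:R / (totient d)%:R).
  apply: ler_pM => //; first by rewrite (ln_ge0 ln_is_log) // ler1n.
  by rewrite addr_ge0 ?ler01 // divr_ge0 ?ler0n.
apply: le_trans (lerD h3 h2) _.
(* The constant is 4(M + 2) + 3. *)
rewrite le_eqVlt; apply/orP; left; apply/eqP.
by rewrite natrD natrM; ring.
Qed.

Lemma trivial_errB (N N' d : nat) (b : R) : (0 < d <= N)%N -> (0 < N' <= 3 * N)%N -> 1 <= b ->
  max_errB N' d <= 4 * (N%:R * b) / (totient d)%:R.
Proof.
move=> /andP[d0 dN] /andP[N'0 N'3] b1.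
apply: le_trans (max_errB_le N' d0) _.
have phi0 : 0 < (totient d)%:R :> R by rewrite ltr0n totient_gt0.
have d0' : 0 < d%:R :> R by rewrite ltr0n.
have phid : (totient d)%:R <= d%:R :> R by rewrite ler_nat totient_le.
have N'F : N'%:R <= 3 * N%:R :> R by rewrite -natrM ler_nat.
have a1 : N'%:R / d%:R <= 3 * N%:R / (totient d)%:R :> R.
  by apply: ler_pM => //; rewrite ?ler0n ?invr_ge0 ?ler0n // lef_pV2 ?posrE.
have a2 : 1 <= N%:R / (totient d)%:R :> R.
  rewrite ler_pdivlMr // mul1r ler_nat; exact: leq_trans (totient_le d) dN.
apply: (@le_trans _ _ (4 * N%:R / (totient d)%:R)).
  have -> : 4 * N%:R / (totient d)%:R = 3 * N%:R / (totient d)%:R + N%:R / (totient d)%:R :> R by ring.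
  exact: lerD.
by rewrite ler_wpM2r ?invr_ge0 ?(ltW phi0) // ler_wpM2l ?ler0n // ler_peMr ?ler0n.
Qed.

Theorem gpy_liouville (k m M : nat) (H : seq nat) (c0 : nat) (f : nat -> R) (theta0 vt e : R) :
  (1 < k)%N -> size H = k -> uniq H -> admissible H ->
  (forall i, f i.+1 <= f i) -> (forall i, 0 <= f i) -> (forall i, (m < i)%N -> f i = 0) ->
  ((m + m).+1 + err_exp k <= M)%N -> (m + m).+1%:R <= theta0 * M%:R ->
  0 < e -> e <= 1 / 4 -> 0 < margin k m M f e ->
  theta0 < vt -> condA vt -> condB vt ->
  forall n0 : nat, exists N n : nat, [/\ (n0 <= N)%N, (N < n <= N + N)%N &
    ln (3 * N)%:R / 2 * (1 + liouville (n + c0)) < \sum_(h <- H) theta ln (n + h)].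
Proof.
move=> k1 Hsize Huniq adm fd f0 fm mM mMt e0 e1 marg tt cA cB n0.
have A0 : (0 < err_exp k)%N by rewrite /err_exp addn_gt0 orbT.
have M0 : (0 < M)%N by apply: leq_trans mM.
have [CA [NA [CA0 hA]]] := @level_avg max_errA _ _ _ _ _ (fun _ _ => maxR_ge0 _) tt cA A0 M0 mMt.
have [CB [NB [CB0 hB]]] := @level_avg max_errB _ _ _ _ _ (fun _ _ => maxR_ge0 _) tt cB A0 M0 mMt.
have [D1 hD1] := nat_above (k%:R / e).
pose hmax := (\max_(h <- H) h)%N.
(* [D1] makes the corrections at primes above [D0] at most e; [hmax] and [c0] make all shifts
   smaller than [D0], hence than N. *)
pose D0 := (k + D1 + hmax + c0).+1.
have kD0 : (k < D0)%N by rewrite ltnS -!addnA leq_addr.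
have c0D0 : (c0 < D0)%N by rewrite ltnS leq_addl.
have HD0 h : h \in H -> (h < D0)%N.
  move=> hH; rewrite ltnS (leq_trans _ (leq_addr _ _)) // (leq_trans _ (leq_addl _ _)) //.
  exact: leq_bigmax_seq.
have De : k%:R / (D0 - k)%N%:R <= e.
  rewrite ler_pdivrMr ?ltr0n ?subn_gt0 // mulrC -ler_pdivrMr //.
  apply: le_trans hD1 _; rewrite ler_nat /D0 -!addnA -addnS addKn.
  by rewrite (leq_trans (leq_addr (hmax + c0) _)).
have [v0 Hv0] := admissible_residue D0 adm.
have W0 : (0 < D0`!)%N by apply: fact_gt0.
pose W := D0`!.
(* Each sum over (N, 2N] is a difference of two initial sums, which doubles the constants; 8M + 22
   is twice the 4M + 11 of [trivial_errA]. *)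
pose C1 := 2 * CA + 2 * CB; pose C2 : R := (8 * M + 22)%:R.
have C10 : 0 <= C1 by rewrite addr_ge0 // mulr_ge0 ?ler0n.
have C20 : 0 <= C2 by rewrite ler0n.
pose Big : R := 2 * W%:R * (k%:R * err_const k m f C1 C2
              + M%:R * (1 + e) * (err_const k m f 1 1 + err_const k m f C1 C2)).
pose dn : R := ((totient W)%:R / W%:R) ^+ k * margin k m M f e.
have dn0 : 0 < dn by rewrite mulr_gt0 // exprn_gt0 // divr_gt0 ?ltr0n ?totient_gt0.
(* [W] and all constants are fixed before [s], so three lower bounds on ln B can be imposed by
   taking [s] large. *)
have [s1 hs1] := ln_unbounded ((W%:R + 1) / e).
have [s2 hs2] := ln_unbounded (2 / (e * M%:R)).
have [s3 hs3] := ln_unbounded (Big / dn + 1).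
pose s := (s1 + s2 + s3 + NA + NB + n0 + 2)%N.
pose B := (W * s)%N.
have sB : (s <= B)%N by rewrite leq_pmull.
have s_gt1 : (1 < s)%N by rewrite /s addn2.
have le_s x y z : (x + y <= z -> x <= z)%N by move=> h; apply: leq_trans h; apply: leq_addr.
have le_s' x y z : (x + y <= z -> y <= z)%N by move=> h; apply: leq_trans h; apply: leq_addl.
have sB6 := le_s _ _ _ sB; have n0B := le_s' _ _ _ sB6.
have sB5 := le_s _ _ _ sB6; have NBB := le_s' _ _ _ sB5.
have sB4 := le_s _ _ _ sB5; have NAB := le_s' _ _ _ sB4.
have sB3 := le_s _ _ _ sB4; have s3B := le_s' _ _ _ sB3.
have sB2 := le_s _ _ _ sB3; have s2B := le_s' _ _ _ sB2; have s1B := le_s _ _ _ sB2.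
have {}hs1 := hs1 B s1B; have {}hs2 := hs2 B s2B; have {}hs3 := hs3 B s3B.
have MF : 0 < M%:R :> R by rewrite ltr0n.
have Be : W%:R + 1 <= e * ln B%:R by rewrite mulrC -ler_pdivrMr.
have Me : 2 <= e * (M%:R * ln B%:R) by rewrite mulrA mulrC -ler_pdivrMr // mulr_gt0.
have big : Big < dn * ln B%:R.
  by rewrite mulrC -ltr_pdivrMr //; apply: lt_le_trans hs3; rewrite ltrDl ltr01.
have b1 := lnB_ge1 ln_is_log s_gt1 e0 e1 Be; rewrite -/B in b1.
have B1 : (1 < B)%N by apply: leq_trans sB.
pose N := (B ^ M)%N.
have BN : (B <= N)%N by rewrite -{1}(expn1 B) leq_exp2l.
have D0B : (D0 <= B)%N.
  have D0W : (D0 <= W)%N by apply: dvdn_leq => //; apply: dvdn_fact; rewrite leqnn.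
  by apply: leq_trans D0W _; rewrite leq_pmulr // ltnW.
have rangeN h : (h < D0)%N ->
   (N <= N + h + N <= 3 * N)%N /\ (N <= N + h <= 3 * N)%N.
  move=> hD; have hN : (h <= N)%N by apply: leq_trans BN; apply: leq_trans D0B; apply: ltnW.
  by clear -hN; split; lia.
have N0 : (0 < N)%N by rewrite expn_gt0 ltnW.
have rangeN' n : (N <= n <= 3 * N)%N -> (0 < n <= 3 * N)%N.
  by case/andP => a ->; rewrite (leq_trans N0 a).
have dN d : (0 < d <= B ^ (m + m).+1)%N -> (0 < d <= N)%N.
  case/andP => -> dB; rewrite (leq_trans dB) // leq_exp2l //.
  by apply: leq_trans mM; apply: leq_addr.
have lb : ln (3 * N)%:R <= (M%:R + 2) * ln B%:R.
  rewrite natrM (lnM ln_is_log) ?ltr0n // natrX (lnX ln_is_log) ?ltr0n ?(ltnW B1) //.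
  have h3 := ln_le_sub1 ln_is_log (ltr0Sn R 2).
  rewrite mulrDl addrC lerD2l; apply: le_trans h3 _.
  have -> : 3 - 1 = 2 * 1 :> R by ring.
  by rewrite ler_wpM2l ?ler0n.
have := @sieve_positive R ln ln_is_log k D0 s m M H f v0 k1 kD0 s_gt1 Hsize Huniq HD0 Hv0 fd f0 fm mM
  e C1 C2 (fun h d => max_errA (N + h + N) d + max_errA (N + h) d)
  (fun d => 2 * max_errB (N + c0 + N) d) (fun n => liouville (n + c0)) e0 e1 De Be Me C10 C20 big.
rewrite -/W -/B -/N => pos.
have [||||||||n nr hn] := pos.
- by move=> h d _; rewrite addr_ge0 ?maxR_ge0.
- move=> h d c hH dB ch; have /andP[d0 _] := dB.
  rewrite ap_sum_shift.
  (* The main term is split as the difference of those for the end points 2N + h and N + h. *)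
  have -> (x y z : R) : x - y - z = (x - (z + h%:R / (totient d)%:R + z)) - (y - (z + h%:R / (totient d)%:R)).
    by ring.
  apply: le_trans (ler_normB _ _) _; rewrite -!mulrDl -!natrD; apply: lerD; exact: max_errA_ge.
- move=> h d hH dB; have [r1 r2] := rangeN h (HD0 h hH).
  have -> : C2 * (N%:R * ln B%:R) / (totient d)%:R
     = (4 * M + 11)%:R * (N%:R * ln B%:R) / (totient d)%:R + (4 * M + 11)%:R * (N%:R * ln B%:R) / (totient d)%:R.
    by rewrite /C2 !natrD !natrM; ring.
  by apply: lerD; apply: trivial_errA; rewrite ?dN ?rangeN'.
- move=> h hH; have [r1 r2] := rangeN h (HD0 h hH).
  rewrite big_split /=; apply: le_trans (lerD (hA _ _ NAB r1) (hA _ _ NAB r2)) _.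
  rewrite -/N -mulrDl ler_wpM2r ?divr_ge0 ?exprn_ge0 ?ler0n ?(le_trans _ b1) //.
  by rewrite /C1 -[CA in CA + CA]mul1r -mulrDl lerDl mulr_ge0 ?ler0n.
- by move=> d; rewrite mulr_ge0 ?ler0n ?maxR_ge0.
- move=> d c dB; have /andP[d0 _] := dB; rewrite ap_sum_shift.
  apply: le_trans (ler_normB _ _) _; rewrite mulr_natl mulr2n.
  apply: lerD; apply: max_errB_ge => //; rewrite leq_addr //.
- move=> d dB; have [r1 _] := rangeN c0 c0D0.
  apply: (@le_trans _ _ (2 * (4 * (N%:R * ln B%:R) / (totient d)%:R))).
    by rewrite ler_wpM2l ?ler0n //; apply: trivial_errB; rewrite ?dN ?rangeN'.
  rewrite !mulrA -natrM ler_wpM2r ?invr_ge0 ?ler0n // ler_wpM2r ?(le_trans _ b1) //.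
  rewrite ler_wpM2r ?ler0n // /C2 ler_nat; clear; lia.
- have [r1 _] := rangeN c0 c0D0; rewrite -mulr_sumr.
  apply: (@le_trans _ _ (2 * (CB * ((B ^ M)%:R / ln B%:R ^+ err_exp k)))).
    by rewrite ler_wpM2l ?ler0n //; apply: hB.
  rewrite mulrA ler_wpM2r ?divr_ge0 ?exprn_ge0 ?ler0n ?(le_trans _ b1) //.
  by rewrite /C1 lerDr mulr_ge0 ?ler0n.
exists N, n; split=> //; first exact: leq_trans n0B BN.
by move: nr; rewrite mem_iota addSn ltnS.
Qed.

(** * Consequences for primes *)

(** Euclid: a prime factor of m! + 1 exceeds m, so the list searched by [next_prime] is not empty
    and the default 0 is not returned. *)
Lemma next_primeP m : (1 < m)%N ->
  [/\ prime (next_prime m), (m < next_prime m)%N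
    & forall p, prime p -> (m < p)%N -> (next_prime m <= p)%N].
Proof.
move=> m1.
pose l := [seq x <- iota m.+1 m`! | prime x].
have f1 : (1 < m`!.+1)%N by rewrite ltnS fact_gt0.
have [q qp qd] : exists2 q, prime q & (q %| m`!.+1)%N.
  by exists (pdiv m`!.+1); rewrite ?pdiv_prime ?pdiv_dvd.
have mq : (m < q)%N.
  rewrite ltnNge; apply/negP => qm.
  have d : (q %| m`!)%N by rewrite dvdn_fact // prime_gt0.
  by move: qd; rewrite -addn1 dvdn_addr // dvdn1 => /eqP h; rewrite h in qp.
have ql : q \in l.
  rewrite mem_filter qp mem_iota mq /= addSn ltnS.
  by apply: leq_trans (dvdn_leq (ltn0Sn _) qd) _; rewrite -add1n leq_add2r ltnW.
have : sorted ltn l by apply: sorted_filter; [exact: ltn_trans | exact: iota_ltn_sorted].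
have nE : next_prime m = nth 0%N l 0 by [].
case: l ql nE (erefl l : l = [seq x <- iota m.+1 m`! | prime x]) => // x l' ql nE lE srt.
have : x \in [seq x <- iota m.+1 m`! | prime x] by rewrite -lE inE eqxx.
rewrite nE /= mem_filter mem_iota => /and3P[px mx xm]; split => // p pp mp.
have [pm|pm] := ltnP p (m.+1 + m`!); last by apply: leq_trans pm; apply: ltnW.
have : p \in x :: l' by rewrite lE mem_filter pp mem_iota mp pm.
rewrite inE => /orP[/eqP -> //|pl'].
by move/(order_path_min ltn_trans)/allP: srt => /(_ p pl') /ltnW.
Qed.

Lemma nth_prime_prime n : prime (nth_prime n).
Proof.
by elim: n => //= n IH; have [] := next_primeP (prime_gt1 IH).
Qed.

Lemma nth_prime_step n : (nth_prime n < nth_prime n.+1)%N.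
Proof. by have [] := next_primeP (prime_gt1 (nth_prime_prime n)). Qed.

Lemma nth_prime_mono i j : (i <= j)%N -> (nth_prime i <= nth_prime j)%N.
Proof.
elim: j => [|j IH]; first by rewrite leqn0 => /eqP ->.
rewrite leq_eqVlt => /orP[/eqP -> //|/IH h].
exact: leq_trans h (ltnW (nth_prime_step j)).
Qed.

Lemma nth_prime_gt n : (n < nth_prime n)%N.
Proof. by elim: n => // n IH; apply: leq_ltn_trans IH (nth_prime_step n). Qed.

Lemma nth_prime_onto p : prime p -> exists n, nth_prime n = p.
Proof.
move=> pp; suff h n : (exists j, nth_prime j = p) \/ (nth_prime n < p)%N.
  by have [//|] := h p; rewrite ltnNge ltnW ?nth_prime_gt.
elim: n => [|n [|IH]]; try by left.
  by have := prime_gt1 pp; rewrite leq_eqVlt => /orP[/eqP <-|]; [left; exists 0%N | right].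
have [_ _ /(_ p pp IH)] := next_primeP (prime_gt1 (nth_prime_prime n)).
by rewrite leq_eqVlt => /orP[/eqP <-|]; [left; exists n.+1 | right].
Qed.

Lemma liminf_prime_gap_le (D : nat) :
  (forall n0 : nat, exists p p' : nat, [/\ prime p, prime p', (n0 <= p < p')%N & (p' <= p + D)%N]) ->
  Rbar_le (LimInf_seq prime_gap) (Rbar.Finite (INR D)).
Proof.
move=> hyp.
have freq N : exists n, (N <= n)%coq_nat /\ Rle (prime_gap n) (INR D).
  have [p [p' [pp pp' /andP[Np lpp'] le_p']]] := hyp (nth_prime N).
  have [n nE] := nth_prime_onto pp; exists n; split.
    apply/ssrnat.leP; rewrite leqNgt; apply/negP => nN.
    have := leq_trans (nth_prime_step n) (nth_prime_mono nN).
    by rewrite nE ltnNge Np.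
  apply: le_INR; apply/ssrnat.leP; rewrite leq_subLR nE.
  apply: leq_trans le_p' => /=; rewrite nE.
  by have [_ _] := next_primeP (prime_gt1 pp); apply.
have : is_LimInf_seq prime_gap (LimInf_seq prime_gap) by exact: proj2_sig (ex_LimInf_seq _).
case: (LimInf_seq prime_gap) => [l||] //= h.
- apply: Rnot_lt_le => lt.
  have e0 : Rlt 0 (Rminus l (INR D)) by Lra.lra.
  have [_ [N hN]] := h (mkposreal _ e0).
  have [n [Nn gn]] := freq N; have := hN n Nn; rewrite /=; Lra.lra.
- have [N hN] := h (INR D).
  by have [n [Nn gn]] := freq N; have := hN n Nn; Lra.lra.
Qed.

Lemma bound_list (P : nat -> nat -> Prop) (H : seq nat) :
  (forall h, h \in H -> exists M, forall p, (M <= p)%N -> P h p) ->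
  exists M, forall h p, h \in H -> (M <= p)%N -> P h p.
Proof.
elim: H => [|h H IH] hyp; first by exists 0%N.
have [|M1 h1] := IH; first by move=> h' h'H; apply: hyp; rewrite inE h'H orbT.
have [M2 h2] := hyp h (mem_head _ _).
exists (maxn M1 M2) => h' p; rewrite inE geq_max => /orP[/eqP ->|h'H] /andP[p1 p2].
  exact: h2.
exact: h1.
Qed.

Lemma liouville_pm1 n : liouville n = 1 \/ liouville n = -1.
Proof.
rewrite /liouville; elim: (bigOmega n) => [|j [] IH] /=; first by left.
- by right; rewrite IH RmultE mulr1.
- by left; rewrite IH RmultE (_ : IZR (-1) = -1) // mulrNN mulr1.
Qed.

(** If no shift d = c0 - h works, then lambda(p + c0 - h) is not -1 for large primes p. A positive
    term has some prime n + h1, so lambda(n + c0) = 1; the penalty is then ln(3N), which one prime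
    cannot beat, and a second prime n + h2 appears. *)
Lemma dichotomy (H : seq nat) (c0 D4 D3 : nat) :
  uniq H ->
  (forall h, h \in H -> h <> c0 /\ (h <= c0 + D4)%N /\ (c0 <= h + D4)%N) ->
  (forall h h', h \in H -> h' \in H -> (h' <= h + D3)%N) ->
  (forall n0 : nat, exists N n : nat, [/\ (n0 <= N)%N, (N < n <= N + N)%N &
    ln (3 * N)%:R / 2 * (1 + liouville (n + c0)) < \sum_(h <- H) theta ln (n + h)]) ->
  (exists d : Z, d <> Z0 /\ Z.le (Z.abs d) (Z.of_nat D4) /\
     forall M : nat, exists p : nat, (M <= p)%N /\ prime p /\
       Z.lt Z0 (Z.of_nat p + d) /\ liouville (Z.to_nat (Z.of_nat p + d)) = -1)
  \/ Rbar_le (LimInf_seq prime_gap) (Rbar.Finite (INR D3)).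
Proof.
move=> uH Hc HD hyp; apply: NNPP => /not_or_and[noi]; apply.
have [M hM] : exists M, forall h p, h \in H -> (M <= p)%N -> prime p ->
    liouville (p + c0 - h) <> -1.
  apply: bound_list => h hH; apply: NNPP => nex; apply: noi.
  have [hc [h1 h2]] := Hc h hH.
  (* Only p > h are considered below, so the truncated subtraction [p + c0 - h] agrees with the one
     in [Z]. *)
  exists (Z.sub (Z.of_nat c0) (Z.of_nat h)); split; [|split]; [lia | lia |] => M.
  apply: NNPP => nop; apply: nex; exists (maxn M h.+1) => p.
  rewrite geq_max => /andP[Mp hp] pp lp; apply: nop; exists p; split=> //; split=> //.
  split; first by lia.
  by have -> : Z.to_nat (Z.add (Z.of_nat p) (Z.sub (Z.of_nat c0) (Z.of_nat h))) = (p + c0 - h)%N by lia.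
apply: liminf_prime_gap_le => n0.
pose hmax := (\max_(h <- H) h)%N.
have [N [n [nN /andP[Nn nN2] pos]]] := hyp (maxn (maxn n0 M) hmax).
move: nN; rewrite !geq_max => /andP[/andP[n0N MN] hN].
have N0 : (0 < N)%N by case: (N) Nn nN2 => // h1 h2; have := leq_trans h1 h2.
have L0 : 0 <= ln (3 * N)%:R by rewrite (ln_ge0 ln_is_log) // ler1n muln_gt0.
have th_le h : h \in H -> theta ln (n + h) <= ln (3 * N)%:R.
  move=> hH; apply: le_trans (ler_norm _) _; apply: theta_norm_le; last by rewrite muln_gt0.
  have h2 : (h <= hmax)%N by apply: leq_bigmax_seq.
  have h3 := leq_trans h2 hN; clear -h3 nN2; lia.
have th0 h : ~~ prime (n + h) -> theta ln (n + h) = 0 by move=> np; rewrite /theta (negbTE np).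
have [h1 h1H p1] : exists2 h, h \in H & prime (n + h).
  apply/hasP; apply: contraT => /hasPn none.
  have S0 : \sum_(h <- H) theta ln (n + h) = 0.
    by rewrite big_seq big1 // => h hH; apply: th0; apply: none.
  move: pos; rewrite S0 ltNge mulr_ge0 ?divr_ge0 ?ler0n //.
  by have [->|->] := liouville_pm1 (n + c0); rewrite ?subrr ?addr_ge0 ?ler01.
have big_n h : (M <= n + h)%N.
  by apply: leq_trans MN _; apply: leq_trans (ltnW Nn) _; apply: leq_addr.
have l1 : liouville (n + c0) = 1.
  have [//|lm] := liouville_pm1 (n + c0).
  by case: (hM h1 (n + h1)%N h1H (big_n h1) p1); rewrite addnAC addnK.
have [h2 h2H /andP[h21 p2]] : exists2 h, h \in H & (h != h1) && prime (n + h).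
  apply/hasP; apply: contraT => /hasPn none.
  have S0 : \sum_(h <- H) theta ln (n + h) = theta ln (n + h1).
    rewrite (bigD1_seq h1) //= big_seq_cond big1 ?addr0 // => h /andP[hH hh1].
    by apply: th0; have := none h hH; rewrite hh1.
  move: pos; rewrite S0 l1 ltNge.
  have -> : ln (3 * N)%:R / 2 * (1 + 1) = ln (3 * N)%:R :> R by field.
  by rewrite th_le.
have n0n h : (n0 <= n + h)%N.
  by apply: leq_trans n0N _; apply: leq_trans (ltnW Nn) _; apply: leq_addr.
have [lt|gt|eq] := ltngtP h1 h2; last by rewrite eq eqxx in h21.
- exists (n + h1)%N, (n + h2)%N; split=> //; first by rewrite n0n ltn_add2l.
  by rewrite -addnA leq_add2l HD.
- exists (n + h2)%N, (n + h1)%N; split=> //; first by rewrite n0n ltn_add2l.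
  by rewrite -addnA leq_add2l HD.
Qed.

(** * Numerical verification *)

Delimit Scope Z_scope with ZZ.

(** Falling factorials replace the binomials, and binary integers keep the evaluation by
    [vm_compute] feasible. *)
Fixpoint ffactZ (n : Z) (j : nat) : Z :=
  if j is j'.+1 then (n * ffactZ (Z.pred n) j')%ZZ else Zpos xH.

(* With [t = i / m] this is [m^2 (a - b t + c t^2)], chosen close to the optimal profile
   [J_(k-1)(j sqrt t) / t^((k-1)/2)], [j] being the first zero of [J_(k-2)]. *)
Definition weightZ (a b c m i : Z) : Z := (a * (m * m) - b * (i * m) + c * (i * i))%ZZ.

Fixpoint sumZ (g : Z -> Z) (n : nat) (i : Z) : Z :=
  if n is n'.+1 then (g i + sumZ g n' (Z.succ i))%ZZ else Z0.

(** The recursion runs down from [a = m] and carries the current tail sum in [phi], so the double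
    sum takes linear time. *)
Fixpoint tailZ (k : nat) (g : Z -> Z) (n : nat) (a phi : Z) : Z :=
  if n is n'.+1 then
    (phi * phi * ffactZ (Z.pred a) (k.-2) + tailZ k g n' (Z.pred a) (phi + g a))%ZZ
  else Z0.

(* Positivity of [margin] at [e = 1 / q], multiplied by
   [(k - 1)! (q + 1)^(k+1) (q - 1)^k q]. *)
Definition margin_check (k : nat) (m M a b c q : Z) : bool :=
  let g := weightZ a b c m in
  let T := sumZ (fun i => g i * g i * ffactZ (i + Z.of_nat k.-1) k.-1)%ZZ (Z.to_nat m).+1 Z0 in
  let Ts := tailZ k g (Z.to_nat m) m Z0 in
  Z.ltb (M * (Z.pow (q + Zpos xH) (Z.of_nat (2 * k + 2)) * T))
        (Z.of_nat (2 * k) * (Z.pow (q - Zpos xH) (Z.of_nat (2 * k + 1)) * (q * (Z.of_nat k.-1 * Ts))))%ZZ.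

Lemma IZR_ffactZ n j : IZR (ffactZ (Z.of_nat n) j) = (n ^_ j)%:R.
Proof.
elim: j n => [|j IH] n //; rewrite ffactnS natrM /= mult_IZR -INR_IZR_INZ INRE.
case: n => [|n]; first by rewrite RmultE !mul0r.
by rewrite (_ : Z.pred (Z.of_nat n.+1) = Z.of_nat n) ?IH //; lia.
Qed.

Lemma IZR_sumZ g n i : IZR (sumZ g n (Z.of_nat i)) = \sum_(j < n) IZR (g (Z.of_nat (i + j))).
Proof.
elim: n i => [|n IH] i; first by rewrite big_ord0.
rewrite big_ord_recl [sumZ _ _ _]/= plus_IZR addn0 RplusE; congr (_ + _).
rewrite (_ : Z.succ (Z.of_nat i) = Z.of_nat i.+1) ?IH; last by lia.
by apply: eq_bigr => j _; rewrite /bump /= addnCA addSn.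
Qed.

Lemma tailsum_rec (m : nat) (f : nat -> R) a : (forall i, (m < i)%N -> f i = 0) ->
  tailsum m f a = f a.+1 + tailsum m f a.+1.
Proof.
move=> fm; rewrite /tailsum.
have : \sum_(l < m.+1) f (a + l.+1)%N = \sum_(l < m.+1) f (a + l.+1)%N by [].
rewrite {1}big_ord_recr big_ord_recl /= [f (a + m.+1)%N]fm ?addr0; last by rewrite addnS ltnS leq_addl.
move=> ->; rewrite addn1; congr (_ + _); apply: eq_bigr => l _.
by rewrite /bump /= add1n addSnnS.
Qed.

Lemma IZR_tailZ k g m (f : nat -> R) n phi :
  (forall i, (m < i)%N -> f i = 0) -> (n <= m)%N ->
  (forall i, (i <= m)%N -> f i = IZR (g (Z.of_nat i))) ->
  IZR phi = tailsum m f n ->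
  IZR (tailZ k g n (Z.of_nat n) phi) = \sum_(a < n) tailsum m f a.+1 ^+ 2 * (a ^_ k.-2)%:R.
Proof.
move=> fm + fg; elim: n phi => [|n IH] phi nm hphi; first by rewrite big_ord0.
have E1 : Z.pred (Z.of_nat n.+1) = Z.of_nat n by lia.
have step x : tailZ k g n.+1 x phi
   = (phi * phi * ffactZ (Z.pred x) k.-2 + tailZ k g n (Z.pred x) (phi + g x))%ZZ by [].
rewrite big_ord_recr step E1 plus_IZR !mult_IZR IZR_ffactZ hphi RplusE addrC.
congr (_ + _); apply: IH; first exact: ltnW.
by rewrite plus_IZR hphi -fg // RplusE addrC -tailsum_rec.
Qed.

Lemma IZR_pow x n : IZR (Z.pow x (Z.of_nat n)) = IZR x ^+ n.
Proof. by rewrite -pow_IZR RpowE. Qed.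

Lemma margin_clear (F : realFieldType) (k : nat) (K2 M Q T Ts P : F) : 1 < Q -> 0 < P ->
  M * ((Q + 1) ^+ (2 * k + 2) * (P * T)) < K2 * ((Q - 1) ^+ (2 * k + 1) * (Q * (P * Ts))) ->
  0 < K2 * ((1 - Q^-1) / (1 + Q^-1)) ^+ k.+1 * Ts
      - M * (1 + Q^-1) * ((1 + Q^-1) / (1 - Q^-1)) ^+ k * T.
Proof.
move=> Q1 P0 h.
have Qp : 0 < Q + 1 by lra.
have Qm : 0 < Q - 1 by lra.
have Q0 : 0 < Q by lra.
have -> : (1 - Q^-1) / (1 + Q^-1) = (Q - 1) / (Q + 1).
  by field; rewrite ?(lt0r_neq0 Qp) ?(lt0r_neq0 Q0).
have -> : (1 + Q^-1) / (1 - Q^-1) = (Q + 1) / (Q - 1).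
  by field; rewrite ?(lt0r_neq0 Qm) ?(lt0r_neq0 Q0).
rewrite -(pmulr_rgt0 _ (_ : 0 < P * ((Q + 1) ^+ k.+1 * (Q - 1) ^+ k * Q))); last first.
  by rewrite !mulr_gt0 ?exprn_gt0.
rewrite -subr_gt0 in h; apply: lt_le_trans h _; rewrite le_eqVlt; apply/orP; left; apply/eqP.
rewrite !mul2n -!addnn !exprD !expr_div_n !exprS !expr0 !mulr1.
move: (expf_neq0 k (lt0r_neq0 Qp)) (expf_neq0 k (lt0r_neq0 Qm)).
move: ((Q + 1) ^+ k) ((Q - 1) ^+ k) => x y x0 y0.
by field; rewrite ?(lt0r_neq0 Qp) ?(lt0r_neq0 Qm) ?(lt0r_neq0 Q0) ?x0 ?y0.
Qed.

Definition weightR (a b c m : Z) (i : nat) : R :=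
  if (i <= Z.to_nat m)%N then IZR (weightZ a b c m (Z.of_nat i)) else 0.

Section Numeric.
Variables (k : nat) (m M a b c q : Z).
Hypotheses (k1 : (1 < k)%N) (m0 : (Z0 <= m)%ZZ) (M0 : (Z0 <= M)%ZZ) (q1 : (Zpos xH < q)%ZZ).
Hypotheses (c0 : (Z0 <= c)%ZZ) (bc : (c + c <= b)%ZZ) (abc : (b <= a + c)%ZZ).
Let m' := Z.to_nat m.
Let M' := Z.to_nat M.
Let f := weightR a b c m.
Let e : R := (IZR q)^-1.

Lemma weightR_out i : (m' < i)%N -> f i = 0.
Proof. by move=> h; rewrite /f /weightR leqNgt h. Qed.

Lemma weightR_ge0 i : 0 <= f i.
Proof.
rewrite /f /weightR; case: ifP => // im; apply/RleP; apply: IZR_le; rewrite /weightZ.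
have h : (Z.of_nat i <= m)%ZZ by lia.
have hx : (Z0 <= Z.of_nat i)%ZZ by lia.
move: (Z.of_nat i) h hx => x h hx.
(* Expansion in powers of m - x: the weight is (a + c - b) m^2 + (b - 2c) m (m - x) + c (m - x)^2,
   with nonnegative coefficients by hypothesis. *)
have h1 : (Z0 <= (a + c - b) * (m * m))%ZZ by apply: Z.mul_nonneg_nonneg; lia.
have h2 : (Z0 <= (b - (c + c)) * (m * (m - x)))%ZZ.
  by apply: Z.mul_nonneg_nonneg; [lia | apply: Z.mul_nonneg_nonneg; lia].
have h3 : (Z0 <= c * ((m - x) * (m - x)))%ZZ.
  by apply: Z.mul_nonneg_nonneg; [lia | apply: Z.mul_nonneg_nonneg; lia].
by clear -h1 h2 h3; lia.
Qed.

Lemma weightR_decr i : f i.+1 <= f i.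
Proof.
have [im|im] := ltnP i m'; last by rewrite weightR_out // weightR_ge0.
rewrite /f /weightR (ltnW im) im; apply/RleP; apply: IZR_le; rewrite /weightZ.
have h : (Z.of_nat i < m)%ZZ by lia.
have hx : (Z0 <= Z.of_nat i)%ZZ by lia.
rewrite (_ : Z.of_nat i.+1 = Z.succ (Z.of_nat i)); last by lia.
move: (Z.of_nat i) h hx => x h hx.
have h2 : (Z0 <= (b - (c + c)) * m)%ZZ by apply: Z.mul_nonneg_nonneg; lia.
have h3 : (Z0 <= c * (m - Z.succ x))%ZZ by apply: Z.mul_nonneg_nonneg; lia.
by move: c0; clear -h2 h3 hx; lia.
Qed.

Lemma margin_pos : margin_check k m M a b c q -> 0 < margin k m' M' f e.
Proof.
move=> /Z.ltb_lt chk.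
have kk0 : (0 < k)%N by exact: ltnW.
have q0 : 1 < IZR q :> R by apply/RltP; apply: IZR_lt.
have fg i : (i <= m')%N -> f i = IZR (weightZ a b c m (Z.of_nat i)) by move=> h; rewrite /f /weightR h.
have TE : IZR (sumZ (fun i => weightZ a b c m i * weightZ a b c m i * ffactZ (i + Z.of_nat k.-1) k.-1)%ZZ m'.+1 Z0)
   = (k.-1)`!%:R * main_sum k m' f.
  rewrite (IZR_sumZ _ _ 0) /main_sum mulr_sumr; apply: eq_bigr => i _; rewrite add0n.
  rewrite !mult_IZR -fg; last by rewrite -ltnS.
  rewrite -Nat2Z.inj_add IZR_ffactZ -bin_ffact natrM !RmultE plusE; ring.
have TsE : IZR (tailZ k (weightZ a b c m) m' m Z0) = (k.-2)`!%:R * main_sum' k m' f.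
  have mE : m = Z.of_nat m' by rewrite Z2Nat.id.
  rewrite [X in tailZ _ _ _ X _]mE (@IZR_tailZ _ _ m' f) //; last first.
  - rewrite /tailsum big1 // => l _; apply: weightR_out; lia.
  - exact: weightR_out.
  rewrite /main_sum' mulr_sumr; apply: eq_bigr => x _.
  by rewrite -bin_ffact natrM; ring.
move/IZR_lt/RltP: chk; rewrite !mult_IZR !IZR_pow TE TsE plus_IZR minus_IZR.
have -> : IZR M = M'%:R by rewrite -INRE INR_IZR_INZ Z2Nat.id.
rewrite -!INR_IZR_INZ !INRE !RmultE RplusE RminusE.
have -> : (k.-1)`!%:R = k.-1%:R * (k.-2)`!%:R :> R.
  by rewrite -natrM; case: (k) k1 => [|[|j]] // _; rewrite -factS.
move=> h; apply: (@margin_clear _ _ _ _ _ _ _ (k.-1%:R * (k.-2)`!%:R)) => //.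
  by rewrite mulr_gt0 // ltr0n ?fact_gt0 //; case: (k) k1 => [|[]].
by move: h; rewrite !mulrA.
Qed.

End Numeric.

Lemma tuple_dichotomy (H : seq nat) (k c0 D4 D3 : nat) (m M a b c t : Z) (theta0 vt : R) :
  (1 < k)%N -> size H = k -> uniq H ->
  all (fun p => has (fun a => all (fun h => ~~ (p %| a + h)%N) H) (iota 0 p))
      [seq p <- iota 0 (size H).+1 | prime p] ->
  all (fun h => [&& h != c0, h <= c0 + D4 & c0 <= h + D4]%N) H ->
  all (fun h => all (fun h' => h' <= h + D3)%N H) H ->
  (Z0 <= m)%ZZ -> (Z0 <= c)%ZZ -> (c + c <= b)%ZZ -> (b <= a + c)%ZZ ->
  (m + m + Z.of_nat (err_exp k).+1 <= M)%ZZ -> (1000%ZZ * (m + m + 1%ZZ) <= t * M)%ZZ ->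
  theta0 = Rdiv (IZR t) (IZR 1000) ->
  margin_check k m M a b c 100000%ZZ ->
  theta0 < vt -> condA vt -> condB vt ->
  (exists d : Z, d <> Z0 /\ Z.le (Z.abs d) (Z.of_nat D4) /\
     forall M : nat, exists p : nat, (M <= p)%N /\ prime p /\
       Z.lt Z0 (Z.of_nat p + d) /\ liouville (Z.to_nat (Z.of_nat p + d)) = -1)
  \/ Rbar_le (LimInf_seq prime_gap) (Rbar.Finite (INR D3)).
Proof.
move=> k1 Hs uH adm /allP Hc /allP HD m0 c00 bc abc mM mMt tE chk tt cA cB.
have M0 : (Z0 <= M)%ZZ by lia.
apply: (@dichotomy H c0) => //.
- by move=> h /Hc /and3P[/eqP].
- by move=> h h' /HD /allP hh /hh.
have q1 : (1 < 100000)%ZZ by [].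
have Q4 : 4 <= IZR 100000 :> R.
  by rewrite IZRposE INRE ler_nat; apply: (@leq_trans 100).
have [le_mM le_mMt] : ((Z.to_nat m + Z.to_nat m).+1 + err_exp k <= Z.to_nat M)%N /\
    (1000 * (Z.to_nat m + Z.to_nat m).+1)%N%:R <= IZR t * (Z.to_nat M)%:R :> R.
  split; first by lia.
  rewrite -!INRE !INR_IZR_INZ -RmultE -mult_IZR; apply/RleP/IZR_le; lia.
apply: (@gpy_liouville k (Z.to_nat m) (Z.to_nat M) H c0 (weightR a b c m) theta0 vt
          (IZR 100000)^-1) => //.
- exact: admissible_small.
- exact: weightR_decr.
- exact: weightR_ge0.
- by move=> i; apply: weightR_out.
- rewrite tE RdivE (_ : IZR 1000 = 1000%:R) ?IZRposE ?INRE //.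
  by rewrite mulrAC ler_pdivlMr ?ltr0n // mulrC -natrM.
- by rewrite invr_gt0; apply: lt_le_trans Q4; rewrite ltr0n.
- by rewrite div1r lef_pV2 ?posrE ?ltr0n //; apply: lt_le_trans Q4; rewrite ltr0n.
- exact: margin_pos.
Qed.

(** In the four checks [m] is the largest integer with [2m + 1 <= theta0 * M]. [M] is in the
    thousands because the shifted binomials in the two sums cost a relative error of order 1/m. *)
Lemma margin_check2 : margin_check 2 1093 3000 20 13 2 100000.
Proof. by vm_compute. Qed.
Lemma margin_check3 : margin_check 3 2771 9000 20 21 6 100000.
Proof. by vm_compute. Qed.
Lemma margin_check4 : margin_check 4 3600 13000 20 26 9 100000.
Proof. by vm_compute. Qed.
Lemma margin_check5 : margin_check 5 4119 16000 20 30 12 100000.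
Proof. by vm_compute. Qed.

(* MathComp's [int_scope] had taken over the key [Z]. *)
Delimit Scope Z_scope with Z.
Open Scope R_scope.

Theorem theorem7 (theta0 : R) (D4 D3 : nat) (theta : R) :
  ((theta0 = 729 / 1000 /\ D4 = 1%N /\ D3 = 2%N) \/
   (theta0 = 616 / 1000 /\ D4 = 3%N /\ D3 = 6%N) \/
   (theta0 = 554 / 1000 /\ D4 = 4%N /\ D3 = 8%N) \/
   (theta0 = 515 / 1000 /\ D4 = 7%N /\ D3 = 12%N)) ->
  theta0 < theta -> condA theta -> condB theta ->
  (exists d : Z, d <> 0%Z /\ (Z.abs d <= Z.of_nat D4)%Z /\
     forall M : nat, exists p : nat, (M <= p)%N /\ prime p /\
       (0 < Z.of_nat p + d)%Z /\ liouville (Z.to_nat (Z.of_nat p + d)) = -1)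
  \/ Rbar_le (LimInf_seq prime_gap) (INR D3).
Proof.
move=> cases /RltP tt cA cB.
case: cases => [|[|[|]]] [tE [-> ->]].
(* [c0] is the midpoint 1, 3, 4 of the first three tuples. In the last one the midpoint 6 belongs to
   the tuple and would allow d = 0, so 5 is taken, whence D4 = 7. *)
- apply: (@tuple_dichotomy [:: 0%N; 2%N] 2 1 1 2 1093%Z 3000%Z 20%Z 13%Z 2%Z 729%Z theta0 theta
    _ _ _ _ _ _ _ _ _ _ _ _ tE margin_check2 tt cA cB) => //; lia.
- apply: (@tuple_dichotomy [:: 0%N; 2%N; 6%N] 3 3 3 6 2771%Z 9000%Z 20%Z 21%Z 6%Z 616%Z theta0 theta
    _ _ _ _ _ _ _ _ _ _ _ _ tE margin_check3 tt cA cB) => //; lia.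
- apply: (@tuple_dichotomy [:: 0%N; 2%N; 6%N; 8%N] 4 4 4 8 3600%Z 13000%Z 20%Z 26%Z 9%Z 554%Z theta0 theta
    _ _ _ _ _ _ _ _ _ _ _ _ tE margin_check4 tt cA cB) => //; lia.
- apply: (@tuple_dichotomy [:: 0%N; 2%N; 6%N; 8%N; 12%N] 5 5 7 12 4119%Z 16000%Z 20%Z 30%Z 12%Z 515%Z theta0 theta
    _ _ _ _ _ _ _ _ _ _ _ _ tE margin_check5 tt cA cB) => //; lia.
Qed.
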